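(* Let $E$ be a separable Hilbert space and let $\xi\in H^\infty(\mathbb{D},E)$. Let $C_\xi:H^2(\mathbb{D},E)\to H^2(\mathbb{D},\wedge^2E)$ be the pointwise creation operator $C_\xi f=\xi\,\dot\wedge\, f$, and consider the adjoint operator $C_\xi^*:H^2(\mathbb{D},\wedge^2E)\to H^2(\mathbb{D},E)$. Let $P_+:L^2(\mathbb{T},E)\to H^2(\mathbb{D},E)$ be the orthogonal projection. (i) For every $g\in H^2(\mathbb{D},E)$ and $f\in H^\infty(\mathbb{D},E)$, $$C_\xi^*(f\,\dot\wedge\, g)=P_+\alpha_f,$$ where $\alpha_f\in L^2(\mathbb{T},E)$ is defined by $$\alpha_f(e^{i\theta})=\langle f(e^{i\theta}),\xi(e^{i\theta})\rangle_E\,g(e^{i\theta})-\langle g(e^{i\theta}),\xi(e^{i\theta})\rangle_E\,f(e^{i\theta})$$ for all $e^{i\theta}\in\mathbb{T}\setminus(N_f\cup N_\xi\cup N_g)$, where $N_f,N_g,N_\xi$ are the singular sets of $f,g,\xi$ respectively. (ii) Suppose that $\xi$ is an inner function. Then, for any $g\in H^2(\mathbb{D},E)$, $$C_\xi^*C_\xi g=P_+\alpha_\xi,\qquad\text{where } \alpha_\xi=g-\xi\xi^*g.$$ Moreover $$C_\xi^*C_\xi g=g-T_{\xi\xi^*}g,$$ where $T_{\xi\xi^*}:H^2(\mathbb{D},E)\to H^2(\mathbb{D},E)$ is the Toeplitz operator with symbol $\xi\xi^*$.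
   Context: $\mathbb{D}$ is the open unit disc and $\mathbb{T}$ the unit circle. Hilbert spaces are complex. Wedge products: for a Hilbert space $E$, $\otimes_H^2E$ is the completion of the algebraic tensor square of $E$ for the norm induced by the inner product $\langle x_1\otimes x_2,\,y_1\otimes y_2\rangle=2\langle x_1,y_1\rangle_E\langle x_2,y_2\rangle_E$ (note the factor $2=2!$). $\wedge^2E$ is the closed subspace of antisymmetric tensors (those changing sign under the unitary flip $x\otimes y\mapsto y\otimes x$), with the inherited inner product, and $x\wedge y$ is the orthogonal projection of $x\otimes y$ onto $\wedge^2E$. Consequently $\langle x_1\wedge x_2,\,y_1\wedge y_2\rangle_{\wedge^2E}=\det(\langle x_i,y_k\rangle_E)_{i,k=1}^2$. The pointwise wedge product is $(f\,\dot\wedge\, g)(z)=f(z)\wedge g(z)$. $H^\infty(\mathbb{D},E)$ is the space of bounded analytic $E$-valued functions on $\mathbb{D}$. $H^2(\mathbb{D},E)$ is the space of analytic $f:\mathbb{D}\to E$ with $\|f\|_2=\sup_{0<r<1}\left(\frac1{2\pi}\int_0^{2\pi}\|f(re^{i\theta})\|_E^2\,d\theta\right)^{1/2}<\infty$. $L^2(\mathbb{T},E)$ is the space of measurable $E$-valued functions with $\|f\|_2=\left(\frac1{2\pi}\int_0^{2\pi}\|f(e^{i\theta})\|_E^2\,d\theta\right)^{1/2}<\infty$. A function $f\in H^2(\mathbb{D},E)$ or $H^\infty(\mathbb{D},E)$ has radial limits $\lim_{r\to1}f(re^{i\theta})$ in the norm of $E$ almost everywhere on $\mathbb{T}$, also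 denoted $f(e^{i\theta})$. The singular set $N_f$ is the null set of points of $\mathbb{T}$ at which the radial limit does not exist. Via radial limits, $H^2(\mathbb{D},E)$ is identified isometrically with a closed subspace of $L^2(\mathbb{T},E)$. It is known that $C_\xi$ maps $H^2(\mathbb{D},E)$ into $H^2(\mathbb{D},\wedge^2E)$ and is bounded, and that $f\,\dot\wedge\, g\in H^2(\mathbb{D},\wedge^2E)$ for $f\in H^\infty(\mathbb{D},E)$, $g\in H^2(\mathbb{D},E)$. $\xi\in H^\infty(\mathbb{D},E)$ is inner if $\|\xi(z)\|_E=1$ for almost every $z\in\mathbb{T}$. For $\xi,\eta\in L^\infty(\mathbb{T},E)$, $\xi\eta^*\in L^\infty(\mathbb{T},\mathcal{B}(E,E))$ is defined by $(\xi\eta^* )(z)x=\langle x,\eta(z)\rangle\,\xi(z)$ for all $x\in E$ and almost every $z\in\mathbb{T}$, and $(\xi\xi^*g)(z)=(\xi\xi^* )(z)g(z)$. For $G\in L^\infty(\mathbb{T},\mathcal{B}(E,E))$, the Toeplitz operator with symbol $G$ is $T_Gx=P_+(Gx)$ for $x\in H^2(\mathbb{D},E)$. *)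

(* Defs.v *)
From HB Require Import structures.
From mathcomp Require Import all_boot all_order all_algebra.
From mathcomp Require Import sesquilinear complex.
From mathcomp Require Import all_classical all_reals all_analysis.

Set Implicit Arguments.
Unset Strict Implicit.
Unset Printing Implicit Defensive.
Import Order.TTheory GRing.Theory Num.Theory.
Import numFieldNormedType.Exports.

Local Open Scope classical_set_scope.
Local Open Scope ring_scope.
Local Open Scope complex_scope.

(** * Hilbert spaces *)

(* [dot] is linear in its first argument and conjugate-linear in its second. *)
HB.mixin Record isHilbert (R : realType) E of CompleteNormedModule R[i] E := {
  dot : {dot E for (Num.conj : R[i] -> R[i])};
  dot_normE : forall x : E, dot x x = `|x| ^+ 2
}.

#[short(type="hilbertType")]
HB.structure Definition Hilbert (R : realType) :=
  {E of isHilbert R E & CompleteNormedModule R[i] E}.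

Notation "'<|' x , y '|>'" := (dot x y)
  (at level 0, x at level 99, y at level 99, format "<| x ,  y |>") : ring_scope.

Definition separable_space (T : topologicalType) : Prop :=
  exists2 A : set T, countable A & dense A.

(* The real number [‖x‖]; the library norm of a [normedModType R[i]] is a
   nonnegative element of [R[i]]. *)
Definition rnorm (R : realType) (E : hilbertType R) (x : E) : R :=
  complex.Re `|x|.

(* [xget] returns the unique element of the set when there is one, which is
   the case for a closed subspace [W]. *)
Definition orthoproj (R : realType) (E : hilbertType R) (W : set E) (x : E) : E :=
  xget 0 [set p | W p /\ forall w, W w -> <| x - p, w |> = 0].

(** * The tensor square and the wedge square *)

(* A completion of the algebraic tensor square of [E] for the inner product
   [<x1 (x) x2, y1 (x) y2> = 2 <x1, y1> <x2, y2>]: a Hilbert space in which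
   the linear span of the elementary tensors is dense and carries that inner
   product.  These conditions determine it up to a unique isometric
   isomorphism compatible with [tens].  They also determine [tens_flip]. *)
Record hilbert_tensor_square (R : realType) (E : hilbertType R) := HilbertTensorSquare {
  tens_space :> hilbertType R;
  tens : {bilinear E -> E -> tens_space};
  tens_dot : forall x1 x2 y1 y2 : E,
    <| tens x1 x2, tens y1 y2 |> = 2 * (<| x1, y1 |> * <| x2, y2 |>);
  tens_dense : dense [set t : tens_space |
    exists n (x y : 'I_n -> E), t = \sum_(i < n) tens (x i) (y i)];
  tens_flip : {linear tens_space -> tens_space};
  tens_flip_unitary : forall s t : tens_space,
    <| tens_flip s, tens_flip t |> = <| s, t |>;
  tens_flipE : forall x y : E, tens_flip (tens x y) = tens y x
}.

Section wedge.
Context (R : realType) (E : hilbertType R) (E2 : hilbert_tensor_square E).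

Definition wedge_square : set E2 := [set t | tens_flip E2 t = - t].

Definition wedge (x y : E) : E2 := orthoproj wedge_square (tens E2 x y).

Definition pwedge (f g : R[i] -> E) : R[i] -> E2 := fun z => wedge (f z) (g z).

End wedge.

(** * Function spaces on the disc and on the circle *)

(* Functions on the disc and on the circle are represented by functions on
   [R[i]] whose values outside the disc, resp. the circle, are irrelevant. *)

Section function_spaces.
Context (R : realType).
Local Notation mu := (@lebesgue_measure R).
Local Notation C := R[i].

Definition disc : set C := [set z | `|z| < 1].
Definition circle : set C := [set z | `|z| = 1].

Definition cis (t : R) : C := cos t +i* sin t.

Definition angles : set R := `[0, 2 * pi].

Definition circle_ae (P : C -> Prop) : Prop :=
  {ae mu, forall t, angles t -> P (cis t)}.

Section valued.
Context (E : hilbertType R).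
Implicit Types f g u v : C -> E.

Definition analytic_on_disc f : Prop :=
  forall z0, disc z0 -> exists2 e : C, 0 < e & exists a : nat -> E,
    forall z, `|z - z0| < e ->
      (\sum_(k < n) (z - z0) ^+ k *: a k) @[n --> \oo] --> f z.

Definition L2norm u : \bar R :=
  poweR ((2 * pi)^-1%:E * \int[mu]_(t in angles) ((rnorm (u (cis t))) ^+ 2)%:E)%E
    2^-1.

(* For separable [E] every class of square integrable functions contains a
   Borel measurable representative. *)
Definition L2 : set (C -> E) := [set u : C -> E |
  measurable_fun angles
    ((fun t => u (cis t)) : R -> g_sigma_algebraType (@open E)) /\
  (L2norm u < +oo)%E].

Definition L2dot u v : C :=
  ((2 * pi)^-1)%:C *
  ((\int[mu]_(t in angles) complex.Re <| u (cis t), v (cis t) |>) +i*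
   (\int[mu]_(t in angles) complex.Im <| u (cis t), v (cis t) |>)).

Definition H2norm f : \bar R :=
  ereal_sup [set L2norm (fun w => f (r%:C * w)) | r in `]0, 1[].

Definition H2 : set (C -> E) :=
  [set f | analytic_on_disc f /\ (H2norm f < +oo)%E].

Definition Hinfty : set (C -> E) :=
  [set f | analytic_on_disc f /\ exists M : C, forall z, disc z -> `|f z| <= M].

Definition radial f (w : C) : R -> E := fun r => f (r%:C * w).

(* Meaningful off [singular_set f]. *)
Definition boundary f : C -> E := fun w => lim (radial f w r @[r --> 1^'-]).

Definition singular_set f : set C :=
  [set w | circle w /\ ~ cvg (radial f w r @[r --> 1^'-])].

(* [H2] is identified with a closed subspace of [L2] through radial limits. *)
Definition H2dot f g : C := L2dot (boundary f) (boundary g).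

Definition inner xi : Prop :=
  Hinfty xi /\ circle_ae (fun w => `|boundary xi w| = 1).

Definition is_orthoproj_L2_H2 (P : (C -> E) -> (C -> E)) : Prop :=
  forall u, L2 u -> H2 (P u) /\
    forall h, H2 h -> L2dot (fun w => u w - boundary (P u) w) (boundary h) = 0.

Definition rank_one u v : C -> E -> E := fun w x => <| x, v w |> *: u w.

(* [P] stands for the orthogonal projection of [L2] onto [H2]. *)
Definition toeplitz (P : (C -> E) -> (C -> E)) (G : C -> E -> E) f : C -> E :=
  P (fun w => G w (boundary f w)).

End valued.

Section creation.
Context (E : hilbertType R) (E2 : hilbert_tensor_square E).

(* [H2] with values in the closed subspace [wedge_square E2] of [E2]. *)
Definition H2wedge : set (C -> E2) :=
  [set u | @H2 E2 u /\ forall z, disc z -> wedge_square (u z)].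

Definition creation (xi f : C -> E) : C -> E2 := pwedge E2 xi f.

Definition is_adjoint_H2 (A : (C -> E) -> (C -> E2))
    (B : (C -> E2) -> (C -> E)) : Prop :=
  forall u, H2wedge u -> H2 (B u) /\
    forall f, @H2 E f -> H2dot (A f) u = H2dot f (B u).

End creation.

Definition is_alpha (E : hilbertType R) (xi f g alpha : C -> E) : Prop :=
  L2 alpha /\
  forall w, circle w ->
    ~ (singular_set f `|` singular_set xi `|` singular_set g) w ->
    alpha w = <| boundary f w, boundary xi w |> *: boundary g w
            - <| boundary g w, boundary xi w |> *: boundary f w.

Definition alpha_inner (E : hilbertType R) (xi g : C -> E) : C -> E :=
  fun w => boundary g w -
           rank_one (boundary xi) (boundary xi) w (boundary g w).

End function_spaces.

(* Main.v *)
(* An [E]-valued analytic function on the disc is the sum of its Taylor series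
   at 0: Cauchy's estimate, a consequence of Parseval's identity, extends
   convergence past every circle on which the function is analytic. Membership
   in H^2 amounts to square summability of the coefficients. Comparing the
   Poisson kernel with dyadic averages, the weak type inequality for the
   Hardy-Littlewood maximal function, applied to lacunary blocks of the series
   with geometrically decreasing norms, yields radial limits almost everywhere,
   and Fatou's lemma shows that they have the Taylor coefficients as Fourier
   coefficients.

   It follows that an element of H^2 is determined by the numbers
   Re <., z^n x>. Testing against h = z^n x, both [Cadj (f ^ g)] and [P alpha]
   are characterized by an integral over the circle, and the integrands agree
   at every point where f, g and xi have radial limits, because
   <xi ^ h, f ^ g> = <xi, f> <h, g> - <xi, g> <h, f> = <h, <f, xi> g - <g, xi> f>.

   [xi] inner gives <xi, xi> = 1 on the circle, so that alpha_xi = g - xi xi^* g,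
   and the last identity is the linearity of [P] on Fourier coefficients. *)

Require Import Defs.
From mathcomp Require Import all_boot all_order all_algebra.
From mathcomp Require Import sesquilinear complex.
From mathcomp Require Import all_classical all_reals all_analysis.
From mathcomp Require Import ring lra.
From mathcomp Require Import measurable_realfun.

Set Implicit Arguments.
Unset Strict Implicit.
Unset Printing Implicit Defensive.
Import Order.TTheory GRing.Theory Num.Theory.
Import numFieldNormedType.Exports.

Local Open Scope classical_set_scope.
Local Open Scope ring_scope.
Local Open Scope complex_scope.

(** * Complex modulus and Hilbert norm *)

Section complex_modulus.
Context {R : realType}.
Implicit Types z w : R[i].

(** Analyticity means a power series near each point, so the series at 0 must first be continued up
    to the unit circle. Mean squares over circles replace contour integrals: they bound each
    [C(n, k) a_n] through the Taylor coefficients at centres inside the circle of convergence, and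
    the binomial theorem assembles these bounds into one on [a_n] at a larger radius.

    The obstacle at the boundary is that mean square convergence gives nothing pointwise. A block of
    the series of norm at most [4^-j] has radial maximal function above a multiple of [2^-j] only on
    a set of measure [O(2^-j)], and Borel-Cantelli applies. A vector-valued polynomial is reduced to
    its scalar norm by testing the Poisson formula against the value to be bounded.

    Functions live on all of [R[i]], and [boundary f] has a default value at singular points. Hence
    measurability is proved on the whole circle, defaults included, while the final identities hold
    on the disc. *)

Definition cnorm z : R := complex.Re `|z|.

Lemma cnormE z : `|z| = (cnorm z)%:C.
Proof. by rewrite /cnorm normc_def. Qed.

Lemma cnorm_ge0 z : 0 <= cnorm z.
Proof. by rewrite -ler0c -cnormE. Qed.

Lemma cnormM z w : cnorm (z * w) = cnorm z * cnorm w.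
Proof. by apply: complexI; rewrite rmorphM /= -!cnormE normrM. Qed.

Lemma cnormD z w : cnorm (z + w) <= cnorm z + cnorm w.
Proof. by rewrite -lecR rmorphD /= -!cnormE ler_normD. Qed.

Lemma cnorm0 : cnorm 0 = 0.
Proof. by rewrite /cnorm normr0. Qed.

Lemma cnormX z n : cnorm (z ^+ n) = cnorm z ^+ n.
Proof. by apply: complexI; rewrite rmorphXn /= -!cnormE normrX. Qed.

Lemma cnorm_real (a : R) : cnorm a%:C = `|a|.
Proof.
by apply: complexI; rewrite -cnormE normc_def /= expr0n addr0 sqrtr_sqr.
Qed.

Lemma cnormMn z n : cnorm (z *+ n) = cnorm z *+ n.
Proof. by apply: complexI; rewrite rmorphMn /= -!cnormE normrMn. Qed.

Lemma cnormJ z : cnorm (z^*) = cnorm z.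
Proof. by rewrite /cnorm normcJ. Qed.

Lemma normRe_le z : `|complex.Re z| <= cnorm z.
Proof. by rewrite -lecR -cnormE normc_ge_Re. Qed.

Lemma ReD z w : complex.Re (z + w) = complex.Re z + complex.Re w.
Proof. by case: z w => [a b] [c d]. Qed.

Lemma ReN z : complex.Re (- z) = - complex.Re z.
Proof. by case: z. Qed.

Lemma ReZ (a : R) z : complex.Re (a%:C * z) = a * complex.Re z.
Proof. by case: z => c d /=; rewrite mul0r subr0. Qed.

Lemma ReJ z : complex.Re (z^*) = complex.Re z.
Proof. by case: z. Qed.

Lemma Re_sum I (r : seq I) (F : I -> R[i]) :
  complex.Re (\sum_(i <- r) F i) = \sum_(i <- r) complex.Re (F i).
Proof. by elim/big_rec2: _ => // i y1 y2 _ <-; rewrite ReD. Qed.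

Lemma cnorm_cis (t : R) : cnorm (cis t) = 1.
Proof.
by apply: complexI; rewrite -cnormE normc_def /= cos2Dsin2 sqrtr1.
Qed.

Lemma cisX (t : R) n : cis t ^+ n = cis (n%:R * t).
Proof.
elim: n => [|n ih]; first by rewrite expr0 mul0r /cis cos0 sin0.
rewrite exprS ih -natr1 mulrDl mul1r addrC /cis cosD sinD.
by apply/eqP; rewrite eq_complex /= eqxx /= addrC.
Qed.

Lemma disc_cnorm z : disc z = (cnorm z < 1) :> Prop.
Proof. by rewrite /disc /= cnormE -(rmorph1 (real_complex R)) ltcR. Qed.

Lemma cisK_conj (t : R) : cis t * (cis t)^* = 1.
Proof. by rewrite -sqr_normc cnormE cnorm_cis expr1n. Qed.

Lemma circle_cis (t : R) : circle (cis t).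
Proof. by rewrite /circle /= cnormE cnorm_cis. Qed.

Lemma disc_scale_cis (r t : R) : 0 <= r < 1 -> disc (r%:C * cis t).
Proof.
by move=> /andP[r0 r1]; rewrite disc_cnorm cnormM cnorm_real cnorm_cis mulr1 ger0_norm.
Qed.

End complex_modulus.

Section hilbert_norm.
Context {R : realType} {E : hilbertType R}.
Implicit Types x y : E.

Lemma rnormE x : `|x| = (rnorm x)%:C.
Proof.
rewrite /rnorm; have : 0 <= `|x| := normr_ge0 x.
by case: `|x| => a b; rewrite lecE /= => /andP[/eqP ->].
Qed.

Lemma rnorm_ge0 x : 0 <= rnorm x.
Proof. by rewrite -ler0c -rnormE. Qed.

Lemma rnormD x y : rnorm (x + y) <= rnorm x + rnorm y.
Proof. by rewrite -lecR rmorphD /= -!rnormE ler_normD. Qed.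

Lemma rnormN x : rnorm (- x) = rnorm x.
Proof. by rewrite /rnorm normrN. Qed.

Lemma rnormB x y : rnorm (x - y) <= rnorm x + rnorm y.
Proof. by rewrite -(rnormN y) rnormD. Qed.

Lemma rnorm_subC x y : rnorm (x - y) = rnorm (y - x).
Proof. by rewrite -rnormN opprB. Qed.

Lemma rnorm0 : rnorm (0 : E) = 0.
Proof. by rewrite /rnorm normr0. Qed.

Lemma rnorm0_eq0 x : rnorm x = 0 -> x = 0.
Proof. by move=> h; apply/eqP; rewrite -normr_eq0 rnormE h. Qed.

Lemma rnormZ (a : R[i]) x : rnorm (a *: x) = cnorm a * rnorm x.
Proof. by apply: complexI; rewrite rmorphM /= -rnormE normrZ cnormE rnormE. Qed.

Lemma rnorm_sum I (r : seq I) (F : I -> E) :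
  rnorm (\sum_(i <- r) F i) <= \sum_(i <- r) rnorm (F i).
Proof.
elim/big_rec2: _ => [|i y1 y2 _ h]; first by rewrite rnorm0.
by apply: le_trans (rnormD _ _) _; rewrite lerD2l.
Qed.

Lemma rnorm_triangle y x z : rnorm (x - z) <= rnorm (x - y) + rnorm (y - z).
Proof. by apply: le_trans (rnormD _ _); rewrite addrA subrK. Qed.

Lemma ge0_eps_eq0 (a : R) : 0 <= a -> (forall e, 0 < e -> a <= e) -> a = 0.
Proof.
move=> a0 h; apply/eqP; rewrite eq_le a0 andbT leNgt; apply/negP => a_gt0.
have := h (a / 2); rewrite divr_gt0// => /(_ isT).
by rewrite leNgt ltr_pdivrMr// ltr_pMr// ltr1n.
Qed.

Lemma dotDl x y z : <| x + y, z |> = <| x, z |> + <| y, z |>.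
Proof. by rewrite linearDl. Qed.

Lemma dotNl x z : <| - x, z |> = - <| x, z |>.
Proof. by rewrite linearNl. Qed.

Lemma dotBl x y z : <| x - y, z |> = <| x, z |> - <| y, z |>.
Proof. by rewrite linearBl. Qed.

Lemma dotZl (a : R[i]) x z : <| a *: x, z |> = a * <| x, z |>.
Proof. by rewrite linearZl_LR. Qed.

Lemma dotC x y : <| x, y |> = (<| y, x |>)^*.
Proof. by rewrite [LHS]hermC expr0 mul1r. Qed.

Lemma dotBr x y z : <| z, x - y |> = <| z, x |> - <| z, y |>.
Proof. by rewrite linearBr. Qed.

Lemma dotZr (a : R[i]) x z : <| z, a *: x |> = a^* * <| z, x |>.
Proof. by rewrite dotC dotZl rmorphM /= -dotC. Qed.

Lemma dot_suml I (r : seq I) (F : I -> E) z :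
  <| \sum_(i <- r) F i, z |> = \sum_(i <- r) <| F i, z |>.
Proof. by rewrite linear_sumlz. Qed.

Lemma dot_sumr I (r : seq I) (F : I -> E) z :
  <| z, \sum_(i <- r) F i |> = \sum_(i <- r) <| z, F i |>.
Proof. by rewrite linear_sumr. Qed.

(** Real parts suffice to identify vectors, because [Re <v, v>] is the squared norm of [v]; all
    integrands below can thus be real functions. *)
Definition rdot x y : R := complex.Re <| x, y |>.

Lemma rdotC x y : rdot x y = rdot y x.
Proof. by rewrite /rdot dotC ReJ. Qed.

Lemma rdotDl x y z : rdot (x + y) z = rdot x z + rdot y z.
Proof. by rewrite /rdot dotDl ReD. Qed.

Lemma rdotBl x y z : rdot (x - y) z = rdot x z - rdot y z.
Proof. by rewrite /rdot dotBl ReD ReN. Qed.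

Lemma rdotxx x : rdot x x = rnorm x ^+ 2.
Proof. by rewrite /rdot dot_normE rnormE -rmorphXn. Qed.

Lemma rnormD_sqr x y : rnorm (x + y) ^+ 2 = rnorm x ^+ 2 + rnorm y ^+ 2 + 2 * rdot x y.
Proof.
rewrite -!rdotxx rdotDl ![rdot _ (_ + _)]rdotC !rdotDl (rdotC y x).
ring.
Qed.

(** The norm comes with its triangle inequality; squaring that and cancelling the two squares leaves
    Cauchy-Schwarz. *)
Lemma rdot_le x y : rdot x y <= rnorm x * rnorm y.
Proof.
have := rnormD x y; rewrite -(ler_pXn2r (n := 2)) ?nnegrE ?addr_ge0 ?rnorm_ge0//.
rewrite rnormD_sqr sqrrD; lra.
Qed.

Lemma cnorm_dot_le x y : cnorm <| x, y |> <= rnorm x * rnorm y.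
Proof.
have [h|h] := eqVneq <| x, y |> 0.
  by rewrite h cnorm0 mulr_ge0 ?rnorm_ge0.
have c0 : cnorm <| x, y |> != 0.
  by apply: contra_neq h => h; apply/eqP; rewrite -normr_eq0 cnormE h.
(* A unimodular factor rotates [<x, y>] onto its modulus, which reduces the complex inequality to
   the real one. *)
pose u : R[i] := (<| x, y |>)^* / (cnorm <| x, y |>)%:C.
have u1 : cnorm u = 1.
  rewrite /u cnormM cnormJ -fmorphV cnorm_real ger0_norm ?invr_ge0 ?cnorm_ge0//.
  by rewrite divff.
have -> : cnorm <| x, y |> = rdot (u *: x) y.
  rewrite /rdot dotZl /u mulrAC mulrC (mulrC (_^*)) -sqr_normc cnormE -rmorphXn.
  by rewrite -fmorphV -rmorphM /= expr2 mulKf.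
by apply: le_trans (rdot_le _ _) _; rewrite rnormZ u1 mul1r.
Qed.

Lemma rdot_norm_le x y : `|rdot x y| <= rnorm x * rnorm y.
Proof. exact: le_trans (normRe_le _) (cnorm_dot_le _ _). Qed.

Lemma rnorm_sqrD_le x y : rnorm (x + y) ^+ 2 <= 2 * rnorm x ^+ 2 + 2 * rnorm y ^+ 2.
Proof.
rewrite rnormD_sqr; have := rdot_le x y.
have := sqr_ge0 (rnorm x - rnorm y); rewrite sqrrB; lra.
Qed.

Lemma cvg_rnormP {T} {F : set_system T} {FF : Filter F} (f : T -> E) (l : E) :
  f x @[x --> F] --> l <->
  forall e : R, 0 < e -> \forall x \near F, rnorm (l - f x) < e.
Proof.
split=> [/cvgrPdist_lt h e e0|h].
  have e0' : 0 < e%:C by rewrite ltcR.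
  by near=> x; rewrite -ltcR -rnormE; near: x; exact: h.
(* Radii of balls are elements of [R[i]]; a positive one has zero imaginary part, so real radii
   suffice. *)
apply/cvgrPdist_lt => -[e e']; rewrite ltcE /= => /andP[/eqP -> e0].
by near=> x; rewrite rnormE ltcR; near: x; exact: h.
Unshelve. all: by end_near. Qed.

Lemma cvg_seq_rnormP (u : nat -> E) (l : E) :
  u n @[n --> \oo] --> l <->
  forall e : R, 0 < e -> exists N, forall n, (N <= n)%N -> rnorm (l - u n) < e.
Proof.
rewrite cvg_rnormP; split=> h e e0.
  by have [N _ hN] := h e e0; exists N => n; exact: hN.
by have [N hN] := h e e0; exists N.
Qed.

Lemma cauchy_rnorm_cvg {T} {F : set_system T} {FF : ProperFilter F} (f : T -> E) :
  (forall e : R, 0 < e -> exists2 A, F A &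
    forall s t, A s -> A t -> rnorm (f s - f t) < e) ->
  cvg (f x @[x --> F]).
Proof.
move=> h; apply: cauchy_cvg; apply: cauchy_exP => -[e e'].
rewrite ltcE /= => /andP[/eqP -> e0].
have [A FA hA] := h e e0.
have [x Ax] := filter_ex FA.
exists (f x); apply: filterS FA => y Ay.
by rewrite /= -ball_normE /ball_ /= rnormE ltcR; exact: hA.
Qed.

Lemma cauchy_seq_cvg (u : nat -> E) :
  (forall e : R, 0 < e -> exists N, forall m n, (N <= m)%N -> (N <= n)%N ->
    rnorm (u m - u n) < e) ->
  exists l : E, u n @[n --> \oo] --> l.
Proof.
move=> h; apply/(@cvg_ex E); apply: cauchy_rnorm_cvg => e /h[N hN].
by exists [set n | (N <= n)%N]; [exists N | move=> m n; exact: hN].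
Qed.

Lemma cvg_rnorm_unique {T} {F : set_system T} {FF : ProperFilter F} (f : T -> E) (l l' : E) :
  f x @[x --> F] --> l -> f x @[x --> F] --> l' -> l = l'.
Proof. exact: (@cvg_unique _ (@norm_hausdorff _ E)). Qed.

End hilbert_norm.

(** * Power series with Hilbert space coefficients *)

Section geometric_series.
Context {R : realType}.
Implicit Types q A e : R.

Lemma sum_expr_le q m n : 0 <= q -> q < 1 ->
  \sum_(m <= k < n) q ^+ k <= q ^+ m / (1 - q).
Proof.
move=> q0 q1; have q1' : 0 < 1 - q by rewrite subr_gt0.
have [mn|nm] := leqP m n; last first.
  by rewrite big_geq ?(ltnW nm)// divr_ge0 ?exprn_ge0// ltW.
rewrite ler_pdivlMr// mulr_suml.
have -> : \sum_(m <= k < n) q ^+ k * (1 - q) = q ^+ m - q ^+ n.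
  elim: n mn => [|n ih]; first by rewrite leqn0 => /eqP ->; rewrite big_geq// subrr.
  rewrite leq_eqVlt => /orP[/eqP ->|]; first by rewrite big_geq// subrr.
  rewrite ltnS => mn; rewrite big_nat_recr//= ih// exprS; ring.
by rewrite lerBlDr lerDl exprn_ge0.
Qed.

Lemma geometric_lt q A e : 0 <= q -> q < 1 -> 0 < e ->
  exists N, forall n, (N <= n)%N -> A * q ^+ n < e.
Proof.
move=> q0 q1 e0.
have h : A * q ^+ n @[n --> \oo] --> (A * 0 : R).
  by apply: cvgMr; apply: cvg_expr; rewrite ger0_norm.
rewrite mulr0 in h; move/cvgrPdist_lt : h => /(_ e e0)[N _ hN].
exists N => n /hN /=; rewrite sub0r normrN; exact: le_lt_trans (ler_norm _).
Qed.

End geometric_series.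

Section power_series.
Context {R : realType} {E : hilbertType R}.
Implicit Types (a b c : nat -> E) (h z : R[i]) (q s M : R).

Definition psum a h n : E := \sum_(k < n) h ^+ k *: a k.

Definition psums a h (y : E) : Prop := psum a h n @[n --> \oo] --> y.

(** The hypothesis of Abel's lemma: terms bounded at radius [s] give, for [|h| <= q s], convergence
    with the explicit tail [M q^n / (1 - q)]. *)
Definition cbound a s M : Prop := forall k, rnorm (a k) * s ^+ k <= M.

Lemma psumE a h n : psum a h n = \sum_(0 <= k < n) h ^+ k *: a k.
Proof. by rewrite big_mkord. Qed.

Lemma psumB a h m n : (m <= n)%N ->
  psum a h n - psum a h m = \sum_(m <= k < n) h ^+ k *: a k.
Proof. by move=> mn; rewrite !psumE (big_cat_nat (leq0n m) mn)/= addrAC subrr add0r. Qed.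

Lemma rnorm_sum_geometric (u : nat -> E) M q m n : 0 <= q -> q < 1 -> 0 <= M ->
  (forall k, rnorm (u k) <= M * q ^+ k) ->
  rnorm (\sum_(m <= k < n) u k) <= M * (q ^+ m / (1 - q)).
Proof.
move=> q0 q1 M0 hu; apply: le_trans (rnorm_sum _ _) _.
apply: (@le_trans _ _ (\sum_(m <= k < n) M * q ^+ k)).
  by apply: ler_sum => i _; exact: hu.
by rewrite -mulr_sumr ler_wpM2l// sum_expr_le.
Qed.

Lemma series_geometric_cvg (u : nat -> E) M q : 0 <= q -> q < 1 ->
  (forall k, rnorm (u k) <= M * q ^+ k) ->
  exists2 l : E, \sum_(k < n) u k @[n --> \oo] --> l &
  forall n, rnorm (l - \sum_(k < n) u k) <= M * (q ^+ n / (1 - q)).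
Proof.
move=> q0 q1 hu.
have M0 : 0 <= M by apply: le_trans (rnorm_ge0 (u 0%N)) _; have := hu 0%N; rewrite expr0 mulr1.
have diff m n : (m <= n)%N -> rnorm (\sum_(k < n) u k - \sum_(k < m) u k) <= M * (q ^+ m / (1 - q)).
  move=> mn; rewrite -!(big_mkord xpredT) (big_cat_nat (leq0n m) mn)/= addrAC subrr add0r.
  exact: rnorm_sum_geometric.
have [l hl] : exists l : E, \sum_(k < n) u k @[n --> \oo] --> l.
  apply: cauchy_seq_cvg => e e0.
  have [N hN] := geometric_lt (M / (1 - q)) q0 q1 e0.
  exists N => m n Nm Nn.
  wlog mn : m n Nm Nn / (m <= n)%N.
    move=> H; have [mn|/ltnW nm] := leqP m n; first exact: H.
    by rewrite rnorm_subC; exact: H.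
  rewrite rnorm_subC; apply: le_lt_trans (diff _ _ mn) _.
  by have := hN m Nm; rewrite mulrAC mulrA.
exists l => // m; apply/ler_addgt0Pr => e e0.
have [N hN] := (cvg_seq_rnormP _ _).1 hl e e0.
apply: le_trans (rnorm_triangle (\sum_(k < maxn N m) u k) _ _) _.
rewrite addrC lerD// ?diff ?leq_maxr// ltW// hN// leq_maxl//.
Qed.

Lemma psum_cvg a s M h q : cbound a s M -> 0 <= q -> q < 1 -> cnorm h <= q * s ->
  exists2 y, psums a h y & forall n, rnorm (y - psum a h n) <= M * (q ^+ n / (1 - q)).
Proof.
move=> ab q0 q1 hs; apply: (series_geometric_cvg (u := fun k => h ^+ k *: a k)) => // k.
rewrite rnormZ cnormX mulrC.
apply: (@le_trans _ _ (rnorm (a k) * (q * s) ^+ k)).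
  by rewrite ler_wpM2l ?rnorm_ge0// lerXn2r ?nnegrE ?cnorm_ge0// (le_trans (cnorm_ge0 h)).
by rewrite exprMn mulrCA mulrC ler_wpM2r// exprn_ge0.
Qed.

Lemma psums_unique a h y y' : psums a h y -> psums a h y' -> y = y'.
Proof. exact: cvg_rnorm_unique. Qed.

Lemma psum_tail a s M h q y : cbound a s M -> 0 <= q -> q < 1 -> cnorm h <= q * s ->
  psums a h y -> forall n, rnorm (y - psum a h n) <= M * (q ^+ n / (1 - q)).
Proof.
by move=> ab q0 q1 hs hy; have [y' hy' ?] := psum_cvg ab q0 q1 hs;
  rewrite (psums_unique hy hy').
Qed.

Lemma seq_bounded (u : nat -> R) (N : nat) (B : R) :
  (forall n, (N <= n)%N -> u n <= B) -> exists M, forall n, u n <= M.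
Proof.
elim: N B => [|N ih] B h; first by exists B => n; exact: h.
apply: (ih (Num.max B (u N))) => n.
rewrite leq_eqVlt => /orP[/eqP <-|/h uB]; first by rewrite le_max lexx orbT.
by rewrite le_max uB.
Qed.

Lemma psums_cbound a s y : 0 <= s -> psums a s%:C y -> exists2 M, 0 <= M & cbound a s M.
Proof.
move=> s0 /cvg_seq_rnormP /(_ 1 ltr01)[N hN].
(* Consecutive partial sums are eventually within 1 of the limit, so a term, being their difference,
   is eventually at most 2. *)
have [M hM] : exists M, forall k, rnorm (a k) * s ^+ k <= M.
  apply: (@seq_bounded _ N 2) => n Nn.
  have -> : rnorm (a n) * s ^+ n = rnorm (psum a s%:C n.+1 - psum a s%:C n).
    by rewrite psumB// big_nat1 rnormZ cnormX cnorm_real ger0_norm// mulrC.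
  apply: le_trans (rnorm_triangle y _ _) _; rewrite rnorm_subC.
  by apply: ltW; rewrite -[2]/(1 + 1) ltrD// hN// leqW.
by exists M => //; apply: le_trans (hM 0%N); rewrite expr0 mulr1 rnorm_ge0.
Qed.

Lemma psumZBl a b h n (w : R[i]) :
  psum (fun k => w *: (a k - b k)) h n = w *: (psum a h n - psum b h n).
Proof.
rewrite /psum -sumrB scaler_sumr; apply: eq_bigr => k _.
by rewrite scalerA mulrC -scalerA scalerBr.
Qed.

Lemma psumsZB a b h y y' (w : R[i]) : psums a h y -> psums b h y' ->
  psums (fun k => w *: (a k - b k)) h (w *: (y - y')).
Proof.
move=> ay by'; rewrite /psums; under eq_cvg do rewrite psumZBl.
by apply: cvgZr; exact: cvgB.
Qed.

(** Once the coefficients below [m] vanish, evaluation at [q s] bounds the term of degree [m], of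
    order [q^m], by a tail of order [q^(m+1)]; then [q] is made small. *)
Lemma psums0_eq0 c r : 0 < r -> (forall h, cnorm h < r -> psums c h 0) -> forall m, c m = 0.
Proof.
move=> r0 hc; have s0 : 0 < r / 2 by rewrite divr_gt0.
have [M M0 cb] : exists2 M, 0 <= M & cbound c (r / 2) M.
  apply: (psums_cbound (ltW s0) (y := 0)); apply: hc.
  by rewrite cnorm_real gtr0_norm// ltr_pdivrMr// ltr_pMr// ltr1n.
set s := r / 2 in s0 cb; elim/ltn_ind => m ih.
suff h e : 0 < e -> rnorm (c m) * s ^+ m <= e.
  apply: rnorm0_eq0; apply/eqP; rewrite -(mulIr_eq0 _ (mulIf (lt0r_neq0 (exprn_gt0 m s0)))).
  by apply/eqP/ge0_eps_eq0 => //; rewrite mulr_ge0 ?rnorm_ge0// exprn_ge0// ltW.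
move=> e0.
(* [q <= 1/2] gives [1 / (1 - q) <= 2], and the second bound brings [2 q M] below [e]. *)
pose q := Num.min (1 / 2) (e / (2 * (M + 1))).
have M1 : 0 < M + 1 by rewrite ltr_wpDl.
have q0 : 0 < q by rewrite lt_min !divr_gt0// mulr_gt0.
have q2 : q <= 1 / 2 by rewrite ge_min lexx.
have q1 : q < 1 by apply: le_lt_trans q2 _; lra.
have qs : cnorm (q * s)%:C <= q * s by rewrite cnorm_real ger0_norm// mulr_ge0// ltW.
have qsr : cnorm (q * s)%:C < r.
  apply: le_lt_trans qs _; apply: le_lt_trans (_ : 1 * s < r); first by rewrite ler_wpM2r// ltW.
  by rewrite mul1r /s; lra.
have := psum_tail cb (ltW q0) q1 qs (hc _ qsr) m.+1.
have -> : psum c (q * s)%:C m.+1 = (q * s)%:C ^+ m *: c m.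
  by rewrite /psum big_ord_recr/= big1 ?add0r// => i _; rewrite ih ?scaler0.
rewrite sub0r rnormN rnormZ cnormX cnorm_real ger0_norm ?(mulr_ge0 (ltW q0) (ltW s0))//.
have -> : M * (q ^+ m.+1 / (1 - q)) = q ^+ m * (M * (q / (1 - q))) by rewrite exprS; ring.
rewrite exprMn -mulrA ler_pM2l ?exprn_gt0// mulrC => h; apply: le_trans h _.
have : q * (2 * (M + 1)) <= e.
  by rewrite -ler_pdivlMr ?mulr_gt0// ge_min lexx orbT.
have i2 : (1 - q)^-1 <= 2.
  by rewrite -[leRHS]invrK lef_pV2 ?posrE ?invr_gt0//; lra.
move=> h; apply: le_trans h; rewrite mulrCA ler_wpM2l ?(ltW q0)//.
rewrite mulrC ler_pM// ?invr_ge0; last by lra.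
by rewrite subr_ge0 ltW.
Qed.

Lemma psums_coef_unique a b (F : R[i] -> E) r : 0 < r ->
  (forall h, cnorm h < r -> psums a h (F h)) ->
  (forall h, cnorm h < r -> psums b h (F h)) -> a = b.
Proof.
move=> r0 ha hb; apply/funext => k; apply/eqP; rewrite -subr_eq0 -[_ - _]scale1r.
apply/eqP; move: k; apply: (psums0_eq0 r0) => h hr.
have := psumsZB (w := 1) (ha _ hr) (hb _ hr).
by rewrite subrr scaler0.
Qed.

(* As [n] grows this tends to the [k]-th Taylor coefficient at [z] of the sum of [a]. *)
Definition reexp_sum a z k n : E := \sum_(j < n) (z ^+ (j - k) *+ 'C(j, k)) *: a j.

Lemma psum_reexp a z h n : psum a (z + h) n = psum (fun k => reexp_sum a z k n) h n.
Proof.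
rewrite /psum /reexp_sum; under [RHS]eq_bigr do rewrite scaler_sumr.
rewrite exchange_big/=; apply: eq_bigr => j _.
under eq_bigr do rewrite scalerA; rewrite -scaler_suml; congr (_ *: _).
rewrite exprDn (big_ord_widen n (fun k => z ^+ (j - k) * h ^+ k *+ 'C(j, k)))//.
rewrite big_mkcond/=; apply: eq_bigr => k _; rewrite ltnS.
case: leqP => jk; first by rewrite mulrnAr mulrC.
by rewrite bin_small// mulr0n mulr0.
Qed.

(** [C(j, k) |z|^(j-k) eta^k] is one term of the binomial expansion of [(|z| + eta)^j <= (q s)^j].
    Each new coefficient therefore converges geometrically, with a rate independent of [k] once
    multiplied by [eta^k], and this uniformity lets the limit pass through the sum over [k]. *)
Lemma reexp_cvg a s M z eta q : cbound a s M -> 0 < eta -> 0 <= q -> q < 1 ->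
  cnorm z + eta <= q * s ->
  exists b,
  [/\ cbound b eta (M / (1 - q)),
      forall k, reexp_sum a z k n @[n --> \oo] --> b k &
      forall h y, cnorm h < eta -> psums a (z + h) y -> psums b h y].
Proof.
move=> ab eta0 q0 q1 zq.
have M0 : 0 <= M by apply: le_trans (ab 0%N); rewrite expr0 mulr1 rnorm_ge0.
have ek k : 0 < eta ^+ k by rewrite exprn_gt0.
have hk k : exists2 l : E, reexp_sum a z k n @[n --> \oo] --> l &
    forall n, rnorm (l - reexp_sum a z k n) <= (M / eta ^+ k) * (q ^+ n / (1 - q)).
  apply: (series_geometric_cvg (u := fun j => (z ^+ (j - k) *+ 'C(j, k)) *: a j)) => // n.
  rewrite rnormZ mulrAC ler_pdivlMr// cnormMn cnormX.
  apply: (@le_trans _ _ (rnorm (a n) * (q * s) ^+ n)); last first.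
    by rewrite exprMn mulrCA mulrC ler_wpM2r// exprn_ge0.
  rewrite mulrAC mulrC ler_wpM2l ?rnorm_ge0//.
  have := cnorm_ge0 z => z0.
  apply: (@le_trans _ _ ((cnorm z + eta) ^+ n)); last first.
    by rewrite lerXn2r ?nnegrE ?addr_ge0 ?(ltW eta0)// (le_trans _ zq)// addr_ge0// ltW.
  have [kn|nk] := leqP k n; last first.
    by rewrite bin_small// mulr0n mul0r exprn_ge0// addr_ge0// ltW.
  rewrite exprDn (bigD1 (Ordinal (kn : (k < n.+1)%N)))//= mulrnAl lerDl sumr_ge0// => i _.
  by rewrite mulrn_wge0// mulr_ge0// exprn_ge0// ltW.
have /choice[b hb] : forall k, exists l : E, (reexp_sum a z k n @[n --> \oo] --> l) /\
    forall n, rnorm (l - reexp_sum a z k n) <= (M / eta ^+ k) * (q ^+ n / (1 - q)).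
  by move=> k; have [l ? ?] := hk k; exists l.
have q1' : 0 < 1 - q by rewrite subr_gt0.
exists b; split=> [k|k|h y heta hy].
- have := (hb k).2 0%N; rewrite /reexp_sum big_ord0 subr0 expr0 mul1r mulrAC.
  by rewrite ler_pdivlMr.
- exact: (hb k).1.
apply/cvg_seq_rnormP => e e0.
have e2 : 0 < e / 2 by rewrite divr_gt0.
have [N1 hN1] := (cvg_seq_rnormP _ _).1 hy _ e2.
set q' := cnorm h / eta.
have q'0 : 0 <= q' by rewrite divr_ge0 ?cnorm_ge0// ltW.
have q'1 : q' < 1 by rewrite ltr_pdivrMr// mul1r.
have q'1' : 0 < 1 - q' by rewrite subr_gt0.
have [N2 hN2] := geometric_lt (M / (1 - q) / (1 - q')) q0 q1 e2.
exists (maxn N1 N2) => n; rewrite geq_max => /andP[n1 n2].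
apply: le_lt_trans (rnorm_triangle (psum a (z + h) n) _ _) _.
rewrite [e]splitr ltrD ?hN1// psum_reexp rnorm_subC.
have -> : psum b h n - psum (fun k => reexp_sum a z k n) h n =
    \sum_(0 <= k < n) h ^+ k *: (b k - reexp_sum a z k n).
  by rewrite !psumE -sumrB; apply: eq_bigr => k _; rewrite scalerBr.
apply: le_lt_trans (rnorm_sum _ _) _.
(* The error on coefficient [k] is at most [M q^n / (1 - q) / eta^k]; weighted by [|h|^k] it becomes
   geometric of ratio [q' = |h| / eta < 1]. *)
apply: (@le_lt_trans _ _ (\sum_(0 <= k < n) (M * (q ^+ n / (1 - q))) * q' ^+ k)).
  apply: ler_sum => k _; rewrite rnormZ cnormX.
  apply: le_trans (ler_wpM2l _ ((hb k).2 n)) _; first by rewrite exprn_ge0// cnorm_ge0.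
  by rewrite /q' expr_div_n le_eqVlt; apply/orP; left; apply/eqP; ring.
rewrite -mulr_sumr; have := hN2 n n2; apply: le_lt_trans.
apply: le_trans (ler_wpM2l _ (sum_expr_le 0 n q'0 q'1)) _.
  by rewrite mulr_ge0// divr_ge0 ?exprn_ge0// ltW.
by rewrite expr0 le_eqVlt; apply/orP; left; apply/eqP; ring.
Qed.

(** The re-expansion about [z] has constant term [F z], so [F w - F z] is a tail starting at degree
    1, small of order [p] when [|w - z| < p eta]. *)
Lemma psums_continuous a s M z : cbound a s M -> cnorm z < s -> forall (F : R[i] -> E),
  (forall w, cnorm w < s -> psums a w (F w)) ->
  forall e : R, 0 < e -> exists2 d : R, 0 < d &
    forall w, cnorm (w - z) < d -> rnorm (F w - F z) < e.
Proof.
move=> ab zs F hF e e0.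
have z0 := cnorm_ge0 z; have s0 : 0 < s by exact: le_lt_trans z0 zs.
pose eta := (s - cnorm z) / 2; pose q := (cnorm z + eta) / s.
have eta0 : 0 < eta by rewrite divr_gt0 ?subr_gt0.
have q0 : 0 <= q by rewrite divr_ge0 ?addr_ge0// ltW.
have q1 : q < 1 by rewrite ltr_pdivrMr// mul1r /eta; lra.
have zq : cnorm z + eta <= q * s by rewrite /q divfK ?gt_eqF.
have [b [bb _ hb]] := reexp_cvg ab eta0 q0 q1 zq.
set M' := M / (1 - q) in bb.
have M'0 : 0 <= M' by apply: le_trans (bb 0%N); rewrite expr0 mulr1 rnorm_ge0.
pose p := Num.min (1 / 2) (e / (4 * (M' + 1))).
have M1 : 0 < M' + 1 by rewrite ltr_wpDl.
have p0 : 0 < p by rewrite lt_min !divr_gt0// mulr_gt0.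
have p2 : p <= 1 / 2 by rewrite ge_min lexx.
have p1 : p < 1 by apply: le_lt_trans p2 _; lra.
have pe : p * (4 * (M' + 1)) <= e by rewrite -ler_pdivlMr ?mulr_gt0// ge_min lexx orbT.
exists (p * eta) => [|w wz]; first by rewrite mulr_gt0.
have pes : p * eta < eta by rewrite -[ltRHS]mul1r ltr_pM2r.
have hw : psums b (w - z) (F w).
  apply: hb; first exact: lt_trans wz pes.
  rewrite addrC subrK; apply: hF.
  rewrite -(subrK z w); apply: le_lt_trans (cnormD _ _) _.
  apply: (@lt_trans _ _ (eta + cnorm z)); first by rewrite ltrD2r (lt_trans wz).
  by rewrite /eta; lra.
have hz : psums b 0 (F z) by apply: hb; rewrite ?cnorm0// addr0; exact: hF.
have b0 : F z = psum b (w - z) 1.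
  have h0 : psums b 0 (b 0%N).
    apply/cvg_seq_rnormP => d d0; exists 1%N => -[//|n] _.
    rewrite /psum big_ord_recl big1 ?addr0 => [|i _]; last by rewrite expr0n scale0r.
    by rewrite expr0 scale1r subrr rnorm0.
  by rewrite (psums_unique hz h0) /psum big_ord1 expr0 scale1r.
rewrite b0; apply: le_lt_trans (psum_tail bb (ltW p0) p1 (ltW wz) hw 1) _.
have i2 : (1 - p)^-1 <= 2.
  by rewrite -[leRHS]invrK lef_pV2 ?posrE ?invr_gt0//; lra.
apply: le_lt_trans (_ : M' * (p * 2) < e).
  by rewrite ler_wpM2l// expr1 ler_wpM2l// ltW.
apply: lt_le_trans pe; rewrite mulrCA ltr_pM2l//; lra.
Qed.

End power_series.

(** * Cauchy products under a bounded bilinear map *)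

Section cauchy_product.
Context {R : realType} {E F G : hilbertType R} (B : {bilinear E -> F -> G}) (K : R).
Hypothesis B_le : forall x y, rnorm (B x y) <= K * (rnorm x * rnorm y).

Definition cauchy_prod (a : nat -> E) (b : nat -> F) n : G :=
  \sum_(i < n.+1) B (a i) (b (n - i)%N).

Lemma bounded_bilinear_cvg {T} {Ft : set_system T} {FF : Filter Ft}
    (u : T -> E) (v : T -> F) (y : E) (y' : F) :
  u t @[t --> Ft] --> y -> v t @[t --> Ft] --> y' ->
  B (u t) (v t) @[t --> Ft] --> B y y'.
Proof.
move=> /cvg_rnormP hu /cvg_rnormP hv; apply/cvg_rnormP => e e0.
pose L := `|K| * (rnorm y + rnorm y' + 1) + 1.
have L0 : 0 < L by rewrite ltr_wpDl// mulr_ge0// !addr_ge0 ?rnorm_ge0.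
pose d := Num.min 1 (e / (2 * L)).
have d0 : 0 < d by rewrite lt_min ltr01 divr_gt0// mulr_gt0.
have Bl x z : rnorm (B x z) <= `|K| * (rnorm x * rnorm z).
  by apply: le_trans (B_le _ _) _; rewrite ler_wpM2r ?ler_norm// mulr_ge0 ?rnorm_ge0.
near=> t.
have n1 : rnorm (y - u t) < d by near: t; exact: hu.
have n2 : rnorm (y' - v t) < d by near: t; exact: hv.
have -> : B y y' - B (u t) (v t) = B (y - u t) y' + B (u t) (y' - v t).
  by rewrite linearBl linearBr addrA subrK.
have an : rnorm (u t) <= rnorm y + 1.
  rewrite -[u t](subrK y); apply: le_trans (rnormD _ _) _.
  by rewrite addrC lerD2l rnorm_subC (le_trans (ltW n1))// ge_min lexx.
apply: le_lt_trans (rnormD _ _) _.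
apply: le_lt_trans (lerD (Bl _ _) (Bl _ _)) _.
apply: (@le_lt_trans _ _ (`|K| * (d * rnorm y') + `|K| * ((rnorm y + 1) * d))).
  by rewrite lerD// ler_wpM2l// ler_pM ?rnorm_ge0// ltW.
apply: (@lt_le_trans _ _ (d * L)).
  have -> : `|K| * (d * rnorm y') + `|K| * ((rnorm y + 1) * d) = d * (`|K| * (rnorm y + rnorm y' + 1)).
    by ring.
  by rewrite ltr_pM2l// /L ltrDl.
have : d * (2 * L) <= e by rewrite -ler_pdivlMr ?mulr_gt0// ge_min lexx orbT.
by apply: le_trans; rewrite ler_pM2l// ler_peMl ?ltW// ltr1n.
Unshelve. all: by end_near. Qed.

(** The product of the partial sums runs over a square, the Cauchy product over a triangle; they
    differ by the terms with [i + j >= n]. The ratio is written [p^2] so that in [p^(2 n)] one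
    factor [p^n] provides the decay, while the other is at most [p^i] and makes the sum over [i]
    converge. *)
Lemma psums_cauchy_prod (a : nat -> E) (b : nat -> F) s M M' h p y y' :
  cbound a s M -> cbound b s M' -> 0 <= p -> p < 1 -> cnorm h <= p ^+ 2 * s ->
  psums a h y -> psums b h y' -> psums (cauchy_prod a b) h (B y y').
Proof.
move=> ab bb p0 p1 hp ay by'.
have q0 : 0 <= p ^+ 2 by rewrite exprn_ge0.
have q1 : p ^+ 2 < 1 by rewrite expr_lt1.
have p1' : 0 < 1 - p by rewrite subr_gt0.
have q1' : 0 < 1 - p ^+ 2 by rewrite subr_gt0.
have M0 : 0 <= M by apply: le_trans (ab 0%N); rewrite expr0 mulr1 rnorm_ge0.
have M'0 : 0 <= M' by apply: le_trans (bb 0%N); rewrite expr0 mulr1 rnorm_ge0.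
pose A := `|K| * (M * M').
have A0 : 0 <= A by rewrite !mulr_ge0.
pose f i j := h ^+ (i + j) *: B (a i) (b j).
have hk (H : hilbertType R) (u : nat -> H) s' N k : cbound u s' N -> cnorm h <= p ^+ 2 * s' ->
    cnorm h ^+ k * rnorm (u k) <= N * (p ^+ 2) ^+ k.
  move=> ub hs'; apply: (@le_trans _ _ ((p ^+ 2 * s') ^+ k * rnorm (u k))).
    by rewrite ler_wpM2r ?rnorm_ge0// lerXn2r ?nnegrE ?cnorm_ge0// (le_trans (cnorm_ge0 h)).
  by rewrite exprMn -mulrA [leLHS]mulrC ler_wpM2r ?exprn_ge0// mulrC.
have hf i j : rnorm (f i j) <= A * ((p ^+ 2) ^+ i * (p ^+ 2) ^+ j).
  rewrite /f rnormZ cnormX exprD.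
  apply: (@le_trans _ _ (cnorm h ^+ i * cnorm h ^+ j * (`|K| * (rnorm (a i) * rnorm (b j))))).
    rewrite ler_wpM2l ?mulr_ge0 ?exprn_ge0 ?cnorm_ge0//.
    by apply: le_trans (B_le _ _) _; rewrite ler_wpM2r ?ler_norm// mulr_ge0 ?rnorm_ge0.
  rewrite /A -(mulrA `|K|) mulrCA ler_wpM2l//.
  rewrite mulrACA (mulrACA M) ler_pM ?mulr_ge0 ?exprn_ge0 ?cnorm_ge0 ?rnorm_ge0//.
    exact: hk ab hp.
  exact: hk bb hp.
have bigB n : B (psum a h n) (psum b h n) = \sum_(0 <= i < n) \sum_(0 <= j < n) f i j.
  rewrite !psumE linear_sumlz; apply: eq_bigr => i _.
  rewrite linear_sumr; apply: eq_bigr => j _.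
  by rewrite linearZl_LR linearZr_LR scalerA -exprD.
have bigc n : psum (cauchy_prod a b) h n =
    \sum_(0 <= i < n) \sum_(0 <= j < n - i) f i j.
  rewrite psumE /cauchy_prod.
  under eq_big_nat => k kn do rewrite scaler_sumr (big_ord_widen n (fun i => h ^+ k *: B (a i) (b (k - i)%N))) ?(andP kn).2//.
  rewrite big_mkord (exchange_big_dep xpredT)//= big_mkord.
  apply: eq_bigr => i _; rewrite -(big_mkord (fun k => i < k.+1)%N (fun k => h ^+ k *: B (a i) (b (k - i)%N))).
  rewrite (big_cat_nat (leq0n i) (ltnW (ltn_ord i)))/= big_nat_cond big1 ?add0r; last first.
    by move=> k /andP[/andP[_ ki]]; rewrite ltnS leqNgt ki.
  rewrite -{1}(add0n i) big_addn big_nat_cond [RHS]big_nat_cond.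
  apply: eq_big => [k|k _]; first by rewrite ltnS leq_addl andbT.
  by rewrite addnK /f addnC.
have hd n : rnorm (B (psum a h n) (psum b h n) - psum (cauchy_prod a b) h n) <=
    A / ((1 - p) * (1 - p ^+ 2)) * p ^+ n.
  rewrite bigB bigc -sumrB.
  apply: le_trans (rnorm_sum _ _) _.
  apply: (@le_trans _ _ (\sum_(0 <= i < n) A / (1 - p ^+ 2) * p ^+ n * p ^+ i)); last first.
    rewrite -mulr_sumr; apply: le_trans (ler_wpM2l _ (sum_expr_le 0 n p0 p1)) _.
      by rewrite !mulr_ge0 ?invr_ge0 ?exprn_ge0// ltW.
    by rewrite expr0 invfM le_eqVlt; apply/orP; left; apply/eqP; ring.
  rewrite !big_nat; apply: ler_sum => i /andP[_ i_n].
  rewrite (big_cat_nat (leq0n (n - i)%N) (leq_subr i n))/= addrAC subrr add0r.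
  apply: le_trans (rnorm_sum_geometric (M := A * (p ^+ 2) ^+ i) _ _ q0 q1 _ _) _.
  - by rewrite mulr_ge0// exprn_ge0.
  - by move=> j; rewrite -mulrA.
  have -> : A * (p ^+ 2) ^+ i * ((p ^+ 2) ^+ (n - i) / (1 - p ^+ 2)) = A / (1 - p ^+ 2) * (p ^+ n * p ^+ n).
    rewrite mulrA -(mulrA A) -(exprD (p ^+ 2)) subnKC ?(ltnW i_n)// -exprM mulnC muln2 -addnn exprD.
    by ring.
  rewrite -[leRHS]mulrA ler_wpM2l ?mulr_ge0 ?invr_ge0 ?(ltW q1')//.
  by rewrite ler_wpM2l ?exprn_ge0// (ler_wiXn2l p0 (ltW p1) (ltnW i_n)).
have Bn : B (psum a h n) (psum b h n) @[n --> \oo] --> B y y' by exact: bounded_bilinear_cvg ay by'.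
apply/cvg_seq_rnormP => e e0; have e2 : 0 < e / 2 by rewrite divr_gt0.
have [N1 h1] := (cvg_seq_rnormP _ _).1 Bn _ e2.
have [N2 h2] := geometric_lt (A / ((1 - p) * (1 - p ^+ 2))) p0 p1 e2.
exists (maxn N1 N2) => n; rewrite geq_max => /andP[/h1 n1 /h2 n2].
apply: le_lt_trans (rnorm_triangle (B (psum a h n) (psum b h n)) _ _) _.
by rewrite [e]splitr ltrD// (le_lt_trans (hd n)).
Qed.

End cauchy_product.

(** * Parseval's identity *)

Section segment_integral.
Context {R : realType}.
Local Notation mu := (@lebesgue_measure R).
Implicit Types (f g F : R -> R) (a b : R).

Lemma integrable_cont f a b : continuous f -> mu.-integrable `[a, b] (EFin \o f).
Proof.
by move=> cf; apply: continuous_compact_integrable;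
  [exact: segment_compact | exact: continuous_subspaceT].
Qed.

Lemma Rint_contD f g a b : continuous f -> continuous g ->
  \int[mu]_(x in `[a, b]) (f x + g x) =
  \int[mu]_(x in `[a, b]) f x + \int[mu]_(x in `[a, b]) g x.
Proof. by move=> cf cg; rewrite RintegralD//; exact: integrable_cont. Qed.

Lemma Rint_contZ f a b (k : R) : continuous f ->
  \int[mu]_(x in `[a, b]) (k * f x) = k * \int[mu]_(x in `[a, b]) f x.
Proof. by move=> cf; rewrite RintegralZl//; exact: integrable_cont. Qed.

Lemma continuous_sumR I (r : seq I) (f : I -> R -> R) :
  (forall i, continuous (f i)) -> continuous (fun x => \sum_(i <- r) f i x).
Proof.
move=> cf; elim: r => [|i r ih] x.
  rewrite (_ : (fun _ => _) = cst 0); first exact: cst_continuous.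
  by apply/funext => y; rewrite big_nil.
rewrite (_ : (fun _ => _) = f i \+ fun x => \sum_(i <- r) f i x).
  by apply: continuousD; [exact: cf | exact: ih].
by apply/funext => y; rewrite big_cons.
Qed.

Lemma Rint_cont_sum I (r : seq I) (f : I -> R -> R) a b : (forall i, continuous (f i)) ->
  \int[mu]_(x in `[a, b]) (\sum_(i <- r) f i x) =
  \sum_(i <- r) \int[mu]_(x in `[a, b]) f i x.
Proof.
move=> cf; elim: r => [|i r ih].
  by under eq_Rintegral do rewrite big_nil; rewrite Rintegral_cst// mul0r big_nil.
under eq_Rintegral do rewrite big_cons.
by rewrite Rint_contD ?ih ?big_cons//; exact: continuous_sumR.
Qed.

Lemma Rint_cont_le f g a b : continuous f -> continuous g ->
  (forall x, x \in `[a, b] -> f x <= g x) ->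
  \int[mu]_(x in `[a, b]) f x <= \int[mu]_(x in `[a, b]) g x.
Proof. by move=> cf cg h; apply: le_Rintegral => //; exact: integrable_cont. Qed.

Lemma Rint_segment_cst a b (k : R) : a <= b ->
  \int[mu]_(x in `[a, b]) k = k * (b - a).
Proof.
rewrite Rintegral_cst//= lebesgue_measure_itv/= lte_fin le_eqVlt => /orP[/eqP->|->//].
by rewrite ltxx subrr.
Qed.

Lemma Rint_derive F f a b : a < b -> continuous f -> (forall x : R, is_derive x (1 : R) F (f x)) ->
  \int[mu]_(x in `[a, b]) f x = F b - F a.
Proof.
move=> ab cf dF; rewrite /Rintegral (continuous_FTC2 (F := F))//.
- exact: continuous_subspaceT.
- have cF x : {for x, continuous F}.
    by apply: differentiable_continuous; apply/derivable1_diffP; case: (dF x).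
  split=> [x _||]; first by case: (dF x).
  + by apply: cvg_at_right_filter; exact: cF.
  + by apply: cvg_at_left_filter; exact: cF.
- by move=> x _; rewrite derive1E; case: (dF x).
Qed.

End segment_integral.

(** * Orthogonality of trigonometric monomials *)

Section trigonometric.
Context {R : realType}.
Local Notation mu := (@lebesgue_measure R).
Implicit Types (c : R[i]) (a b t : R) (n : nat).

Definition trig c n t : R := complex.Re (c * cis t ^+ n).

Lemma trigE c n t :
  trig c n t = complex.Re c * cos (n%:R * t) - complex.Im c * sin (n%:R * t).
Proof. by rewrite /trig cisX; case: c. Qed.

Lemma continuous_lin (k : R) : continuous (fun t : R => k * t).
Proof. by move=> t; apply: cvgMr; exact: cvg_id. Qed.

Lemma trig_continuous c n : continuous (trig c n).
Proof.
rewrite (_ : trig c n = fun t => complex.Re c * cos (n%:R * t) - complex.Im c * sin (n%:R * t)).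
  move=> t; apply: cvgB; apply: cvgMr.
    by apply: (continuous_comp (@continuous_lin _ _)); exact: continuous_cos.
  by apply: (continuous_comp (@continuous_lin _ _)); exact: continuous_sin.
by apply/funext => t; rewrite trigE.
Qed.

(** The primitive is [Re (- i c e^(i n t)) / n], a function of [cis t]. The endpoints are left
    general because [[0, 2 pi]], [[t - pi, t + pi]] and [[- 2 pi, 4 pi]] all occur. *)
Lemma int_trig c n a b : a < b -> cis a = cis b -> (0 < n)%N ->
  \int[mu]_(t in `[a, b]) trig c n t = 0.
Proof.
move=> ab cab n0; have n0' : (n%:R : R) != 0 by rewrite pnatr_eq0 -lt0n.
pose F := fun t => (n%:R)^-1 * (complex.Re c * sin (n%:R * t) + complex.Im c * cos (n%:R * t)).
have dF (t : R) : is_derive t (1 : R) F (trig c n t).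
  rewrite trigE /F.
  have dl : is_derive t 1 (fun t : R => n%:R * t) n%:R.
    by apply: is_derive_eq; rewrite /GRing.scale/= ?(mulr0, add0r, addr0, mulr1).
  have ds : is_derive t 1 (fun t => sin (n%:R * t)) (cos (n%:R * t) * n%:R).
    by apply: (@is_derive1_comp _ sin (fun t => n%:R * t)).
  have dc : is_derive t 1 (fun t => cos (n%:R * t)) (- sin (n%:R * t) * n%:R).
    by apply: (@is_derive1_comp _ cos (fun t => n%:R * t)).
  apply: is_derive_eq.
  rewrite /GRing.scale/= ?scaler0 ?mulr0 ?addr0 ?add0r.
  by field.
rewrite (Rint_derive ab (@trig_continuous c n) dF).
have : trig (- 'i * c) n b = trig (- 'i * c) n a by rewrite /trig cab.
have E t : F t = n%:R^-1 * trig (- 'i * c) n t.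
  rewrite trigE /F; congr (_ * _); clear F dF; case: c => x y /=; ring.
by rewrite !E => ->; rewrite subrr.
Qed.

Lemma int_trig0 c a b : a <= b ->
  \int[mu]_(t in `[a, b]) trig c 0 t = complex.Re c * (b - a).
Proof.
move=> ab; rewrite -(Rint_segment_cst _ ab); apply: eq_Rintegral => t _.
by rewrite /trig expr0 mulr1.
Qed.

(** A cross term of a squared norm: the two natural exponents encode the integer frequency
    [m - n]. *)
Definition trig2 c m n t : R := complex.Re (c * cis t ^+ m * (cis t ^+ n)^*).

Lemma trig2E c m n t : trig2 c m n t =
  if (n <= m)%N then trig c (m - n) t else trig (c^*) (n - m) t.
Proof.
have key k l (w : R[i]) : (l <= k)%N -> w * cis t ^+ k * (cis t ^+ l)^* = w * cis t ^+ (k - l).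
  move=> lk; rewrite -[in LHS](subnK lk) exprD mulrA -mulrA rmorphXn/= -exprMn cisK_conj.
  by rewrite expr1n mulr1.
rewrite /trig2 /trig; case: leqP => [nm|mn]; first by rewrite key.
rewrite -ReJ -key ?(ltnW mn)// !rmorphM/= conjcK; congr complex.Re; ring.
Qed.

Lemma trig2_continuous c m n : continuous (trig2 c m n).
Proof.
have [nm|mn] := leqP n m.
- have -> : trig2 c m n = trig c (m - n) by apply/funext => t; rewrite trig2E nm.
  exact: trig_continuous.
- have -> : trig2 c m n = trig (c^*) (n - m) by apply/funext => t; rewrite trig2E leqNgt mn.
  exact: trig_continuous.
Qed.

Lemma int_trig2 c m n a b : a < b -> cis a = cis b ->
  \int[mu]_(t in `[a, b]) trig2 c m n t = if m == n then complex.Re c * (b - a) else 0.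
Proof.
move=> ab cab; have [<-|mn] := eqVneq m n.
  rewrite -int_trig0 ?ltW//; apply: eq_Rintegral => t _.
  by rewrite trig2E leqnn subnn.
under eq_Rintegral do rewrite trig2E.
case: leqP => [nm|nm]; rewrite int_trig// subn_gt0//.
by rewrite ltn_neqAle eq_sym mn.
Qed.

End trigonometric.

(** * Mean squares of polynomials and the bound on coefficients *)

Section parseval.
Context {R : realType} {E : hilbertType R}.
Local Notation mu := (@lebesgue_measure R).
Implicit Types (u : nat -> E).

Lemma cis_lipschitz (s t : R) : cnorm (cis s - cis t) <= `|cos s - cos t| + `|sin s - sin t|.
Proof.
have -> : cis s - cis t = (cos s - cos t)%:C + 'i * (sin s - sin t)%:C.
  by apply/eqP; rewrite eq_complex/=; apply/andP; split; apply/eqP; ring.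
apply: le_trans (cnormD _ _) _; rewrite cnormM !cnorm_real.
by rewrite [cnorm 'i]/cnorm normc_def/= expr0n expr1n add0r sqrtr1 mul1r.
Qed.

Lemma cis_near (t e : R) : 0 < e -> \forall s \near t, cnorm (cis s - cis t) < e.
Proof.
move=> e0; have e2 : 0 < e / 2 by rewrite divr_gt0.
have hc := @continuous_cos R t; move/cvgrPdist_lt : hc => /(_ _ e2) hc.
have hs := @continuous_sin R t; move/cvgrPdist_lt : hs => /(_ _ e2) hs.
near=> s; apply: le_lt_trans (cis_lipschitz _ _) _.
rewrite [e]splitr ltrD// distrC; near: s; [exact: hc | exact: hs].
Unshelve. all: by end_near. Qed.

Lemma rdot_psum u (t : R) N (x : E) :
  rdot (psum u (cis t) N) x = \sum_(k < N) trig <| u k, x |> k t.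
Proof.
rewrite /rdot /psum dot_suml Re_sum; apply: eq_bigr => k _.
by rewrite dotZl mulrC.
Qed.

Lemma psum_sqr u (t : R) N : rnorm (psum u (cis t) N) ^+ 2 =
  \sum_(m < N) \sum_(n < N) trig2 <| u m, u n |> m n t.
Proof.
rewrite -rdotxx /rdot {1}/psum dot_suml Re_sum; apply: eq_bigr => m _.
rewrite /psum dot_sumr Re_sum; apply: eq_bigr => n _.
by rewrite dotZl dotZr /trig2; congr complex.Re; ring.
Qed.

Lemma psum_sqr_continuous u N : continuous (fun t : R => rnorm (psum u (cis t) N) ^+ 2).
Proof.
have -> : (fun t : R => rnorm (psum u (cis t) N) ^+ 2) =
    fun t => \sum_(m < N) \sum_(n < N) trig2 <| u m, u n |> m n t.
  by apply/funext => t; rewrite psum_sqr.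
by apply: continuous_sumR => m; apply: continuous_sumR => n; exact: trig2_continuous.
Qed.

Lemma parseval u N (a b : R) : a < b -> cis a = cis b ->
  \int[mu]_(t in `[a, b]) (rnorm (psum u (cis t) N) ^+ 2) =
  (\sum_(n < N) rnorm (u n) ^+ 2) * (b - a).
Proof.
move=> ab cab; under eq_Rintegral do rewrite psum_sqr.
rewrite Rint_cont_sum => [|m]; last first.
  by apply: continuous_sumR => n; exact: trig2_continuous.
rewrite mulr_suml; apply: eq_bigr => m _.
rewrite Rint_cont_sum => [|n]; last exact: trig2_continuous.
under eq_bigr do rewrite int_trig2//.
rewrite (bigD1 m)//= eqxx -/(rdot (u m) (u m)) rdotxx big1 ?addr0// => n nm.
by rewrite -val_eqE eq_sym in nm; rewrite (negbTE nm).
Qed.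

Lemma cis0 : cis 0 = 1 :> R[i].
Proof. by rewrite /cis cos0 sin0. Qed.

Lemma cis2pi : cis (2 * pi) = 1 :> R[i].
Proof. by rewrite /cis mulr_natl cos2pi sin2pi. Qed.

Lemma twopi_gt0 : 0 < 2 * pi :> R.
Proof. by rewrite mulr_gt0// pi_gt0. Qed.

Lemma psum_scale u (r : R[i]) z N : psum u (r * z) N = psum (fun k => r ^+ k *: u k) z N.
Proof. by rewrite /psum; apply: eq_bigr => k _; rewrite scalerA exprMn mulrC. Qed.

(* Each coefficient is dominated by the mean square given by Parseval's identity. *)
Lemma psum_coef_le u N (r B : R) : 0 <= r -> 0 <= B ->
  (forall t : R, rnorm (psum u (r%:C * cis t) N) <= B) ->
  forall n, (n < N)%N -> rnorm (u n) * r ^+ n <= B.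
Proof.
move=> r0 B0 hB n nN.
pose v k := r%:C ^+ k *: u k.
have hv k : rnorm (v k) = rnorm (u k) * r ^+ k.
  by rewrite rnormZ cnormX cnorm_real ger0_norm// mulrC.
have ab : 0 < 2 * pi - 0 :> R by rewrite subr0 twopi_gt0.
have : (\sum_(k < N) rnorm (v k) ^+ 2) * (2 * pi - 0) <= B ^+ 2 * (2 * pi - 0).
  rewrite -parseval ?twopi_gt0 ?cis0 ?cis2pi//.
  rewrite -Rint_segment_cst ?(ltW twopi_gt0)//.
  apply: Rint_cont_le => [||t _]; [exact: psum_sqr_continuous|exact: cst_continuous|].
  by rewrite -psum_scale lerXn2r ?nnegrE ?rnorm_ge0.
rewrite ler_pM2r// => h; rewrite -hv -(ler_pXn2r (n := 2)) ?nnegrE ?rnorm_ge0//.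
apply: le_trans h; rewrite (bigD1 (Ordinal nN))//= lerDl sumr_ge0// => i _.
exact: sqr_ge0.
Qed.

(** The bound for polynomials is applied to a partial sum that contains degree [n] and lies
    uniformly within [e] of the sum on the circle; [e] is arbitrary. *)
Lemma cauchy_estimate u (s M r B : R) : cbound u s M -> 0 < r -> r < s ->
  (forall t : R, exists2 y, psums u (r%:C * cis t) y & rnorm y <= B) ->
  forall n, rnorm (u n) * r ^+ n <= B.
Proof.
move=> ub r0 rs hB n.
have s0 : 0 < s by exact: lt_trans rs.
have B0 : 0 <= B by have [y _] := hB 0; apply: le_trans; exact: rnorm_ge0.
pose q := r / s.
have q0 : 0 <= q by rewrite divr_ge0// ltW.
have q1 : q < 1 by rewrite ltr_pdivrMr// mul1r.
have hq t : cnorm (r%:C * cis t) <= q * s.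
  by rewrite cnormM cnorm_real cnorm_cis mulr1 gtr0_norm// /q divfK ?gt_eqF.
apply/ler_addgt0Pr => e e0.
have [N hN] := geometric_lt (M / (1 - q)) q0 q1 e0.
pose N' := maxn N n.+1.
apply: (@psum_coef_le _ N') => //; [exact: ltW|by rewrite addr_ge0// ltW| |].
  move=> t; have [y hy yB] := hB t.
  have := psum_tail ub q0 q1 (hq t) hy N'.
  have := hN N' (leq_maxl _ _) => h1 h2.
  rewrite -[psum _ _ _](subrK y); apply: le_trans (rnormD _ _) _.
  rewrite addrC lerD// rnorm_subC (le_trans h2)//; apply: le_trans (ltW h1).
  by rewrite mulrAC mulrA.
by rewrite leq_max ltnSn orbT.
Qed.

End parseval.

(** * Taylor expansion on the disc *)

Section taylor_expansion.
Context {R : realType} {E : hilbertType R}.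
Implicit Types (f : R[i] -> E) (a b : nat -> E) (z w h : R[i]).

Lemma polar_form z : exists2 t : R, 0 <= t <= 2 * pi & z = (cnorm z)%:C * cis t.
Proof.
have pi0 := @pi_ge0 R.
have [z0|z0] := eqVneq (cnorm z) 0.
  exists 0; first by rewrite lexx mulr_ge0.
  by rewrite z0 mul0r; apply/eqP; rewrite -normr_eq0 cnormE z0.
have zp : 0 < cnorm z by rewrite lt0r z0 cnorm_ge0.
pose x := complex.Re z / cnorm z; pose y := complex.Im z / cnorm z.
have xy : x ^+ 2 + y ^+ 2 = 1.
  have : (cnorm z ^+ 2)%:C = (complex.Re z ^+ 2 + complex.Im z ^+ 2)%:C.
    by rewrite add_Re2_Im2 cnormE rmorphXn.
  move/complexI => h.
  by rewrite /x /y !expr_div_n -mulrDl -h divff// expf_neq0.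
have x1 : -1 <= x <= 1.
  by rewrite -ler_norml -(ler_pXn2r (n := 2)) ?nnegrE// expr1n real_normK ?num_real// -xy lerDl sqr_ge0.
have zE : z = (cnorm z)%:C * (x +i* y).
  apply/eqP; rewrite eq_complex/= !mul0r subr0 addr0 /x /y.
  by rewrite ![_ * (_ / _)]mulrC !divfK// !eqxx.
have yE : Num.sqrt (1 - x ^+ 2) = `|y| by rewrite -xy addrAC subrr add0r sqrtr_sqr.
have ca : cos (acos x) = x by exact: acosK.
have sa : sin (acos x) = `|y| by rewrite -yE sin_acos.
have a0 := acos_ge0 x1; have api := acos_lepi x1.
have [y0|y0] := leP 0 y.
  exists (acos x); first by rewrite a0 (le_trans api)// ler_peMl// ler1n.
  by rewrite [LHS]zE /cis ca sa ger0_norm.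
exists (2 * pi - acos x).
  by rewrite subr_ge0 lerBlDr lerDl a0 andbT (le_trans api)// ler_peMl// ler1n.
rewrite [LHS]zE /cis addrC mulr_natl cosD2pi sinD2pi cosN sinN ca sa.
by rewrite ltr0_norm// opprK.
Qed.

(** A single number [e] serves as radius of validity and, through [e^-1], as bound on the terms.
    Uniformity over a circle can thus be stated for all small [e]. *)
Definition taylor_at f z e b : Prop :=
  cbound b e e^-1 /\ forall h, cnorm h < e -> psums b h (f (z + h)).

Lemma analytic_taylor_near f w : analytic_on_disc f -> disc w ->
  exists2 d : R, 0 < d & forall e, 0 < e -> e < d -> forall z, cnorm (z - w) < d ->
    exists b, taylor_at f z e b.
Proof.
move=> fa /fa [[e0 e0'] + [a ha]]; rewrite ltcE /= => /andP[/eqP ? e00]; subst e0'.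
have {}ha h : cnorm h < e0 -> psums a h (f (w + h)).
  move=> he; have := ha (w + h); rewrite addrC addKr cnormE ltcR => /(_ he).
  by [].
pose s := e0 / 2; have s0 : 0 < s by rewrite divr_gt0.
have se0 : s < e0 by rewrite /s; lra.
have [M M0 ab] : exists2 M, 0 <= M & cbound a s M.
  by apply: (psums_cbound (ltW s0) (ha _ _)); rewrite cnorm_real gtr0_norm.
pose eta := s / 4; have eta0 : 0 < eta by rewrite divr_gt0.
have M1 : 0 < 2 * M + 1 by rewrite ltr_wpDl// mulr_ge0.
(* Re-expansion with [q = 1/2] bounds the terms by [2 M], which is below [e^-1] as soon as
   [e < 1 / (2 M + 1)]. *)
exists (Num.min eta (2 * M + 1)^-1); first by rewrite lt_min eta0 invr_gt0.
move=> e ep; rewrite lt_min => /andP[e_eta eM] z; rewrite lt_min => /andP[zw _].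
have h2 : (0 : R) <= 1 / 2 by lra.
have h1 : (1 / 2 : R) < 1 by lra.
have hq : cnorm (z - w) + eta <= 1 / 2 * s by rewrite /eta in zw *; lra.
have [b [bb _ hb]] := reexp_cvg ab eta0 h2 h1 hq.
exists b; split=> [k|h hh].
  apply: le_trans (_ : rnorm (b k) * eta ^+ k <= _).
    by rewrite ler_wpM2l ?rnorm_ge0// lerXn2r ?nnegrE ?ltW.
  apply: le_trans (bb k) _.
  have -> : M / (1 - 1 / 2) = 2 * M by field.
  apply: le_trans (_ : 2 * M + 1 <= _); first by rewrite lerDl.
  by rewrite -[leLHS]invrK lef_pV2 ?posrE ?invr_gt0// ltW.
apply: hb; first exact: lt_trans e_eta.
have -> : z + h = w + (z - w + h) by rewrite addrA [w + _]addrC subrK.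
apply: ha; apply: le_lt_trans (cnormD _ _) _.
apply: lt_trans (_ : eta + eta < _); first by rewrite ltrD// (lt_trans hh).
by rewrite /eta /s; lra.
Qed.

(** Compactness of the set of angles, in covering form: a property valid for nearby angles and small
    [e] around each angle holds for all angles with one [e]. *)
Lemma taylor_uniform f (r : R) : analytic_on_disc f -> 0 <= r -> r < 1 ->
  \forall e \near 0^'+, forall t : R, 0 <= t <= 2 * pi ->
    forall z, cnorm (z - r%:C * cis t) < e -> exists b, taylor_at f z e b.
Proof.
move=> fa r0 r1.
pose P (e t : R) := forall z, cnorm (z - r%:C * cis t) < e -> exists b, taylor_at f z e b.
have /compact_near_coveringP K := @segment_compact R 0 (2 * pi).
have := K R (0^'+) P (at_right_proper_filter _).
have h (t : R) : `[0, 2 * pi]%classic t -> \forall t' \near t & e \near 0^'+, P e t'.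
  move=> _; have [d d0 hd] := analytic_taylor_near fa (disc_scale_cis t (introT andP (conj r0 r1))).
  have d2 : 0 < d / 2 by rewrite divr_gt0.
  near=> t' e => z /= ze.
  have ed : e < d / 2 by near: e; exact: nbhs_right_lt.
  apply: hd.
  - by rewrite /=; near: e; exact: nbhs_right_gt.
  - by apply: lt_trans ed _; lra.
  - have -> : z - r%:C * cis t = (z - r%:C * cis t') + r%:C * (cis t' - cis t).
      by rewrite mulrBr addrA subrK.
    apply: le_lt_trans (cnormD _ _) _.
    rewrite [d]splitr ltrD ?(lt_trans ze)// cnormM cnorm_real ger0_norm//.
    apply: le_lt_trans (_ : 1 * cnorm (cis t' - cis t) < _).
      by rewrite ler_wpM2r ?cnorm_ge0// ltW.
    by rewrite mul1r; near: t'; exact: cis_near.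
move=> /(_ h); apply: filterS => e he t t01; apply: he.
by rewrite /= in_itv.
Unshelve. all: by end_near. Qed.

(** At every centre of modulus [p = r - e/2], the [k]-th Taylor coefficient is at most [e^-1 / e^k].
    Viewed as a power series in the centre, it obeys Cauchy's estimate, whence
    [|a_n| C(n, k) p^(n-k) e^k <= e^-1]. Weighting by [(3/4)^k] and summing over [k] yields
    [|a_n| (p + 3 e / 4)^n <= 4 e^-1], and [p + 3 e / 4 = r + e / 4] exceeds [r]. *)
Lemma psums_extend f a (r e : R) : 0 < e -> e < r ->
  (forall z, cnorm z < r -> psums a z (f z)) ->
  (forall t : R, 0 <= t <= 2 * pi ->
    forall z, cnorm (z - r%:C * cis t) < e -> exists b, taylor_at f z e b) ->
  forall z, cnorm z < r + e / 4 -> psums a z (f z).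
Proof.
move=> e0 er ha hT.
pose p := r - e / 2; have p0 : 0 < p by rewrite /p; lra.
pose s := r - e / 4; have s0 : 0 < s by rewrite /s; lra.
have [M M0 ab] : exists2 M, 0 <= M & cbound a s M.
  apply: (psums_cbound (ltW s0) (ha _ _)); rewrite cnorm_real gtr0_norm// /s; lra.
have ncis (q t : R) : 0 <= q -> cnorm (q%:C * cis t) = q.
  by move=> q0; rewrite cnormM cnorm_real cnorm_cis mulr1 ger0_norm.
have hb (t : R) : 0 <= t <= 2 * pi -> exists b, taylor_at f (p%:C * cis t) e b /\
    forall k, reexp_sum a (p%:C * cis t) k n @[n --> \oo] --> b k.
  move=> t01; have [|b bT] := hT t t01 (p%:C * cis t).
    by rewrite -mulrBl -rmorphB cnormM cnorm_real cnorm_cis mulr1 ltr_norml /p; lra.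
  exists b; split=> //.
  pose eta := e / 8; have eta0 : 0 < eta by rewrite divr_gt0.
  pose q := (p + eta) / s.
  have q0 : 0 <= q by apply/ltW/divr_gt0 => //; apply: addr_gt0.
  have q1 : q < 1 by rewrite ltr_pdivrMr// mul1r /p /s /eta; lra.
  have hq : cnorm (p%:C * cis t) + eta <= q * s by rewrite ncis ?(ltW p0)// /q divfK ?gt_eqF.
  have [b' [_ b'l b's]] := reexp_cvg ab eta0 q0 q1 hq.
  suff -> : b = b' by [].
  apply: (psums_coef_unique (F := fun h => f (p%:C * cis t + h)) eta0) => h hh.
    by apply: bT.2; apply: lt_trans hh _; rewrite /eta; lra.
  apply: b's => //; apply: ha; apply: le_lt_trans (cnormD _ _) _.
  by rewrite ncis ?(ltW p0)//; move: hh; rewrite /p /eta; lra.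
(* Taylor expansions are supplied for angles in [[0, 2 pi]], whereas Cauchy's estimate ranges over
   all real angles. *)
have pE (t : R) : exists2 t', 0 <= t' <= 2 * pi & p%:C * cis t = p%:C * cis t'.
  have [t' t'01 tE] := polar_form (p%:C * cis t); exists t' => //.
  by rewrite [LHS]tE ncis// ltW.
have coef k n : (k <= n)%N -> rnorm (a n) * ('C(n, k)%:R * p ^+ (n - k) * e ^+ k) <= e^-1.
  (* [c] is the series of the [k]-th derivative divided by [k!]; at [p e^(it)] its sum is the Taylor
     coefficient [b k]. *)
  move=> kn; pose c m := ('C(m + k, k)%:R : R[i]) *: a (m + k)%N.
  have csum z m : psum c z m = reexp_sum a z k (m + k).
    rewrite psumE /reexp_sum -(big_mkord xpredT (fun j => (z ^+ (j - k) *+ 'C(j, k)) *: a j)).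
    rewrite (big_cat_nat (leq0n k) (leq_addl m k))/=.
    rewrite [X in _ = X + _]big_nat_cond [X in _ = X + _]big1 ?add0r; last first.
      by move=> j /andP[/andP[_ jk] _]; rewrite bin_small// mulr0n scale0r.
    rewrite -[X in \sum_(X <= j < m + k) _](add0n k) big_addn addnK; apply: eq_bigr => j _.
    by rewrite addnK /c scalerA mulr_natr.
  have ccvg z (y : E) : reexp_sum a z k m @[m --> \oo] --> y -> psums c z y.
    move=> /cvg_seq_rnormP h; apply/cvg_seq_rnormP => d /h[N hN].
    by exists N => m Nm; rewrite csum hN// (leq_trans Nm)// leq_addr.
  pose s' := r - 3 * e / 8; have s'0 : 0 < s' by rewrite /s'; lra.
  have [M' M'0 cb] : exists2 M', 0 <= M' & cbound c s' M'.
    pose eta := e / 16; have eta0 : 0 < eta by rewrite divr_gt0.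
    pose q := (s' + eta) / s.
    have q0 : 0 <= q by apply/ltW/divr_gt0 => //; apply: addr_gt0.
    have q1 : q < 1 by rewrite ltr_pdivrMr// mul1r /s /s' /eta; lra.
    have hq : cnorm s'%:C + eta <= q * s by rewrite cnorm_real gtr0_norm// /q divfK ?gt_eqF.
    have [b' [_ b'l _]] := reexp_cvg ab eta0 q0 q1 hq.
    exact: (psums_cbound (ltW s'0) (ccvg _ _ (b'l k))).
  have ps' : p < s' by rewrite /p /s'; lra.
  have hB (t : R) : exists2 y, psums c (p%:C * cis t) y & rnorm y <= e^-1 / e ^+ k.
    have [t' t'01 ->] := pE t; have [b [[bb _] bl]] := hb t' t'01.
    by exists (b k); [exact: ccvg | rewrite ler_pdivlMr ?exprn_gt0].
  have := cauchy_estimate cb p0 ps' hB (n - k)%N.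
  rewrite /c subnK// rnormZ ler_pdivlMr ?exprn_gt0// => h; apply: le_trans h.
  rewrite -[_%:R : R[i]](rmorph_nat (real_complex R)) cnorm_real ger0_norm//.
  by rewrite le_eqVlt; apply/orP; left; apply/eqP; ring.
have ei0 : 0 < e^-1 by rewrite invr_gt0.
have ab' : cbound a (r + e / 4) (e^-1 * 4).
  move=> n; have -> : r + e / 4 = p + 3 / 4 * e by rewrite /p; field.
  have q0 : (0 : R) <= 3 / 4 by lra.
  have q1 : (3 / 4 : R) < 1 by lra.
  rewrite exprDn mulr_sumr.
  apply: (@le_trans _ _ (\sum_(0 <= k < n.+1) e^-1 * (3 / 4) ^+ k)).
    rewrite big_mkord; apply: ler_sum => k _.
    apply: le_trans (ler_wpM2r (exprn_ge0 k q0) (coef k n _)); last by rewrite -ltnS.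
    rewrite exprMn -mulr_natr le_eqVlt; apply/orP; left; apply/eqP; ring.
  rewrite -mulr_sumr ler_wpM2l ?(ltW ei0)//.
  apply: le_trans (sum_expr_le 0 n.+1 q0 q1) _.
  by rewrite expr0 (_ : 1 / (1 - 3 / 4) = 4)//; field.
move=> z zs; have [zr|rz] := ltP (cnorm z) r; first exact: ha.
have [t t01 zE] := polar_form z.
have [b [[_ bT] bl]] := hb t t01.
have hE : cnorm (z - p%:C * cis t) = cnorm z - p.
  rewrite {1}zE -mulrBl -rmorphB cnormM cnorm_real cnorm_cis mulr1 ger0_norm//.
  by rewrite subr_ge0 /p; lra.
(* The midpoint between [|z| - p], the distance from [z] to the centre on its ray, and [3 e / 4],
   the gap from [p] to the new radius. Both the continued series and [f] then have the expansion [b]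
   at that centre, and both are read off at [z]. *)
pose eta := (cnorm z - p + 3 / 4 * e) / 2.
have eta0 : 0 < eta by rewrite divr_gt0//; rewrite /p; lra.
pose S := r + e / 4; have S0 : 0 < S by rewrite /S; lra.
pose q := (p + eta) / S.
have q0 : 0 <= q by apply/ltW/divr_gt0 => //; apply: addr_gt0.
have q1 : q < 1 by rewrite ltr_pdivrMr// mul1r /S /eta; move: zs; rewrite /p; lra.
have hq : cnorm (p%:C * cis t) + eta <= q * S by rewrite ncis ?(ltW p0)// /q divfK ?gt_eqF.
have [b' [_ b'l b's]] := reexp_cvg ab' eta0 q0 q1 hq.
have zq : cnorm z <= q * S by rewrite /q divfK ?gt_eqF// /eta; move: zs; rewrite /p; lra.
have [y hy _] := psum_cvg ab' q0 q1 zq.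
have bb' : b = b' by apply/funext => k; exact: cvg_rnorm_unique (bl k) (b'l k).
have y1 : psums b (z - p%:C * cis t) y.
  rewrite bb'; apply: b's; last by rewrite addrC subrK.
  by rewrite hE /eta; move: zs; rewrite /p; lra.
have y2 : psums b (z - p%:C * cis t) (f z).
  have := bT (z - p%:C * cis t); rewrite [p%:C * cis t + _]addrC subrK; apply.
  by rewrite hE; move: zs; rewrite /p; lra.
by rewrite (psums_unique y2 y1).
Qed.

(** Let [r] be the supremum of the radii at most 1 on which the series at 0 represents [f]. It is
    itself such a radius, and if [r < 1] then [psums_extend] would enlarge it. *)
Lemma analytic_power_series f : analytic_on_disc f ->
  exists a, forall z, disc z -> psums a z (f z).
Proof.
move=> fa.
have d0 : disc (0 : R[i]) by rewrite disc_cnorm cnorm0.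
have [d dp /(_ (d / 2) _ _ 0)] := analytic_taylor_near fa d0.
have d2 : 0 < d / 2 by rewrite divr_gt0.
have dd : d / 2 < d by lra.
rewrite subrr cnorm0 => /(_ d2 dd dp)[a [_ ha]].
exists a => z; rewrite disc_cnorm => z1.
pose S := [set r : R | 0 <= r <= 1 /\ forall z, cnorm z < r -> psums a z (f z)].
have S0 : S (Num.min 1 (d / 2)).
  split; first by rewrite le_min ler01 (ltW d2) ge_min lexx.
  by move=> w; rewrite lt_min => /andP[_ /ha]; rewrite add0r.
have hS : has_sup S by split; [exists (Num.min 1 (d / 2)) | exists 1 => r [/andP[]]].
pose r := sup S.
have rub x : S x -> x <= r by move=> Sx; exact: (ub_le_sup hS.2).
have r0 : 0 < r by apply: lt_le_trans (rub _ S0); rewrite lt_min ltr01.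
have hr w : cnorm w < r -> psums a w (f w).
  rewrite -subr_gt0 => wr; have [x [x01 hx]] := sup_adherent wr hS.
  by rewrite opprB addrC subrK; exact: hx.
have [r1|r1] := leP 1 r; first by apply: hr; exact: lt_le_trans r1.
have r1' : 0 < 1 - r by rewrite subr_gt0.
have [e [[e0 er] [e1 hT]]] := filter_ex (filterI (filterI (nbhs_right_gt 0) (nbhs_right_lt r0))
  (filterI (nbhs_right_lt r1') (taylor_uniform fa (ltW r0) r1))).
have := rub (r + e / 4); rewrite leNgt ltrDl divr_gt0// => h; exfalso.
suff /h : S (r + e / 4) by [].
split; first by apply/andP; split; lra.
exact: psums_extend e0 er hr hT.
Qed.

(** The converse, by re-expansion; it yields the analyticity of wedge products, whose series at 0 is
    a combination of Cauchy products. *)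
Lemma power_series_analytic a f :
  (forall z, disc z -> psums a z (f z)) -> analytic_on_disc f.
Proof.
move=> ha z; rewrite disc_cnorm => z1; have z0 := cnorm_ge0 z.
pose s := (cnorm z + 1) / 2; have s0 : 0 < s by rewrite /s; lra.
have [M M0 ab] : exists2 M, 0 <= M & cbound a s M.
  apply: (psums_cbound (ltW s0) (ha _ _)); rewrite disc_cnorm cnorm_real gtr0_norm// /s; lra.
pose eta := (s - cnorm z) / 2; have eta0 : 0 < eta by rewrite /eta /s; lra.
pose q := (cnorm z + eta) / s.
have q0 : 0 <= q by rewrite divr_ge0 ?addr_ge0// ltW.
have q1 : q < 1 by rewrite ltr_pdivrMr// mul1r /eta /s; lra.
have hq : cnorm z + eta <= q * s by rewrite /q divfK ?gt_eqF.
have [b [_ _ hb]] := reexp_cvg ab eta0 q0 q1 hq.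
exists eta%:C; first by rewrite ltcR.
exists b => w; rewrite cnormE ltcR => wz; apply: hb => //.
rewrite addrC subrK; apply: ha; rewrite disc_cnorm -(subrK z w).
by apply: le_lt_trans (cnormD _ _) _; move: wz; rewrite /eta /s; lra.
Qed.

End taylor_expansion.

(** * The Poisson kernel *)

Section poisson_kernel.
Context {R : realType}.
Local Notation mu := (@lebesgue_measure R).
Implicit Types (r t s x : R) (c : R[i]) (n : nat).

Definition poisson r x : R := (1 - r ^+ 2) / (1 + r ^+ 2 - 2 * r * cos x).

Lemma poisson_den_ge r x : 0 <= r -> (1 - r) ^+ 2 <= 1 + r ^+ 2 - 2 * r * cos x.
Proof.
move=> r0; have := ler_wpM2l r0 (cos_le1 x); rewrite mulr1 => h.
by rewrite sqrrB expr1n mul1r -mulrA; lra.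
Qed.

Lemma poisson_den_gt0 r x : 0 <= r -> r < 1 -> 0 < 1 + r ^+ 2 - 2 * r * cos x.
Proof.
move=> r0 r1; apply: lt_le_trans (poisson_den_ge _ r0).
by rewrite exprn_gt0// subr_gt0.
Qed.

Lemma poisson_ge0 r x : 0 <= r -> r < 1 -> 0 <= poisson r x.
Proof.
by move=> r0 r1; rewrite divr_ge0 ?(ltW (poisson_den_gt0 _ _ _))// subr_ge0 expr_le1// ltW.
Qed.

Lemma poisson_continuous r t : 0 <= r -> r < 1 -> continuous (fun s => poisson r (s - t)).
Proof.
move=> r0 r1 s; apply: cvgMr; apply: cvgV; first by rewrite gt_eqF// poisson_den_gt0.
apply: cvgB; first exact: cvg_cst.
apply: cvgMr; apply: (@continuous_comp _ _ _ (fun s => s - t) cos).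
  by apply: cvgB; [exact: cvg_id | exact: cvg_cst].
exact: continuous_cos.
Qed.

(* [trigc c n t s] is [Re (c u ^ n)] for [u = e ^ (i (s - t))]. *)
Definition trigc c n t s : R := trig (c * (cis t)^* ^+ n) n s.

Lemma trigcE c n t s : trigc c n t s = complex.Re (c * (cis s * (cis t)^*) ^+ n).
Proof. by rewrite /trigc /trig exprMn; congr complex.Re; ring. Qed.

Lemma trigc_continuous c n t : continuous (trigc c n t).
Proof. exact: trig_continuous. Qed.

Lemma cosB_Re s t : cos (s - t) = complex.Re (cis s * (cis t)^*).
Proof. by rewrite cosB /=; ring. Qed.

Lemma trigc_le c n t s : `|trigc c n t s| <= cnorm c.
Proof.
rewrite trigcE; apply: le_trans (normRe_le _) _.
by rewrite cnormM cnormX cnormM cnormJ !cnorm_cis mulr1 expr1n mulr1.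
Qed.

Lemma trigc_rec c n t s : 2 * cos (s - t) * trigc c n.+1 t s = trigc c n.+2 t s + trigc c n t s.
Proof.
rewrite !trigcE cosB_Re; set u := cis s * _.
have uu : u * u^* = 1 by rewrite -sqr_normc cnormE cnormM cnormJ !cnorm_cis mulr1 expr1n.
rewrite -ReZ -ReD; congr complex.Re.
have -> : (2 * complex.Re u)%:C = u + u^* by rewrite addcJ rmorphM rmorph_nat.
rewrite !exprS.
have -> : (u + u^*) * (c * (u * u ^+ n)) = c * (u * (u * u ^+ n)) + c * ((u * u^*) * u ^+ n) by ring.
by rewrite uu mul1r.
Qed.

Lemma trigc_rec0 c t s : 2 * cos (s - t) * trigc c 0 t s = trigc c 1 t s + trigc (c^*) 1 t s.
Proof.
rewrite !trigcE cosB_Re; set u := cis s * _.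
rewrite expr0 expr1 mulr1; case: u => a b; case: c => d e /=; ring.
Qed.

Lemma cis_window t : cis (t - pi) = cis (t + pi).
Proof. by rewrite /cis cosB cosD sinB sinD sinpi !mulr0 subr0 !addr0 subr0. Qed.

(** The window is centred at [t], so that [|s - t| <= pi], the range on which the kernel is
    estimated. The kernel is not normalised: its integral is [2 pi]. *)
Definition poisson_coef r c n t : R :=
  \int[mu]_(s in `[t - pi, t + pi]) (poisson r (s - t) * trigc c n t s).

(* Multiplying the kernel by its denominator gives a three-term recurrence in
   [n]; its only bounded solutions are geometric with ratio [r]. *)
Lemma poisson_coefE r c n t : 0 < r -> r < 1 ->
  poisson_coef r c n t = 2 * pi * r ^+ n * complex.Re c.
Proof.
move=> r0 r1; pose J d m := poisson_coef r d m t.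
have pi0 := @pi_gt0 R.
have tt : t - pi < t + pi by lra.
have len : (t + pi) - (t - pi) = 2 * pi by ring.
have cP := @poisson_continuous r t (ltW r0) r1.
have cPw d m : continuous (fun s => poisson r (s - t) * trigc d m t s).
  by move=> s; apply: cvgM; [exact: cP | exact: trigc_continuous].
have PE s : poisson r (s - t) * (1 + r ^+ 2 - 2 * r * cos (s - t)) = 1 - r ^+ 2.
  by rewrite /poisson divfK// gt_eqF// poisson_den_gt0// ltW.
have key (d1 d2 d3 : R[i]) (n1 n2 n3 : nat) :
    (forall s, 2 * cos (s - t) * trigc d1 n1 t s = trigc d2 n2 t s + trigc d3 n3 t s) ->
    (1 - r ^+ 2) * \int[mu]_(s in `[t - pi, t + pi]) trigc d1 n1 t s =
    (1 + r ^+ 2) * J d1 n1 - r * J d2 n2 - r * J d3 n3.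
  move=> h; rewrite -Rint_contZ; last exact: trigc_continuous.
  have E s : (1 - r ^+ 2) * trigc d1 n1 t s =
      (1 + r ^+ 2) * (poisson r (s - t) * trigc d1 n1 t s) +
      (- r) * (poisson r (s - t) * trigc d2 n2 t s + poisson r (s - t) * trigc d3 n3 t s).
    by rewrite -(PE s) -mulrDr -h; ring.
  under eq_Rintegral do rewrite E.
  have c1 := cPw d1 n1; have c2 := cPw d2 n2; have c3 := cPw d3 n3.
  have c23 : continuous (fun s => poisson r (s - t) * trigc d2 n2 t s + poisson r (s - t) * trigc d3 n3 t s).
    by move=> s; apply: cvgD; [exact: c2 | exact: c3].
  rewrite Rint_contD ?Rint_contZ ?Rint_contD//.
  - by rewrite /J /poisson_coef; ring.
  - by move=> s; apply: cvgMr; exact: c1.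
  - by move=> s; apply: cvgMr; exact: c23.
have rec d m : J d m.+1 - r * J d m = r * (J d m.+2 - r * J d m.+1).
  have := key _ _ _ _ _ _ (trigc_rec d m t).
  rewrite int_trig ?cis_window// mulr0 => /eqP; rewrite eq_sym => /eqP h.
  by apply/eqP; rewrite -subr_eq0; apply/eqP; rewrite -[RHS]h; ring.
(* The defect from being geometric is [r^m] times a bounded quantity for every [m], hence zero. *)
have dpow d m : J d 1%N - r * J d 0%N = r ^+ m * (J d m.+1 - r * J d m).
  by elim: m => [|m ih]; [rewrite expr0 mul1r | rewrite ih rec exprSr mulrA].
pose B := \int[mu]_(s in `[t - pi, t + pi]) poisson r (s - t).
have B0 : 0 <= B by apply: Rintegral_ge0 => s _; exact: poisson_ge0 (ltW r0) r1.
have JB d m : `|J d m| <= cnorm d * B.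
  apply: le_trans (le_normr_Rintegral _ _) _ => //; first exact: integrable_cont.
  rewrite -Rint_contZ//; apply: Rint_cont_le.
  - by move=> s; apply: cvg_norm; exact: cPw.
  - by move=> s; apply: cvgMr; exact: cP.
  - move=> s _; rewrite normrM ger0_norm ?(poisson_ge0 _ (ltW r0))// mulrC.
    by rewrite ler_wpM2r ?(poisson_ge0 _ (ltW r0))// trigc_le.
have J1 d : J d 1%N = r * J d 0%N.
  apply/eqP; rewrite -subr_eq0 -normr_eq0; apply/eqP/ge0_eps_eq0 => // e e0.
  have [N hN] := geometric_lt (2 * (cnorm d * B)) (ltW r0) r1 e0.
  rewrite (dpow d N) normrM ger0_norm ?exprn_ge0 ?(ltW r0)//.
  apply: le_trans (ltW (hN N (leqnn _))); rewrite mulrC ler_wpM2r ?exprn_ge0 ?(ltW r0)//.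
  apply: le_trans (ler_normB _ _) _; rewrite mulr_natl mulr2n lerD ?JB//.
  rewrite normrM gtr0_norm//; apply: le_trans (JB d N).
  by rewrite ler_piMl// ltW.
(* At index 0 the factor [u + u^-1] produces a power -1, read as the conjugate of a power 1. The
   recurrence then involves both [d] and its conjugate, which share the same [J 0]. *)
have J0 d : J d 0%N = 2 * pi * complex.Re d.
  have JJ : J (d^*) 0%N = J d 0%N.
    apply: eq_Rintegral => s _; congr (_ * _).
    by rewrite !trigcE !expr0 !mulr1 ReJ.
  have := key _ _ _ _ _ _ (trigc_rec0 d t).
  rewrite /trigc expr0 mulr1 int_trig0 ?ltW// len !J1 JJ => h.
  have r2 : 1 - r ^+ 2 != 0 by rewrite subr_eq0 eq_sym lt_eqF// expr_lt1// ltW.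
  apply: (mulfI r2); rewrite -[LHS]addr0 -[0](subrr ((1 + r ^+ 2) * J d 0%N)).
  have -> : (1 - r ^+ 2) * (2 * pi * complex.Re d) = (1 - r ^+ 2) * (complex.Re d * (2 * pi)) by ring.
  by rewrite h; ring.
have Jn d m : J d m = r ^+ m * J d 0%N.
  elim: m => [|m ih]; first by rewrite expr0 mul1r.
  have := dpow d m; rewrite J1 subrr => /esym/eqP.
  rewrite mulf_eq0 expf_eq0 (gt_eqF r0) andbF/= subr_eq0 => /eqP ->.
  by rewrite ih exprS mulrA.
by rewrite -/(J c n) Jn J0; ring.
Qed.

Lemma poisson_psum (E : hilbertType R) (a : nat -> E) N r t (x : E) : 0 < r -> r < 1 ->
  \int[mu]_(s in `[t - pi, t + pi]) (poisson r (s - t) * rdot (psum a (cis s) N) x) =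
  2 * pi * rdot (psum a (r%:C * cis t) N) x.
Proof.
move=> r0 r1.
have tcis k s : trig <| a k, x |> k s = trigc (<| a k, x |> * cis t ^+ k) k t s.
  by rewrite /trigc -mulrA -exprMn cisK_conj expr1n mulr1.
under eq_Rintegral do rewrite rdot_psum mulr_sumr.
rewrite Rint_cont_sum => [|k]; last first.
  by move=> s; apply: cvgM; [exact: poisson_continuous (ltW r0) r1 _ | exact: trig_continuous].
rewrite psum_scale rdot_psum mulr_sumr; apply: eq_bigr => k _.
under eq_Rintegral do rewrite tcis.
rewrite -/(poisson_coef r _ _ _) poisson_coefE// /trig dotZl -mulrA.
by rewrite -rmorphXn/= -[_%:C * _ * _]mulrA ReZ.
Qed.

Lemma cos_pi4_ge : 1 / 2 <= cos (pi / 4) :> R.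
Proof.
have pi0 := @pi_gt0 R.
have h0 : 0 <= cos (pi / 4) :> R by apply: cos_ge0_pihalf; apply/andP; split; lra.
rewrite -(ler_pXn2r (n := 2)) ?nnegrE//.
have := @cos_pihalf R; have -> : pi / 2 = (pi / 4) *+ 2 :> R by rewrite -mulr_natr; field.
rewrite cos_mulr2n => h.
have -> : cos (pi / 4) ^+ 2 = 1 / 2 :> R by rewrite mulr2n in h; lra.
lra.
Qed.

(** Mean value theorem on [[0, x/2]], where the cosine is at least [cos (pi/4) >= 1/2], then
    monotonicity of the sine. *)
Lemma sin_ge_quarter x : 0 <= x <= pi / 2 -> x / 4 <= sin x.
Proof.
move=> /andP[x0 xpi]; have pi0 := @pi_gt0 R.
have [->|xn0] := eqVneq x 0; first by rewrite sin0 mul0r.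
have xp : 0 < x / 2 by rewrite divr_gt0// lt0r xn0.
apply: (@le_trans _ _ (sin (x / 2))); last first.
  have [->|] := eqVneq (x / 2) x => //.
  move=> _; apply: ltW; rewrite ltr_sin ?in_itv/=; [lra| |]; apply/andP; split; lra.
have [|c] := @MVT _ sin cos 0 (x / 2) xp (fun y _ => is_derive_sin y).
  by apply: continuous_subspaceT; exact: continuous_sin.
rewrite in_itv/= => /andP[c0 cx]; rewrite sin0 !subr0 => ->.
apply: le_trans (_ : 1 / 2 * (x / 2) <= _); first lra.
rewrite ler_wpM2r ?(ltW xp)//; apply: le_trans cos_pi4_ge _.
by apply: ltW; rewrite ltr_cos ?in_itv/=; [lra| |]; apply/andP; split; lra.
Qed.

(** By the half-angle formula, [1 - cos y = 2 sin^2 (y/2) >= 2 (y/8)^2]. *)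
Lemma cos_quadratic x : `|x| <= pi -> x ^+ 2 / 32 <= 1 - cos x.
Proof.
move=> xpi; have -> : cos x = cos `|x| by rewrite cos_norm.
have -> : x ^+ 2 = `|x| ^+ 2 by rewrite real_normK ?num_real.
set y := `|x| in xpi *; have y0 : 0 <= y by rewrite normr_ge0.
have hs : y / 2 / 4 <= sin (y / 2) by apply: sin_ge_quarter; apply/andP; split; lra.
have -> : 1 - cos y = 2 * sin (y / 2) ^+ 2.
  rewrite [in LHS](_ : y = (y / 2) *+ 2); last by rewrite -mulr_natr; field.
  by rewrite cos_mulr2n -mulr_natr; have := cos2Dsin2 (y / 2); lra.
have : (y / 2 / 4) ^+ 2 <= sin (y / 2) ^+ 2 by rewrite lerXn2r ?nnegrE//; lra.
have -> : (y / 2 / 4) ^+ 2 = y ^+ 2 / 64 by field.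
lra.
Qed.

(* A sum of normalized indicators of dyadic balls: it turns Poisson integrals
   into averages controlled by the Hardy-Littlewood maximal function. *)
Lemma poisson_le r x K : 1 / 2 <= r -> r < 1 -> `|x| <= pi -> pi < 2 ^+ K * (1 - r) ->
  poisson r x <= \sum_(k < K.+1) 2 ^+ 8 / (4 ^+ k * (1 - r)) * (`|x| < 2 ^+ k * (1 - r))%R%:R.
Proof.
have : 256 <= 2 ^+ 8 :> R by rewrite -natrX ler_nat.
move: (2 ^+ 8) => c c256; have c0 : 0 <= c by lra.
move=> r2 r1 xpi hK; set d := 1 - r; have d0 : 0 < d by rewrite subr_gt0.
have r0 : 0 <= r by lra.
have ex : exists k, `|x| < 2 ^+ k * d by exists K; exact: le_lt_trans xpi hK.
(* Only the smallest dyadic ball containing [x] is kept. If [k = 0], the denominator is at least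
   [d^2]; otherwise minimality gives [|x| >= 2^(k-1) d], and the quadratic bound on the cosine
   applies. *)
case: (ex_minnP ex) => k hk kmin.
have kK : (k < K.+1)%N by rewrite ltnS kmin// (le_lt_trans xpi hK).
rewrite (bigD1 (Ordinal kK))//= hk mulr1.
apply: (@le_trans _ _ (c / (4 ^+ k * d))); last first.
  by rewrite lerDl sumr_ge0// => i _; rewrite !mulr_ge0// invr_ge0 mulr_ge0 ?exprn_ge0// ltW.
have p4 : 0 < 4 ^+ k * d :> R by rewrite mulr_gt0// exprn_gt0.
have D0 := poisson_den_gt0 x r0 r1.
rewrite /poisson ler_pdivrMr// mulrAC ler_pdivlMr//.
have n2 : 1 - r ^+ 2 <= 2 * d by rewrite /d; have := sqr_ge0 (1 - r); rewrite sqrrB; lra.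
apply: (@le_trans _ _ (2 * d * (4 ^+ k * d))); first by rewrite ler_wpM2r// ltW.
case: k hk kmin kK p4 => [|k] hk kmin kK p4.
  rewrite expr0 mul1r -mulrA; apply: le_trans (ler_wpM2l _ (poisson_den_ge x r0)) => //.
  rewrite -/d -expr2.
  have : 256 * d ^+ 2 <= c * d ^+ 2 by rewrite ler_wpM2r ?sqr_ge0.
  by have := sqr_ge0 d; lra.
have kx : 2 ^+ k * d <= `|x|.
  by rewrite leNgt; apply/negP => /kmin; rewrite ltnn.
have : (2 ^+ k * d) ^+ 2 <= `|x| ^+ 2 by rewrite lerXn2r ?nnegrE// mulr_ge0// ?exprn_ge0// ltW.
rewrite real_normK ?num_real// exprMn -exprM mulnC exprM => h.
have -> : 2 * d * (4 ^+ k.+1 * d) = 8 * ((2 ^+ 2) ^+ k * d ^+ 2).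
  by rewrite exprS (_ : 2 ^+ 2 = 4 :> R)//; [ring | rewrite expr2; ring].
apply: le_trans (ler_wpM2l _ h) _ => //.
have hc := cos_quadratic xpi.
have : 2 * r * (x ^+ 2 / 32) <= 2 * r * (1 - cos x) by rewrite ler_wpM2l// mulr_ge0.
have : 1 * (x ^+ 2 / 32) <= 2 * r * (x ^+ 2 / 32).
  by rewrite ler_wpM2r ?divr_ge0 ?sqr_ge0//; lra.
have D1 : 256 * (1 + r ^+ 2 - 2 * r * cos x) <= c * (1 + r ^+ 2 - 2 * r * cos x).
  by rewrite ler_wpM2r// ltW.
have := sqr_ge0 (1 - r); rewrite sqrrB; lra.
Qed.

End poisson_kernel.

(** * Radial limits *)

Section radial_maximal.
Context {R : realType} {E : hilbertType R}.
Local Notation mu := (@lebesgue_measure R).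
Implicit Types (a : nat -> E) (N : nat) (r t s c : R).

Lemma psum_rnorm_continuous a N : continuous (fun t : R => rnorm (psum a (cis t) N)).
Proof.
have -> : (fun t : R => rnorm (psum a (cis t) N)) =
    fun t => Num.sqrt (rnorm (psum a (cis t) N) ^+ 2).
  by apply/funext => t; rewrite sqrtr_sqr ger0_norm ?rnorm_ge0.
move=> t; apply: (continuous_comp (@psum_sqr_continuous _ _ a N _)).
exact: sqrt_continuous.
Qed.

(** With [x] the value at [r e^(it)], Poisson's formula tested against [x] gives [2 pi |x|^2 <= |x|]
    times the Poisson integral of the scalar norm; [2 pi >= 1] is then dropped. The interval
    [[- 2 pi, 4 pi]] contains every window centred in [[0, 2 pi]] and spans three full periods. *)
Lemma psum_radial_le_average a N r t c : 1 / 2 <= r -> r < 1 -> 0 <= t <= 2 * pi -> 0 <= c ->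
  (forall d, 0 < d ->
    (\int[mu]_(s in ball t d)
       `|((fun s => rnorm (psum a (cis s) N)) \_ `[- (2 * pi), 4 * pi]) s|%:E <= (d * 2 * c)%:E)%E) ->
  rnorm (psum a (r%:C * cis t) N) <= 2 ^+ 10 * c.
Proof.
move=> r2 r1 /andP[t0 t2pi] c0 hc.
have pi0 := @pi_gt0 R; have pi2 := @pi_ge2 R.
have r0 : 0 < r by lra.
pose psi s := rnorm (psum a (cis s) N).
have psi0 s : 0 <= psi s by exact: rnorm_ge0.
have cpsi : continuous psi by exact: psum_rnorm_continuous.
have cP : continuous (fun s => poisson r (s - t)) := @poisson_continuous R r t (ltW r0) r1.
have P0 s : 0 <= poisson r (s - t) by exact: poisson_ge0 (ltW r0) r1.
have cPp : continuous (fun s => poisson r (s - t) * psi s).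
  by move=> s; apply: cvgM; [exact: cP | exact: cpsi].
pose D : set R := `[t - pi, t + pi]%classic.
set x := psum a (r%:C * cis t) N.
suff hI : \int[mu]_(s in D) (poisson r (s - t) * psi s) <= 2 ^+ 10 * c.
  have [->|xn0] := eqVneq (rnorm x) 0; first by rewrite mulr_ge0 ?exprn_ge0.
  have xp : 0 < rnorm x by rewrite lt0r xn0 rnorm_ge0.
  rewrite -(ler_pM2r xp); apply: le_trans (ler_wpM2r (ltW xp) hI).
  apply: (@le_trans _ _ (2 * pi * rdot x x)).
    by rewrite rdotxx -expr2 ler_peMl ?sqr_ge0//; lra.
  rewrite -poisson_psum// [leRHS]mulrC -Rint_contZ//; apply: Rint_cont_le => [||s _].
  - move=> s; apply: cvgM; first exact: cP.
    rewrite /continuous_at; under eq_fun do rewrite rdot_psum.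
    rewrite rdot_psum; apply: continuous_sumR => k; exact: trig_continuous.
  - by move=> s; apply: cvgMr; exact: cPp.
  - rewrite mulrCA ler_wpM2l// mulrC; exact: rdot_le.
set d := 1 - r; have d0 : 0 < d by rewrite subr_gt0.
have [K hK] : exists K, pi < 2 ^+ K * d.
  have h0 : (0 : R) <= 1 / 2 by lra.
  have h1 : (1 / 2 : R) < 1 by lra.
  have [K hK] := geometric_lt pi h0 h1 d0.
  exists K; have := hK K (leqnn _); rewrite div1r exprVn ltr_pdivrMr ?exprn_gt0//.
  by rewrite mulrC.
pose phi := (psi : R -> R) \_ `[- (2 * pi), 4 * pi].
have mphi : measurable_fun setT phi.
  apply/(measurable_restrictT _ _).1 => //; apply: measurable_funTS.
  exact: continuous_measurable_fun.
have phi0 s : 0 <= phi s by rewrite /phi patchE; case: ifPn.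
pose A k : R := 2 ^+ 8 / (4 ^+ k * d).
have A0 k : 0 <= A k.
  by apply: divr_ge0; [exact: exprn_ge0|apply: mulr_ge0; [exact: exprn_ge0|exact: ltW]].
pose B k : set R := ball t (2 ^+ k * d).
have mB k : measurable (B k) by exact: measurable_ball.
have mphiB k : measurable_fun setT ((EFin \o phi) \_ (B k)).
  by apply/(measurable_restrictT _ _).1 => //; apply: measurable_funTS; exact/measurable_EFinP.
have phiB0 k s : (0 <= ((EFin \o phi) \_ (B k)) s)%E.
  by rewrite patchE; case: ifPn => // _; rewrite lee_fin.
have mAphiB k : measurable_fun setT (fun s => (A k)%:E * ((EFin \o phi) \_ (B k)) s)%E.
  exact: (measurable_funeM _ (mphiB k)).
have mD : measurable D by exact: measurable_itv.
rewrite -lee_fin /Rintegral fineK; last first.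
  by apply: integral_fune_fin_num => //; exact: integrable_cont.
apply: (@le_trans _ _ (\int[mu]_(s in D) (\sum_(k < K.+1) (A k)%:E * ((EFin \o phi) \_ (B k)) s))%E).
  apply: ge0_le_integral => //.
  - by move=> s _; rewrite lee_fin mulr_ge0.
  - by apply: measurable_funTS; apply/measurable_EFinP; exact: continuous_measurable_fun.
  - apply: measurable_funTS; apply: emeasurable_sum => k.
    exact: mAphiB.
  - move=> s; rewrite /D /= in_itv/= => /andP[s1 s2].
    have st : `|s - t| <= pi by rewrite ler_norml; lra.
    have sphi : phi s = psi s.
      by rewrite /phi patchE mem_set//= in_itv/=; apply/andP; split; lra.
    have := ler_wpM2r (psi0 s) (poisson_le r2 r1 st hK).
    rewrite mulr_suml -lee_fin => /le_trans; apply.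
    rewrite -sumEFin; apply: lee_sum => k _.
    rewrite patchE /=; case: ifPn => [_|/negP sB].
      rewrite -EFinM lee_fin sphi -[leLHS]mulrA; apply: (@ler_wpM2l _ (A k)); first exact: A0.
      by apply: ler_piMl => //; case: (_ < _).
    rewrite mule0 lee_fin.
    have -> : (`|s - t| < 2 ^+ k * (1 - r)) = false.
      by apply/negbTE/negP => h; apply: sB; apply/mem_set; rewrite /B /ball/= distrC.
    by rewrite mulr0 mul0r.
rewrite ge0_integral_sum//; last 2 first.
- by move=> k; apply: measurable_funTS; exact: mAphiB.
- by move=> k s _; rewrite mule_ge0// lee_fin.
(* The ball of radius [2^k d] contributes [2^8 / (4^k d)] times at most [2^k d * 2 * c]; the
   geometric series doubles [2^9 c] at most. *)
apply: (@le_trans _ _ (\sum_(k < K.+1) (2 ^+ 9 * c * (1 / 2) ^+ k)%:E)%E).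
  apply: lee_sum => k _.
  rewrite ge0_integralZl//; [|apply: measurable_funTS; exact: mphiB|by rewrite lee_fin A0].
  apply: (@le_trans _ _ ((A k)%:E * \int[mu]_(s in B k) `|phi s|%:E)%E).
    rewrite lee_pmul2l//; last first.
      by rewrite lte_fin; apply: divr_gt0; [exact: exprn_gt0|apply: mulr_gt0 => //; exact: exprn_gt0].
    rewrite [leRHS](_ : _ = \int[mu]_s ((EFin \o phi) \_ (B k)) s)%E; last first.
      rewrite [LHS]integral_mkcond; apply: eq_integral => s _.
      by rewrite !patchE; case: ifPn => // _; rewrite /= ger0_norm.
    apply: ge0_subset_integral => //; exact: mphiB.
  apply: le_trans (lee_wpmul2l _ (hc (2 ^+ k * d) _)) _; rewrite ?lee_fin//.
    by rewrite mulr_gt0// exprn_gt0.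
  rewrite /A le_eqVlt; apply/orP; left; apply/eqP.
  rewrite (_ : 4 = 2 * 2 :> R); last by ring.
  rewrite exprMn div1r exprVn.
  have : (2 : R) ^+ k != 0 by rewrite expf_neq0.
  by move: (gt_eqF d0) => /negbT dn0 e0; field; rewrite dn0 e0.
rewrite sumEFin lee_fin -mulr_sumr -(big_mkord xpredT (fun k => (1 / 2) ^+ k)).
have h0 : (0 : R) <= 1 / 2 by lra.
have h1 : (1 / 2 : R) < 1 by lra.
have := sum_expr_le 0 K.+1 h0 h1; rewrite expr0 (_ : 1 / (1 - 1 / 2) = 2 :> R); last by field.
move=> h; have := ler_wpM2l (mulr_ge0 (exprn_ge0 9 (ler0n R 2)) c0) h.
by move=> /le_trans; apply; rewrite mulrAC -exprSr.
Qed.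

End radial_maximal.

(** * Weak type estimate for the radial maximal function of a polynomial *)

Section radial_maximal_ineq.
Context {R : realType} {E : hilbertType R}.
Local Notation mu := (@lebesgue_measure R).
Implicit Types (a : nat -> E) (N : nat) (r t s c : R).

(** The exceptional set is where the Hardy-Littlewood maximal function exceeds [c]. The maximal
    inequality has constant 3 and the [L^1] norm over three periods is at most [6 pi eta]; [pi <= 4]
    turns [18 pi] into 72. *)
Lemma radial_maximal a N (eta c : R) : 0 < eta -> 0 < c ->
  \sum_(k < N) rnorm (a k) ^+ 2 <= eta ^+ 2 ->
  exists B : set R, [/\ measurable B, (mu B <= (72 * eta / c)%:E)%E &
    forall t, 0 <= t <= 2 * pi -> ~ B t -> forall r, 1 / 2 <= r -> r < 1 ->
      rnorm (psum a (r%:C * cis t) N) <= 2 ^+ 10 * c].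
Proof.
move=> eta0 c0 ha.
have pi0 := @pi_gt0 R.
pose psi s := rnorm (psum a (cis s) N).
have psi0 s : 0 <= psi s by exact: rnorm_ge0.
have cpsi : continuous psi by exact: psum_rnorm_continuous.
pose phi := (psi : R -> R) \_ `[- (2 * pi), 4 * pi].
have lphi : locally_integrable setT phi.
  by apply: integrable_locally_restrict => //; exact: integrable_cont.
have len : - (2 * pi) < 4 * pi :> R by lra.
have cisE : cis (- (2 * pi)) = cis (4 * pi) :> R[i].
  have -> : - (2 * pi) = 0 - 2 * pi :> R by ring.
  have -> : 4 * pi = 0 + pi *+ 2 + pi *+ 2 :> R by rewrite !mulr2n; ring.
  rewrite /cis !cosD2pi !sinD2pi mulr_natl.
  by rewrite cosB sinB cos2pi sin2pi cos0 sin0 !(mulr0, mulr1, mul0r) addr0 subr0.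
exists [set t | (c%:E < HL_maximal phi t)%E]; split.
- rewrite -[X in measurable X]setTI; apply: emeasurable_fun_o_infty => //.
  exact: measurable_HL_maximal.
- apply: le_trans (maximal_inequality lphi c0) _.
  apply: (@le_trans _ _ ((3 / c)%:E * (6 * pi * eta)%:E)%E).
    rewrite lee_wpmul2l ?lee_fin ?divr_ge0 ?(ltW c0)//.
    have -> : (\int[mu]_y `|(phi y)%:E| = \int[mu]_(y in `[(- (2 * pi))%R, (4 * pi)%R]) (psi y)%:E)%E.
      rewrite [RHS]integral_mkcond; apply: eq_integral => s _.
      by rewrite /phi !patchE; case: ifPn => _; rewrite /= ?normr0 ?ger0_norm.
    rewrite -[leLHS]fineK; last first.
      by apply: integral_fune_fin_num => //; exact: integrable_cont.
    rewrite lee_fin -/(Rintegral _ _ _).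
    have csq : continuous (fun s => (2 * eta)^-1 * psi s ^+ 2).
      by move=> s; apply: cvgMr; exact: psum_sqr_continuous.
    (* [psi <= psi^2 / (2 eta) + eta / 2] passes from the [L^1] norm to mean squares; the weight
       makes each half at most [3 pi eta]. *)
    apply: (@le_trans _ _ (\int[mu]_(s in `[(- (2 * pi))%R, (4 * pi)%R]) ((2 * eta)^-1 * psi s ^+ 2 + eta / 2))).
      apply: Rint_cont_le => //; first by move=> s; apply: cvgD; [exact: csq | exact: cvg_cst].
      move=> s _; rewrite -(ler_pM2l (_ : 0 < 2 * eta)) ?mulr_gt0//.
      rewrite mulrDr mulrA divff ?mul1r ?mulf_neq0 ?gt_eqF//.
      have := sqr_ge0 (psi s - eta); rewrite sqrrB.
      have -> : 2 * eta * (eta / 2) = eta ^+ 2 by field.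
      lra.
    rewrite Rint_contD//; last by move=> s; exact: cvg_cst.
    rewrite (Rint_contZ _ _ _ (@psum_sqr_continuous R E a N)).
    rewrite parseval// Rint_segment_cst ?(ltW len)//.
    have -> : 4 * pi - - (2 * pi) = 6 * pi :> R by ring.
    apply: (@le_trans _ _ ((2 * eta)^-1 * (eta ^+ 2 * (6 * pi)) + eta / 2 * (6 * pi))).
      rewrite lerD2r ler_wpM2l ?invr_ge0 ?mulr_ge0 ?(ltW eta0)//.
      by rewrite ler_wpM2r// mulr_ge0// ltW.
    by rewrite le_eqVlt; apply/orP; left; apply/eqP; field; rewrite gt_eqF.
  rewrite -EFinM lee_fin.
  have -> : 3 / c * (6 * pi * eta) = 18 * pi * eta / c by field; rewrite gt_eqF.
  rewrite ler_wpM2r ?invr_ge0 ?(ltW c0)// ler_wpM2r ?(ltW eta0)//.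
  by have := @pihalf_lt2 R; lra.
- move=> t t2 /= /negP; rewrite -leNgt => hHL r r2 r1.
  apply: psum_radial_le_average => //; first exact: ltW.
  move=> d d0.
  have /(_ (ltac:(by exists d => //; rewrite /= in_itv/= d0))) := ereal_sup_ubound (S := [set iavg phi (ball t r) | r in `]0%R, +oo[]) (x := iavg phi (ball t d)).
  move=> /le_trans => /(_ _ hHL).
  rewrite /iavg lebesgue_measure_ball ?(ltW d0)// inver -if_neg mulrn_eq0/= (gt_eqF d0)/=.
  have -> : d *+ 2 = d * 2 by rewrite mulr_natr.
  by rewrite lee_pdivrMl ?mulr_gt0// -EFinM.
Qed.

End radial_maximal_ineq.

(** * Existence of radial limits almost everywhere *)

Section radial_limits.
Context {R : realType} {E : hilbertType R}.
Local Notation mu := (@lebesgue_measure R).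
Implicit Types (f : R[i] -> E) (a : nat -> E).

(** Makes a block of the series a partial sum again, so that the estimates on [psum] apply to
    blocks. *)
Definition trunc (a : nat -> E) m k : E := if (m <= k)%N then a k else 0.

Lemma psum_trunc a m n z : (m <= n)%N -> psum (trunc a m) z n = psum a z n - psum a z m.
Proof.
move=> mn; rewrite psumB// psumE (big_cat_nat (leq0n m) mn)/= big_nat big1 ?add0r; last first.
  by move=> k /andP[_ km]; rewrite /trunc leqNgt km scaler0.
by apply: eq_big_nat => k /andP[mk _]; rewrite /trunc mk.
Qed.

Lemma sum_trunc a m n : (m <= n)%N ->
  \sum_(k < n) rnorm (trunc a m k) ^+ 2 = \sum_(m <= k < n) rnorm (a k) ^+ 2.
Proof.
move=> mn; rewrite -(big_mkord xpredT (fun k => rnorm (trunc a m k) ^+ 2)).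
rewrite (big_cat_nat (leq0n m) mn)/= big_nat big1 ?add0r; last first.
  by move=> k /andP[_ km]; rewrite /trunc leqNgt km rnorm0 expr0n.
by apply: eq_big_nat => k /andP[mk _]; rewrite /trunc mk.
Qed.

Lemma psum_near a N (z : R[i]) (e : R) : 0 < e -> exists2 d : R, 0 < d &
  forall w, cnorm (w - z) < d -> rnorm (psum a w N - psum a z N) < e.
Proof.
pose b k := if (k < N)%N then a k else 0.
have bE w n : (N <= n)%N -> psum b w n = psum a w N.
  move=> Nn; rewrite psumE (big_cat_nat (leq0n N) Nn)/= [X in _ + X]big_nat [X in _ + X]big1 ?addr0.
    by rewrite psumE; apply: eq_big_nat => k /andP[_ kN]; rewrite /b kN.
  by move=> k /andP[Nk _]; rewrite /b ltnNge Nk scaler0.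
have hb w : psums b w (psum a w N).
  by apply/cvg_seq_rnormP => d d0; exists N => n /bE ->; rewrite subrr rnorm0.
have s0 : 0 <= cnorm z + 1 by rewrite addr_ge0// cnorm_ge0.
have [M M0 bb] := psums_cbound s0 (hb _).
have zs : cnorm z < cnorm z + 1 by rewrite ltrDl.
exact: (psums_continuous bb zs (F := fun w => psum a w N) (fun w _ => hb w)).
Qed.

Lemma psum_radial_near a N (t e : R) : 0 < e ->
  \forall r \near 1^'-, rnorm (psum a (r%:C * cis t) N - psum a (cis t) N) < e.
Proof.
move=> /(psum_near a N (cis t))[d d0 hd].
have d1 : 1 - d < 1 by rewrite ltrBlDr ltrDl.
near=> r; apply: hd.
rewrite -{2}[cis t]mul1r -mulrBl cnormM cnorm_cis mulr1 -(rmorph1 (real_complex R)) -rmorphB.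
have r1 : r < 1 by near: r; exact: nbhs_left_lt.
have rd : 1 - d < r by near: r; exact: nbhs_left_gt.
by rewrite cnorm_real ltr_norml; apply/andP; split; lra.
Unshelve. all: by end_near. Qed.

Lemma lacunary_indices (u : nat -> R) (K : R) : (forall k, 0 <= u k) ->
  (forall n, \sum_(k < n) u k <= K) ->
  exists n_ : nat -> nat, (forall j, (j <= n_ j)%N /\ (n_ j <= n_ j.+1)%N) /\
    forall j n, (n_ j <= n)%N -> \sum_(n_ j <= k < n) u k <= ((1 / 4) ^+ j) ^+ 2.
Proof.
move=> u0 uK; pose s n := \sum_(k < n) u k.
have sE m n : (m <= n)%N -> \sum_(m <= k < n) u k = s n - s m.
  by move=> mn; rewrite /s -!(big_mkord xpredT) (big_cat_nat (leq0n m) mn)/= addrAC subrr add0r.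
have smon : {homo s : m n / (m <= n)%N >-> m <= n}.
  by move=> m n mn; rewrite -subr_ge0 -sE// sumr_ge0.
have hs : has_sup [set s n | n in setT].
  by split; [exists (s 0%N); exists 0%N | exists K => _ [n _ <-]; exact: uK].
have /choice[N hN] : forall j, exists N, forall n, (N <= n)%N -> \sum_(N <= k < n) u k <= ((1 / 4) ^+ j) ^+ 2.
  move=> j; have e0 : 0 < ((1 / 4) ^+ j) ^+ 2 :> R by rewrite !exprn_gt0// divr_gt0.
  have [_ [N _ <-] hN] := sup_adherent e0 hs.
  exists N => n Nn; rewrite sE// lerBlDr.
  have : s n <= sup [set s n | n in setT] by apply: (ub_le_sup hs.2); exists n.
  by move: hN; rewrite ltrBlDr addrC => hN /le_trans; apply; exact: ltW.
(* Accumulating the thresholds makes the indices nondecreasing, and adding [j] makes them tend to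
   infinity. *)
pose n_ j := (j + \sum_(i < j.+1) N i)%N.
exists n_; split=> [j|j n jn].
  split; first by rewrite leq_addr.
  by rewrite /n_ leq_add// [leqRHS]big_ord_recr/= leq_addr.
have Nj : (N j <= n_ j)%N by rewrite /n_ big_ord_recr/= addnA leq_addl.
apply: le_trans (hN j n (leq_trans Nj jn)).
by rewrite !sE ?(leq_trans Nj)// lerD2l lerN2 smon.
Qed.

(** The block bounds are uniform in [r], so the partial sums are uniformly Cauchy along the radius
    and the limits in [j] and in [r] may be interchanged. *)
Lemma radial_limit_of_blocks f a (n_ : nat -> nat) (t C : R) (J : nat) :
  0 <= C -> (forall z, disc z -> psums a z (f z)) -> (forall j, (j <= n_ j)%N) ->
  (forall j, (J <= j)%N -> forall r : R, 1 / 2 <= r -> r < 1 ->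
    rnorm (psum a (r%:C * cis t) (n_ j.+1) - psum a (r%:C * cis t) (n_ j)) <= C * (1 / 2) ^+ j) ->
  exists2 l : E, f (r%:C * cis t) @[r --> 1^'-] --> l &
    psum a (cis t) (n_ j) @[j --> \oo] --> l.
Proof.
move=> C0 ha hn hJ.
have h0 : (0 : R) <= 1 / 2 by lra.
have h1 : (1 / 2 : R) < 1 by lra.
have h2 : 1 / (1 - 1 / 2) = 2 :> R by field.
pose P j (r : R) := psum a (r%:C * cis t) (n_ j).
pose Q j := psum a (cis t) (n_ j).
have diff j i r : (J <= j)%N -> (j <= i)%N -> 1 / 2 <= r -> r < 1 ->
    rnorm (P i r - P j r) <= 2 * C * (1 / 2) ^+ j.
  move=> Jj ji r2 r1.
  have -> : P i r - P j r = \sum_(j <= k < i) (P k.+1 r - P k r) by rewrite telescope_sumr.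
  apply: le_trans (rnorm_sum _ _) _.
  apply: (@le_trans _ _ (\sum_(j <= k < i) C * (1 / 2) ^+ k)).
    by rewrite !big_nat; apply: ler_sum => k /andP[jk _]; apply: hJ => //; exact: leq_trans jk.
  rewrite -mulr_sumr; apply: le_trans (ler_wpM2l C0 (sum_expr_le j i h0 h1)) _.
  by rewrite le_eqVlt; apply/orP; left; apply/eqP; field.
(* The bound extends to [r = 1] by continuity of the two polynomials at [cis t]. *)
have Qdiff j i : (J <= j)%N -> (j <= i)%N -> rnorm (Q i - Q j) <= 2 * C * (1 / 2) ^+ j.
  move=> Jj ji; apply/ler_addgt0Pr => e e0; have e2 : 0 < e / 2 by rewrite divr_gt0.
  have [r [[/ltW r2 r1] [hi hj]]] := filter_ex (filterI
    (filterI (nbhs_left_gt h1) (nbhs_left_lt (1 : R)))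
    (filterI (psum_radial_near a (n_ i) t e2) (psum_radial_near a (n_ j) t e2))).
  apply: le_trans (rnorm_triangle (P i r) _ _) _.
  apply: le_trans (lerD (lexx _) (rnorm_triangle (P j r) _ _)) _.
  rewrite addrCA [e]splitr; apply: lerD; first exact: diff.
  by apply: lerD; [rewrite rnorm_subC|]; exact: ltW.
have [l hl] : exists l : E, Q j @[j --> \oo] --> l.
  apply: cauchy_seq_cvg => e e0.
  have [N hN] := geometric_lt (2 * C) h0 h1 e0.
  exists (maxn N J) => m n; rewrite !geq_max => /andP[Nm Jm] /andP[Nn Jn].
  have [mn|/ltnW nm] := leqP m n.
    by rewrite rnorm_subC; apply: le_lt_trans (Qdiff _ _ Jm mn) (hN _ Nm).
  exact: le_lt_trans (Qdiff _ _ Jn nm) (hN _ Nn).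
exists l => //; apply/cvg_rnormP => e e0.
have e4 : 0 < e / 4 by rewrite divr_gt0.
have [N hN] := geometric_lt (2 * C) h0 h1 e4.
pose j := maxn N J.
have Nj : 2 * C * (1 / 2) ^+ j < e / 4 by apply: hN; exact: leq_maxl.
have Jj : (J <= j)%N by exact: leq_maxr.
near=> r.
have r1 : r < 1 by near: r; exact: nbhs_left_lt.
have r2 : 1 / 2 <= r by apply: ltW; near: r; exact: nbhs_left_gt.
have rj : rnorm (P j r - Q j) < e / 4 by near: r; exact: psum_radial_near.
have lQ : rnorm (l - Q j) < e / 4 + e / 4.
  have [M hM] := (cvg_seq_rnormP _ _).1 hl _ e4.
  apply: le_lt_trans (rnorm_triangle (Q (maxn M j)) _ _) _.
  rewrite ltrD ?hM ?leq_maxl//; apply: le_lt_trans Nj.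
  by apply: Qdiff => //; exact: leq_maxr.
have fP : rnorm (P j r - f (r%:C * cis t)) <= e / 4.
  apply/ler_addgt0Pr => d d0.
  have fz : disc (r%:C * cis t) by apply: disc_scale_cis; apply/andP; split; lra.
  have [M hM] := (cvg_seq_rnormP _ _).1 (ha _ fz) _ d0.
  apply: le_trans (rnorm_triangle (P (maxn M j) r) _ _) _; apply: lerD.
    rewrite rnorm_subC; apply: le_trans (ltW Nj); apply: diff => //; exact: leq_maxr.
  rewrite rnorm_subC; apply/ltW/hM; exact: leq_trans (leq_maxl _ _) (hn _).
apply: le_lt_trans (rnorm_triangle (Q j) _ _) _.
apply: le_lt_trans (lerD (lexx _) (rnorm_triangle (P j r) _ _)) _.
have -> : e = e / 4 + e / 4 + (e / 4 + e / 4) by field.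
by rewrite rnorm_subC in rj; exact: (ltrD lQ (ltr_leD rj fP)).
Unshelve. all: by end_near. Qed.

(** Block [j] has norm at most [4^-j]; the threshold [2^-j] leaves an exceptional set of measure at
    most [72 * 2^-j = 144 / 2^(j+1)]. These are summable, so the limsup of the exceptional sets is
    null. *)
Lemma fatou_radial f a (K : R) : (forall z, disc z -> psums a z (f z)) ->
  (forall n, \sum_(k < n) rnorm (a k) ^+ 2 <= K) ->
  exists n_ : nat -> nat, (forall j, (j <= n_ j)%N) /\ exists B : set R,
  [/\ measurable B, mu B = 0%E & forall t, 0 <= t <= 2 * pi -> ~ B t ->
    exists2 l : E, f (r%:C * cis t) @[r --> 1^'-] --> l &
      psum a (cis t) (n_ j) @[j --> \oo] --> l].
Proof.
move=> ha aK.
have [n_ [hn htail]] := lacunary_indices (fun k => sqr_ge0 (rnorm (a k))) aK.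
exists n_; split; first by move=> j; exact: (hn j).1.
have q0 : (0 : R) < 1 / 4 by lra.
have q2 : (0 : R) < 1 / 2 by lra.
have /choice[B hB] : forall j, exists B : set R, [/\ measurable B,
    (mu B <= (144 / (2 ^ (j + 1))%:R)%:E)%E & forall t, 0 <= t <= 2 * pi -> ~ B t ->
    forall r : R, 1 / 2 <= r -> r < 1 ->
      rnorm (psum a (r%:C * cis t) (n_ j.+1) - psum a (r%:C * cis t) (n_ j)) <= 2 ^+ 10 * (1 / 2) ^+ j].
  move=> j.
  have [|B [mB muB hB]] := @radial_maximal R E (trunc a (n_ j)) (n_ j.+1) _ _ (exprn_gt0 j q0) (exprn_gt0 j q2).
    by rewrite sum_trunc ?(hn j).2// htail// (hn j).2.
  exists B; split=> //.
    apply: le_trans muB _; rewrite lee_fin le_eqVlt; apply/orP; left; apply/eqP.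
    rewrite natrX addn1 exprS !expr_div_n !expr1n (_ : 4 = 2 * 2 :> R); last by ring.
    by rewrite exprMn; field; rewrite expf_neq0.
  by move=> t t01 tB r r2 r1; rewrite -psum_trunc ?(hn j).2//; exact: hB.
exists (lim_sup_set B); split.
- by apply: bigcap_measurable => // k _; apply: bigcup_measurable => i _; have [] := hB i.
- apply: lim_sup_set_cvg0; first by move=> k; have [] := hB k.
  apply: (@le_lt_trans _ _ (\sum_(0 <= n <oo) (144 / (2 ^ (n + 1))%:R)%:E)%E).
    by apply: lee_nneseries => [i _ _|i _]; [exact: measure_ge0 | have [] := hB i].
  have := @cvg_geometric_eseries_half R 144 0 => /cvg_lim -> //.
  by rewrite ltry.
(* Outside the limsup, [t] avoids all exceptional sets of index at least [J]. *)
- move=> t t01 /existsNP[J /not_implyP[_ tJ]].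
  apply: (radial_limit_of_blocks (C := 2 ^+ 10) (J := J) _ ha) => [|j|j Jj r r2 r1].
  + by rewrite exprn_ge0.
  + exact: (hn j).1.
  + have [_ _ h] := hB j; apply: h => //; move=> Bt; apply: tJ; by exists j.
Qed.

End radial_limits.

(** * Borel functions and boundary values *)

Section borel_functions.
Context {R : realType} {E : hilbertType R}.
Implicit Types (A : set R) (u v : R -> E).

Definition bmeasurable A u : Prop :=
  measurable_fun A (u : R -> g_sigma_algebraType (@open E)).

Lemma continuous_rnorm u (t e : R) : continuous u -> 0 < e ->
  \forall s \near t, rnorm (u t - u s) < e.
Proof. by move=> /(_ t)/cvg_rnormP h e0; exact: h. Qed.

(** A point [t] of [A] has [u t] in an open [V] iff some ball of radius [1/(k+1)] about [u_n t] lies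
    in [V] for all large [n]; for fixed [n] and [k] the set of such [t] is closed. *)
Lemma bmeasurable_limit A (u_ : nat -> R -> E) u : measurable A ->
  (forall n, continuous (u_ n)) ->
  (forall t, A t -> u_ n t @[n --> \oo] --> u t) -> bmeasurable A u.
Proof.
move=> mA cu ul; rewrite /bmeasurable.
apply: (@measurability _ _ _ (g_sigma_algebraType (@open E)) A u (@open E) erefl) => _ [V oV <-].
pose d k : R := k.+1%:R^-1; have d0 k : 0 < d k by rewrite invr_gt0.
pose F n k := [set t | forall y, rnorm (u_ n t - y) < d k -> V y].
have mF n k : measurable (F n k).
  rewrite -(setCK (F n k)); apply: measurableC; apply: open_measurable.
  rewrite openE => t /existsNP[y /not_implyP[yt nVy]].
  have e0 : 0 < d k - rnorm (u_ n t - y) by rewrite subr_gt0.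
  have := continuous_rnorm t (cu n) e0.
  apply: filterS => s hs /(_ y); apply/not_implyP; split=> //.
  apply: le_lt_trans (rnorm_triangle (u_ n t) _ _) _.
  by rewrite rnorm_subC -ltrBrDr.
have -> : A `&` u @^-1` V = A `&` \bigcup_k \bigcup_m \bigcap_(n in [set n | (m <= n)%N]) F n k.
  apply/seteqP; split=> t /= [At].
  - move=> Vt; split=> //.
    have [e e0 he] : exists2 e : R, 0 < e & forall y, rnorm (u t - y) < e -> V y.
      move: oV; rewrite openE => /(_ _ Vt) /nbhs_ballP[[e e'] /=].
      rewrite ltcE/= => /andP[/eqP -> e0] he; exists e => // y hy; apply: he.
      by rewrite -ball_normE /ball_/= rnormE ltcR.
    have [k hk] : exists k, d k < e / 2.
      have e2 : 0 < e / 2 by rewrite divr_gt0.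
      exists (Num.truncn (e / 2)^-1); rewrite /d -[ltRHS]invrK ltf_pV2 ?posrE ?invr_gt0//.
      exact: truncnS_gt.
    have [m hm] := (cvg_seq_rnormP _ _).1 (ul t At) _ (d0 k).
    exists k => //; exists m => // n /= mn y hy; apply: he.
    apply: le_lt_trans (rnorm_triangle (u_ n t) _ _) _.
    by rewrite [e]splitr; apply: ltrD; apply: lt_trans hk => //; exact: hm.
  - move=> [k _ [m _ h]]; split=> //.
    have [N hN] := (cvg_seq_rnormP _ _).1 (ul t At) _ (d0 k).
    apply: (h (maxn m N)); first exact: leq_maxl.
    by rewrite rnorm_subC; apply: hN; exact: leq_maxr.
apply: measurableI => //; apply: bigcup_measurable => k _; apply: bigcup_measurable => m _.
by apply: bigcap_measurable => [|n _]; [exists m => /= | exact: mF].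
Qed.

Lemma bmeasurable_comp A u (phi : E -> R) : measurable A -> bmeasurable A u ->
  continuous phi -> measurable_fun A (phi \o u).
Proof.
move=> mA mu_ cphi; apply: (measurability _ (RGenOpens.measurableE R)).
move=> _ [_ [a [b ->] <-]]; rewrite comp_preimage; apply: mu_ => //.
apply: sub_sigma_algebra.
by move/continuousP : cphi; apply; exact: interval_open.
Qed.

Lemma rnorm_continuous : continuous (@rnorm R E).
Proof.
move=> x; apply/cvgrPdist_lt => e e0.
have := (@cvg_rnormP R E E (nbhs x) (nbhs_filter x) id x).1 cvg_id _ e0.
apply: filterS => y; apply: le_lt_trans.
have h1 := rnormD (x - y) y; have h2 := rnormD (y - x) x.
rewrite !subrK in h1 h2; rewrite (rnorm_subC y) in h2.
rewrite ler_norml; apply/andP; split; lra.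
Qed.

Lemma rdot_continuous (x : E) : continuous (fun y : E => rdot y x).
Proof.
move=> y; apply/cvgrPdist_lt => e e0.
have x1 : 0 < rnorm x + 1 by rewrite ltr_wpDl ?rnorm_ge0.
have e' : 0 < e / (rnorm x + 1) by rewrite divr_gt0.
have := (@cvg_rnormP R E E (nbhs y) (nbhs_filter y) id y).1 cvg_id _ e'.
apply: filterS => z hz; rewrite -rdotBl; apply: le_lt_trans (rdot_norm_le _ _) _.
rewrite ltr_pdivlMr// in hz; apply: le_lt_trans hz.
by rewrite ler_wpM2l ?rnorm_ge0// lerDl.
Qed.

Lemma measurable_rnorm A u : measurable A -> bmeasurable A u ->
  measurable_fun A (fun t => rnorm (u t)).
Proof. by move=> mA mu_; exact: bmeasurable_comp mA mu_ rnorm_continuous. Qed.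

Lemma measurable_rdotl A u x : measurable A -> bmeasurable A u ->
  measurable_fun A (fun t => rdot (u t) x).
Proof. by move=> mA mu_; exact: bmeasurable_comp mA mu_ (@rdot_continuous x). Qed.

Lemma rdotZr (y x : E) (z : R[i]) :
  rdot y (z *: x) = complex.Re z * rdot y x + complex.Im z * rdot y ('i *: x).
Proof.
rewrite /rdot !dotZr; case: z => a b; case: <| y, x |> => c d /=.
by rewrite !(mul0r, mulN1r, mulNr, opprK, sub0r, oppr0, add0r, addr0, mul1r); ring.
Qed.

Lemma measurable_rdot_cis A u n (x : E) : measurable A -> bmeasurable A u ->
  measurable_fun A (fun t => rdot (u t) (cis t ^+ n *: x)).
Proof.
move=> mA mu_.
have -> : (fun t => rdot (u t) (cis t ^+ n *: x)) =
    (fun t => cos (n%:R * t)) \* (fun t => rdot (u t) x) \+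
    (fun t => sin (n%:R * t)) \* (fun t => rdot (u t) ('i *: x)).
  by apply/funext => t; rewrite rdotZr cisX.
apply: measurable_funD; apply: measurable_funM; try exact: measurable_rdotl.
  apply: measurable_funTS; apply: continuous_measurable_fun.
  by move=> t; apply: (continuous_comp (@continuous_lin _ _ _)); exact: continuous_cos.
apply: measurable_funTS; apply: continuous_measurable_fun.
by move=> t; apply: (continuous_comp (@continuous_lin _ _ _)); exact: continuous_sin.
Qed.

Lemma rdot_sumr I (r : seq I) (F : I -> E) y :
  rdot y (\sum_(i <- r) F i) = \sum_(i <- r) rdot y (F i).
Proof. by rewrite /rdot dot_sumr Re_sum. Qed.

Lemma measurable_rdot_psum A u a N : measurable A -> bmeasurable A u ->
  measurable_fun A (fun t => rdot (u t) (psum a (cis t) N)).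
Proof.
move=> mA mu_.
have -> : (fun t => rdot (u t) (psum a (cis t) N)) =
    (fun t => \sum_(k < N) rdot (u t) (cis t ^+ k *: a k)).
  by apply/funext => t; rewrite rdot_sumr.
by apply: measurable_sum => k; exact: measurable_rdot_cis.
Qed.

(** Expanding the square leaves only scalar functions, each measurable because [u] is; the
    difference itself need not be treated as a Borel function. *)
Lemma measurable_rnorm_psum A u a N : measurable A -> bmeasurable A u ->
  measurable_fun A (fun t => rnorm (u t - psum a (cis t) N) ^+ 2).
Proof.
move=> mA mu_.
have -> : (fun t => rnorm (u t - psum a (cis t) N) ^+ 2) =
    (fun t => rnorm (u t) ^+ 2) \+ ((fun t => rnorm (psum a (cis t) N) ^+ 2) \-
      (fun t => 2 * rdot (u t) (psum a (cis t) N))).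
  apply/funext => t /=; rewrite rnormD_sqr rnormN.
  have -> : rdot (u t) (- psum a (cis t) N) = - rdot (u t) (psum a (cis t) N).
    by rewrite rdotC /rdot dotNl ReN -!/(rdot _ _) rdotC.
  by ring.
apply: measurable_funD; first by apply: measurable_funX; exact: measurable_rnorm.
apply: measurable_funB.
  apply: measurable_funTS; apply: continuous_measurable_fun; exact: psum_sqr_continuous.
by apply: measurable_funM => //; exact: measurable_rdot_psum.
Qed.

(** Polarization. The sum is a separate hypothesis, to be checked where [u] and [v] are explicit
    boundary values. *)
Lemma measurable_rdot A u v : measurable A -> bmeasurable A u -> bmeasurable A v ->
  bmeasurable A (fun t => u t + v t) -> measurable_fun A (fun t => rdot (u t) (v t)).
Proof.
move=> mA mu_ mv muv.
have -> : (fun t => rdot (u t) (v t)) =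
    (fun t => 2^-1 * (rnorm (u t + v t) ^+ 2 - rnorm (u t) ^+ 2 - rnorm (v t) ^+ 2)).
  by apply/funext => t; rewrite rnormD_sqr; field.
apply: measurable_funM => //; apply: measurable_funB; first apply: measurable_funB.
- by apply: measurable_funX; exact: measurable_rnorm.
- by apply: measurable_funX; exact: measurable_rnorm.
- by apply: measurable_funX; exact: measurable_rnorm.
Qed.

End borel_functions.

(** * Regular points and measurability of boundary values *)

Section boundary_values.
Context {R : realType}.
Local Notation C := R[i].

Definition has_power_series (E : hilbertType R) (f : C -> E) : Prop :=
  exists a, forall z, disc z -> psums a z (f z).

Lemma disc_continuous (E : hilbertType R) (f : C -> E) z : has_power_series f -> disc z ->
  forall e : R, 0 < e -> exists2 d : R, 0 < d &
    forall w, cnorm (w - z) < d -> rnorm (f w - f z) < e.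
Proof.
move=> [a ha]; rewrite disc_cnorm => z1; have z0 := cnorm_ge0 z.
pose s := (cnorm z + 1) / 2; have s0 : 0 < s by rewrite /s; lra.
have s1 : s < 1 by rewrite /s; lra.
have [M M0 ab] : exists2 M, 0 <= M & cbound a s M.
  by apply: (psums_cbound (ltW s0) (ha _ _)); rewrite disc_cnorm cnorm_real gtr0_norm.
have zs : cnorm z < s by rewrite /s; lra.
by apply: (psums_continuous ab zs) => w ws; apply: ha; rewrite disc_cnorm (lt_trans ws).
Qed.

Lemma circle_continuous (E : hilbertType R) (f : C -> E) (r : R) : has_power_series f ->
  0 <= r -> r < 1 -> continuous (fun t : R => f (r%:C * cis t)).
Proof.
move=> fa r0 r1 t; apply/cvg_rnormP => e e0.
have zd : disc (r%:C * cis t) by apply: disc_scale_cis; rewrite r0 r1.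
have [d d0 hd] := disc_continuous fa zd e0.
have := cis_near t d0; apply: filterS => s hs.
rewrite rnorm_subC; apply: hd; rewrite -mulrBr cnormM cnorm_real ger0_norm//.
by apply: le_lt_trans hs; rewrite ler_piMl ?cnorm_ge0// ltW.
Qed.

Lemma near_leftP (x : R) (P : R -> Prop) :
  (\forall r \near x^'-, P r) <-> exists2 d : R, 0 < d & forall r, x - d < r -> r < x -> P r.
Proof.
split=> [[d /= d0 hd]|[d d0 hd]].
  exists d => // r r1 rx; apply: hd => //=.
  by rewrite gtr0_norm ?subr_gt0//; lra.
near=> r; apply: hd; near: r; last exact: nbhs_left_lt.
by apply: nbhs_left_gt; rewrite ltrBlDr ltrDl.
Unshelve. all: by end_near. Qed.

Definition regular (E : hilbertType R) (f : C -> E) : set R :=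
  [set t | cvg (radial f (cis t) r @[r --> 1^'-])].

Definition radius n : R := 1 - n.+2%:R^-1.

Lemma radius_ge0 n : 0 <= radius n.
Proof. by rewrite subr_ge0 invf_le1 ?ler1n. Qed.

Lemma radius_lt1 n : radius n < 1.
Proof. by rewrite ltrBlDr ltrDl invr_gt0. Qed.

Lemma radius_near (d : R) : 0 < d -> exists N, forall n, (N <= n)%N -> 1 - d < radius n.
Proof.
move=> d0; exists (Num.truncn d^-1) => n Nn; rewrite ltrD2l ltrN2.
rewrite -[ltRHS]invrK ltf_pV2 ?posrE ?invr_gt0//.
by apply: lt_le_trans (truncnS_gt _) _; rewrite ler_nat ltnS (leq_trans Nn).
Qed.

Lemma regular_seq (E : hilbertType R) (f : C -> E) t : regular f t ->
  f ((radius n)%:C * cis t) @[n --> \oo] --> boundary f (cis t).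
Proof.
move=> /cvg_rnormP h; apply/cvg_seq_rnormP => e /h/near_leftP[d d0 hd].
have [N hN] := radius_near d0.
by exists N => n /hN hn; apply: hd => //; exact: radius_lt1.
Qed.

Lemma boundaryE (E : hilbertType R) (f : C -> E) t (l : E) :
  f (r%:C * cis t) @[r --> 1^'-] --> l -> regular f t /\ boundary f (cis t) = l.
Proof.
move=> h; split; first by apply/(@cvg_ex E); exists l.
exact: (@cvg_lim _ (@norm_hausdorff _ E) _ (1^'-) _ (radial f (cis t))).
Qed.

(** [lim] returns the default [point] when there is no limit, so [boundary f] is a definite function
    on the whole circle. *)
Lemma boundary_singular (E : hilbertType R) (f : C -> E) t :
  ~ regular f t -> boundary f (cis t) = point.
Proof. exact: dvgP. Qed.

(* For fixed [p], [q] the set of [t] with [‖f (p e^it) - f (q e^it)‖ <= e] is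
   closed, so Cauchy's criterion needs no countable set of radii. *)
Lemma measurable_regular (E : hilbertType R) (f : C -> E) : has_power_series f ->
  measurable (regular f).
Proof.
move=> fa; pose d k : R := k.+1%:R^-1; have d0 k : 0 < d k by rewrite invr_gt0.
have dsmall (e : R) : 0 < e -> exists k, d k < e.
  move=> e0; exists (Num.truncn e^-1); rewrite /d -[ltRHS]invrK ltf_pV2 ?posrE ?invr_gt0//.
  exact: truncnS_gt.
pose F k m := [set t : R | forall p q : R, 0 <= p -> 0 <= q -> 1 - d m < p -> p < 1 -> 1 - d m < q -> q < 1 ->
  rnorm (f (p%:C * cis t) - f (q%:C * cis t)) <= d k].
have mF k m : measurable (F k m).
  rewrite -(setCK (F k m)); apply: measurableC; apply: open_measurable.
  rewrite openE => t /existsNP[p /existsNP[q]].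
  move=> /not_implyP[p0 /not_implyP[q0 /not_implyP[p1 /not_implyP[p2 /not_implyP[q1 /not_implyP[q2]]]]]].
  move=> /negP; rewrite -ltNge -subr_gt0 => e0.
  set e := _ - d k in e0; have e2 : 0 < e / 2 by rewrite divr_gt0.
  have cp := circle_continuous fa p0 p2; have cq := circle_continuous fa q0 q2.
  have hp := continuous_rnorm t cp e2; have hq := continuous_rnorm t cq e2.
  apply: (filterS _ (filterI hp hq)) => s [sp sq].
  move=> /(_ p q p0 q0 p1 p2 q1 q2); apply/negP; rewrite -ltNge.
  have h1 := rnorm_triangle (f (p%:C * cis s)) (f (p%:C * cis t)) (f (q%:C * cis t)).
  have h2 := rnorm_triangle (f (q%:C * cis s)) (f (p%:C * cis s)) (f (q%:C * cis t)).
  rewrite [in X in _ <= _ + X]rnorm_subC in h2.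
  have : rnorm (f (p%:C * cis t) - f (q%:C * cis t)) = e + d k by rewrite /e subrK.
  lra.
have -> : regular f = \bigcap_k \bigcup_m F k m.
  apply/seteqP; split=> t /=.
  - move=> /(@cvg_ex E)[l /cvg_rnormP hl] k _.
    have k2 : 0 < d k / 2 by rewrite divr_gt0.
    have /near_leftP[e /dsmall[m me] he] := hl _ k2.
    exists m => // p q p0 q0 p1 p2 q1 q2.
    have hp : rnorm (l - f (p%:C * cis t)) < d k / 2 by apply: he => //; apply: lt_trans p1; rewrite ltrD2l ltrN2.
    have hq : rnorm (l - f (q%:C * cis t)) < d k / 2 by apply: he => //; apply: lt_trans q1; rewrite ltrD2l ltrN2.
    apply: le_trans (rnorm_triangle l _ _) _; rewrite rnorm_subC; lra.
  - move=> h; apply: cauchy_rnorm_cvg => e /dsmall[k ke].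
    have [m _ hm] := h k I.
    exists [set r | 1 - d m < r /\ r < 1].
      by apply/near_leftP; exists (d m).
    have d1 : d m <= 1 by rewrite invf_le1 ?ler1n.
    move=> p q /= [p1 p2] [q1 q2]; apply: le_lt_trans ke; apply: hm => //; lra.
by apply: bigcap_measurable => // k _; apply: bigcup_measurable => m _; exact: mF.
Qed.

(** Stated along arbitrary filters, to cover both continuity in the angle and limits of sequences of
    radii. *)
Definition jointly_continuous (E1 E2 E3 : hilbertType R) (F : E1 -> E2 -> E3) : Prop :=
  forall (T : Type) (G : set_system T) (_ : Filter G) (u : T -> E1) (v : T -> E2) x y,
    u t @[t --> G] --> x -> v t @[t --> G] --> y -> F (u t) (v t) @[t --> G] --> F x y.

(** The domain is cut in four by regularity of [f] and [g]. On each piece the function is a limit of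
    continuous ones, the constant [point] standing for any argument without radial limit. *)
Lemma bmeasurable_boundary2 (E1 E2 E3 : hilbertType R) (F : E1 -> E2 -> E3)
    (f : C -> E1) (g : C -> E2) A : measurable A -> jointly_continuous F ->
  has_power_series f -> has_power_series g ->
  bmeasurable A (fun t => F (boundary f (cis t)) (boundary g (cis t))).
Proof.
move=> mA cF fa ga.
have mf := measurable_regular fa; have mg := measurable_regular ga.
have cf n : continuous (fun t : R => f ((radius n)%:C * cis t)).
  exact: circle_continuous fa (radius_ge0 n) (radius_lt1 n).
have cg n : continuous (fun t : R => g ((radius n)%:C * cis t)).
  exact: circle_continuous ga (radius_ge0 n) (radius_lt1 n).
have -> : A = ((A `&` regular f `&` regular g) `|` (A `&` regular f `&` ~` regular g)) `|`
    ((A `&` ~` regular f `&` regular g) `|` (A `&` ~` regular f `&` ~` regular g)).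
  by rewrite -!setIUr !setUv !setIT -setIUr setUv setIT.
have mfg B1 B2 : measurable B1 -> measurable B2 -> measurable (A `&` B1 `&` B2).
  by move=> m1 m2; apply: measurableI => //; exact: measurableI.
have mCf := measurableC mf; have mCg := measurableC mg.
apply/measurable_funU; [by apply: measurableU; apply: mfg|by apply: measurableU; apply: mfg|split].
- apply/measurable_funU; [exact: mfg|exact: mfg|split].
  + apply: (bmeasurable_limit (u_ := fun n t => F (f ((radius n)%:C * cis t)) (g ((radius n)%:C * cis t)))).
    * exact: mfg.
    * by move=> n t; apply: cF; [exact: cf | exact: cg].
    * by move=> t [[_ ft] gt_]; apply: cF; exact: regular_seq.
  + apply: (bmeasurable_limit (u_ := fun n t => F (f ((radius n)%:C * cis t)) point)).
    * exact: mfg.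
    * by move=> n t; apply: cF; [exact: cf | exact: cvg_cst].
    * move=> t [[_ ft] gt_]; rewrite [boundary g _]boundary_singular//.
      by apply: cF; [exact: regular_seq | exact: cvg_cst].
- apply/measurable_funU; [exact: mfg|exact: mfg|split].
  + apply: (bmeasurable_limit (u_ := fun n t => F point (g ((radius n)%:C * cis t)))).
    * exact: mfg.
    * by move=> n t; apply: cF; [exact: cvg_cst | exact: cg].
    * move=> t [[_ ft] gt_]; rewrite [boundary f _]boundary_singular//.
      by apply: cF; [exact: cvg_cst | exact: regular_seq].
  + apply: (bmeasurable_limit (u_ := fun n t => F point point)).
    * exact: mfg.
    * by move=> n t; exact: cvg_cst.
    * move=> t [[_ ft] gt_]; rewrite !boundary_singular//; exact: cvg_cst.
Qed.

Lemma bmeasurable_boundary (E : hilbertType R) (f : C -> E) A : measurable A ->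
  has_power_series f -> bmeasurable A (fun t => boundary f (cis t)).
Proof.
by move=> mA fa; apply: (bmeasurable_boundary2 (F := fun x _ => x) mA _ fa fa) => T G ? u v x y.
Qed.

Lemma jointly_continuousD (E : hilbertType R) : jointly_continuous (fun x y : E => x + y).
Proof. by move=> T G FG u v x y; exact: cvgD. Qed.

End boundary_values.

(** * The spaces H^2 and L^2 *)

Section boundary_L2.
Context {R : realType}.
Local Notation mu := (@lebesgue_measure R).
Local Notation C := R[i].

Lemma measurable_angles : measurable (@angles R).
Proof. exact: measurable_itv. Qed.
#[local] Hint Resolve measurable_angles : core.

Definition sqint (E : hilbertType R) (u : C -> E) : \bar R :=
  (\int[mu]_(t in @angles R) ((rnorm (u (cis t))) ^+ 2)%:E)%E.

Lemma sqint_ge0 (E : hilbertType R) (u : C -> E) : (0 <= sqint u)%E.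
Proof. by apply: integral_ge0 => t _; rewrite lee_fin sqr_ge0. Qed.

Lemma angles_cst (k : R) : (\int[mu]_(t in @angles R) k%:E = (k * (2 * pi))%:E)%E.
Proof.
rewrite integral_cst//= lebesgue_measure_itv/= lte_fin twopi_gt0 -EFinD -EFinM.
by rewrite oppr0 addr0.
Qed.

Lemma L2norm_lty (E : hilbertType R) (u : C -> E) : (L2norm u < +oo)%E <-> (sqint u < +oo)%E.
Proof.
have c0 : 0 < (2 * pi)^-1 :> R by rewrite invr_gt0 twopi_gt0.
rewrite /L2norm -/(sqint u); split=> [|h].
  have h2 : (2^-1 : R) != 0 by rewrite invr_eq0.
  move=> /(lty_poweRy h2); rewrite !ltey; apply: contra_neq => ->.
  by rewrite gt0_muley// lte_fin.
apply: poweR_lty; apply: lte_mul_pinfty => //.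
by rewrite lee_fin ltW.
Qed.

Lemma H2norm_bound (E : hilbertType R) (f : C -> E) : (H2norm f < +oo)%E ->
  exists K : R, forall r : R, 0 < r -> r < 1 -> (sqint (fun w => f (r%:C * w)%R) <= K%:E)%E.
Proof.
move=> hf; pose c : R := (2 * pi)^-1; have c0 : 0 < c by rewrite invr_gt0 twopi_gt0.
have [M hM] : exists M : R, (H2norm f <= M%:E)%E.
  case: (H2norm f) hf => [x _||]//; first by exists x.
  by move=> _; exists 0; rewrite leNye.
exists (c^-1 * M `^ 2) => r r0 r1.
have : (L2norm (fun w => f (r%:C * w)%R) <= M%:E)%E.
  apply: le_trans hM; apply: ereal_sup_ubound; exists r => //.
  by rewrite /= in_itv/= r0.
rewrite /L2norm -/(sqint _) -/c => h.
have M0 : 0 <= M by rewrite -lee_fin; apply: le_trans h; exact: poweR_ge0.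
have c0e : (0 <= c%:E * sqint (fun w => f (r%:C * w)%R))%E.
  by rewrite mule_ge0 ?sqint_ge0// lee_fin ltW.
have h2 : (0 : R) <= 2 by [].
have : (((c%:E * sqint (fun w => f (r%:C * w)%R)) `^ 2^-1) `^ 2 <= M%:E `^ 2)%E.
  by apply: (gt0_ler_poweR h2) => //; rewrite in_itv/= leey andbT ?lee_fin ?poweR_ge0.
rewrite -poweRrM mulVf// poweRe1// poweR_EFin => hh.
by rewrite EFinM lee_pdivlMl.
Qed.

Lemma H2norm_lty (E : hilbertType R) (f : C -> E) (K : R) :
  (forall r : R, 0 < r -> r < 1 -> (sqint (fun w => f (r%:C * w)%R) <= K%:E)%E) ->
  (H2norm f < +oo)%E.
Proof.
move=> hK; pose c : R := (2 * pi)^-1; have c0 : 0 < c by rewrite invr_gt0 twopi_gt0.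
have K0 : 0 <= K.
  have r2 : (0 : R) < 2^-1 by rewrite invr_gt0.
  have r1 : (2^-1 : R) < 1 by rewrite invf_lt1// ltr1n.
  by rewrite -lee_fin; apply: le_trans (hK _ r2 r1); exact: sqint_ge0.
apply: (@le_lt_trans _ _ (poweR (c * K)%:E 2^-1)); last by apply: poweR_lty; rewrite ltry.
apply: ge_ereal_sup => y [r /= + <-]; rewrite in_itv/= => /andP[r0 r1].
rewrite /L2norm -/(sqint _) -/c.
have h2 : (0 : R) <= 2^-1 by rewrite invr_ge0.
rewrite -poweR_EFin; apply: (gt0_ler_poweR h2).
- rewrite in_itv/= leey andbT; apply: mule_ge0; first by rewrite lee_fin ltW.
  exact: (sqint_ge0 (fun w => f (r%:C * w))).
- by rewrite in_itv/= leey andbT lee_fin mulr_ge0// ltW.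
- by rewrite EFinM lee_wpmul2l ?lee_fin ?(ltW c0)//; exact: hK.
Qed.

Lemma rnorm_circle_continuous (E : hilbertType R) (f : C -> E) (r : R) :
  has_power_series f -> 0 <= r -> r < 1 -> continuous (fun t : R => rnorm (f (r%:C * cis t)) ^+ 2).
Proof.
move=> fa r0 r1 t; rewrite /continuous_at expr2; under eq_fun do rewrite expr2.
have h : {for t, continuous (fun t : R => rnorm (f (r%:C * cis t)))}.
  apply: (@continuous_comp _ _ _ (fun t : R => f (r%:C * cis t)) (@rnorm R E)).
    exact: circle_continuous.
  exact: rnorm_continuous.
by apply: cvgM; exact: h.
Qed.

(** On the circle of radius [r] a long partial sum is within 1 of [f], so its squared norm is at
    most [2 |f|^2 + 2]. Parseval gives [2 pi] times the coefficient sum at most [2 K + 4 pi], which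
    is below [2 pi (K + 2)]; then [r] tends to 1. *)
Lemma coef_sqr_le (E : hilbertType R) (f : C -> E) (a : nat -> E) (K : R) :
  (forall z, disc z -> psums a z (f z)) ->
  (forall r : R, 0 < r -> r < 1 -> (sqint (fun w => f (r%:C * w)%R) <= K%:E)%E) ->
  forall n, \sum_(k < n) rnorm (a k) ^+ 2 <= K + 2.
Proof.
move=> ha hK n; have pi2 := @pi_ge2 R; have pi0 := @twopi_gt0 R.
have fa : has_power_series f by exists a.
have K0 : 0 <= K.
  have r2 : (0 : R) < 2^-1 by rewrite invr_gt0.
  have r1 : (2^-1 : R) < 1 by rewrite invf_lt1// ltr1n.
  by rewrite -lee_fin; apply: le_trans (hK _ r2 r1); exact: sqint_ge0.
have main r : 0 < r -> r < 1 -> \sum_(k < n) (rnorm (a k) * r ^+ k) ^+ 2 <= K + 2.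
  move=> r0 r1; pose s := (r + 1) / 2; have s0 : 0 < s by rewrite /s; lra.
  have s1 : s < 1 by rewrite /s; lra.
  have rs : r < s by rewrite /s; lra.
  have [M M0 ab] : exists2 M, 0 <= M & cbound a s M.
    by apply: (psums_cbound (ltW s0) (ha _ _)); rewrite disc_cnorm cnorm_real gtr0_norm.
  pose q := r / s.
  have q0 : 0 <= q by rewrite divr_ge0// ltW.
  have q1 : q < 1 by rewrite ltr_pdivrMr// mul1r.
  have [N hN] := geometric_lt (M / (1 - q)) q0 q1 (ltr01 : (0 : R) < 1).
  pose m := maxn n N.
  have close (t : R) : rnorm (psum a (r%:C * cis t) m - f (r%:C * cis t)) <= 1.
    have zq : cnorm (r%:C * cis t) <= q * s.
      by rewrite cnormM cnorm_real cnorm_cis mulr1 gtr0_norm// /q divfK ?gt_eqF.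
    have zd : disc (r%:C * cis t) by apply: disc_scale_cis; rewrite (ltW r0).
    rewrite rnorm_subC; apply: le_trans (psum_tail ab q0 q1 zq (ha _ zd) m) _.
    by apply: ltW; have := hN m (leq_maxr _ _); rewrite mulrAC mulrA.
  pose v k := r%:C ^+ k *: a k.
  have vE k : rnorm (v k) ^+ 2 = (rnorm (a k) * r ^+ k) ^+ 2.
    by rewrite rnormZ cnormX cnorm_real gtr0_norm// mulrC.
  apply: (@le_trans _ _ (\sum_(k < m) rnorm (v k) ^+ 2)).
    rewrite (big_ord_widen m (fun k => (rnorm (a k) * r ^+ k) ^+ 2)) ?leq_maxl//.
    rewrite [leRHS](bigID (fun k : 'I_m => (k < n)%N))/=.
    under eq_bigr do rewrite -vE.
    by rewrite lerDl sumr_ge0// => k _; exact: sqr_ge0.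
  rewrite -(ler_pM2r pi0) -[X in _ * X](subr0 (2 * pi)) -(parseval v m (a := 0) (b := 2 * pi)) ?cis0 ?cis2pi//.
  have cf := rnorm_circle_continuous fa (ltW r0) r1.
  have intf : mu.-integrable (@angles R) (EFin \o (fun t => rnorm (f (r%:C * cis t)) ^+ 2)).
    exact: integrable_cont.
  apply: (@le_trans _ _ (\int[mu]_(t in `[0, (2 * pi)%R]) (2 * rnorm (f (r%:C * cis t)) ^+ 2 + 2))).
    apply: Rint_cont_le; first exact: psum_sqr_continuous.
      by move=> t; apply: cvgD; [apply: cvgMr; exact: cf | exact: cvg_cst].
    move=> t _; rewrite -psum_scale.
    have := rnorm_sqrD_le (f (r%:C * cis t)) (psum a (r%:C * cis t) m - f (r%:C * cis t)).
    rewrite addrC subrK => /le_trans; apply.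
    have : rnorm (psum a (r%:C * cis t) m - f (r%:C * cis t)) ^+ 2 <= 1.
      by rewrite expr_le1// rnorm_ge0.
    lra.
  rewrite Rint_contD; [|by move=> t; apply: cvgMr; exact: cf|by move=> t; exact: cvg_cst].
  rewrite Rint_contZ// Rint_segment_cst ?(ltW pi0)// subr0.
  have : \int[mu]_(t in `[0, (2 * pi)%R]) (rnorm (f (r%:C * cis t)) ^+ 2) <= K.
    rewrite -lee_fin /Rintegral fineK; first exact: hK.
    by apply: integral_fune_fin_num => //; exact: integrable_cont.
  have : K * 2 <= K * (2 * pi) by rewrite ler_wpM2l//; lra.
  lra.
have cpoly : (\sum_(k < n) (rnorm (a k) * r ^+ k) ^+ 2) @[r --> (1 : R)^'-] -->
    \sum_(k < n) (rnorm (a k) * 1 ^+ k) ^+ 2.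
  suff csum : continuous (fun r : R => \sum_(k < n) (rnorm (a k) * r ^+ k) ^+ 2).
    by apply: cvg_at_left_filter; exact: csum.
  apply: (@continuous_sumR R _ _ (fun (k : 'I_n) r => (rnorm (a k) * r ^+ k) ^+ 2)).
  move=> k r; rewrite /continuous_at expr2; under eq_fun do rewrite expr2.
  have h : {for r, continuous (fun r : R => rnorm (a k) * r ^+ k)}.
    by apply: cvgMr; exact: exprn_continuous.
  by apply: cvgM; exact: h.
have -> : \sum_(k < n) rnorm (a k) ^+ 2 = \sum_(k < n) (rnorm (a k) * 1 ^+ k) ^+ 2.
  by apply: eq_bigr => k _; rewrite expr1n mulr1.
apply: (ler_cvg_to cpoly (cvg_cst (K + 2))).
near=> r; apply: main; near: r; last exact: nbhs_left_lt.
exact: nbhs_left_gt.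
Unshelve. all: by end_near. Qed.

Lemma H2_power_series (E : hilbertType R) (f : C -> E) : H2 f ->
  exists a K, (forall z, disc z -> psums a z (f z)) /\
    forall n, \sum_(k < n) rnorm (a k) ^+ 2 <= K.
Proof.
move=> [/analytic_power_series[a ha] /H2norm_bound[K hK]].
by exists a, (K + 2); split=> //; exact: coef_sqr_le ha hK.
Qed.

Section square_summable.
Variables (E : hilbertType R) (f : C -> E) (a : nat -> E) (K : R).
Hypothesis ha : forall z, disc z -> psums a z (f z).
Hypothesis aK : forall n, \sum_(k < n) rnorm (a k) ^+ 2 <= K.

Let fa : has_power_series f. Proof. by exists a. Qed.

Lemma regular_ae : {ae mu, forall t, @angles R t -> regular f t}.
Proof.
have [n_ [_ [B [mB B0 hB]]]] := fatou_radial ha aK.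
exists B; split=> // t /= h; apply: contrapT => tB; apply: h => t01.
have [|l hl _] := hB t _ tB; first by move: t01; rewrite /angles/= in_itv.
exact: (boundaryE hl).1.
Qed.

(** Fatou's lemma along the lacunary partial sums, which converge to the boundary value almost
    everywhere; Parseval bounds each integral by [2 pi eta]. *)
Lemma boundary_tail N (eta : R) :
  (forall M, (N <= M)%N -> \sum_(N <= k < M) rnorm (a k) ^+ 2 <= eta) ->
  (\int[mu]_(t in @angles R) ((rnorm (boundary f (cis t) - psum a (cis t) N)) ^+ 2)%:E
    <= (eta * (2 * pi))%:E)%E.
Proof.
move=> heta; have [n_ [hn [B [mB B0 hB]]]] := fatou_radial ha aK.
(* The shift by [N] ensures that the index is at least [N], so that the difference is a block. *)
pose g j t := ((rnorm (psum a (cis t) (n_ (j + N)%N) - psum a (cis t) N)) ^+ 2)%:E.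
have gE j t : g j t = (rnorm (psum (trunc a N) (cis t) (n_ (j + N)%N)) ^+ 2)%:E.
  by rewrite /g psum_trunc// (leq_trans (leq_addl j N) (hn _)).
have mg j : measurable_fun (@angles R) (g j).
  rewrite (_ : g j = EFin \o (fun t : R => rnorm (psum (trunc a N) (cis t) (n_ (j + N)%N)) ^+ 2)).
    apply/measurable_EFinP; apply: measurable_funTS; apply: continuous_measurable_fun.
    exact: psum_sqr_continuous.
  by apply/funext => t; rewrite gE.
have g0 j t : @angles R t -> (0 <= g j t)%E by move=> _; rewrite lee_fin sqr_ge0.
have intg j : (\int[mu]_(t in @angles R) g j t <= (eta * (2 * pi))%:E)%E.
  under eq_integral do rewrite gE.
  rewrite -[leLHS]fineK; last first.
    apply: integral_fune_fin_num => //.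
    apply: (integrable_cont (f := fun t : R => rnorm (psum (trunc a N) (cis t) (n_ (j + N)%N)) ^+ 2)).
    exact: psum_sqr_continuous.
  rewrite lee_fin -/(Rintegral _ _ _) /angles parseval ?twopi_gt0 ?cis0 ?cis2pi// subr0.
  rewrite ler_wpM2r ?(ltW twopi_gt0)// sum_trunc ?heta//.
  - exact: leq_trans (leq_addl j N) (hn _).
  - exact: leq_trans (leq_addl j N) (hn _).
have mh : measurable_fun (@angles R)
    (fun t => ((rnorm (boundary f (cis t) - psum a (cis t) N)) ^+ 2)%:E).
  apply/measurable_EFinP; apply: measurable_rnorm_psum => //.
  exact: bmeasurable_boundary.
have mD : measurable (@angles R `\` B) by exact: measurableD.
have DA : @angles R `\` B `<=` @angles R by move=> t [].
rewrite (@ge0_negligible_integral _ _ _ mu (@angles R) B)//; last first.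
  by move=> t _; rewrite lee_fin sqr_ge0.
apply: (@le_trans _ _ (\int[mu]_(t in @angles R `\` B) limn_einf (g^~ t))%E).
  rewrite le_eqVlt; apply/orP; left; apply/eqP; apply: eq_integral => t.
  rewrite inE => -[t01 tB].
  have [|l hl hl'] := hB t _ tB; first by move: t01; rewrite /angles/= in_itv.
  have [_ ->] := boundaryE hl.
  suff hg : g j t @[j --> \oo] --> ((rnorm (l - psum a (cis t) N)) ^+ 2)%:E.
    by rewrite (cvg_limn_einf_sup hg).1.
  apply: cvg_EFin; first by apply: nearW.
  have cr : rnorm (psum a (cis t) (n_ (j + N)%N) - psum a (cis t) N) @[j --> \oo] -->
      rnorm (l - psum a (cis t) N).
    have cl : (psum a (cis t) (n_ (j + N)%N) - psum a (cis t) N : E) @[j --> \oo] --> (l - psum a (cis t) N : E).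
      apply: cvgB; last exact: cvg_cst.
      apply/cvg_seq_rnormP => e /((cvg_seq_rnormP _ _).1 hl')[m hm].
      by exists m => j mj; apply: hm; rewrite (leq_trans mj)// leq_addr.
    exact: (cvg_comp _ (@rnorm R E) cl (@rnorm_continuous R E (l - psum a (cis t) N))).
  exact: (cvgM cr cr).
apply: (@le_trans _ _ (limn_einf (fun j => \int[mu]_(t in @angles R `\` B) g j t))%E).
  apply: fatou => // [j|j t /DA]; last exact: g0.
  exact: measurable_funS (mg j).
rewrite limn_einf_lim; apply: lime_le; first exact: is_cvg_einfs.
apply: nearW => j; apply: le_trans (intg j).
apply: (@le_trans _ _ (\int[mu]_(t in @angles R `\` B) g j t)%E).
  by apply: ereal_inf_lbound; exists j => /=.
by apply: ge0_subset_integral; [exact: mD|exact: measurable_angles|exact: (mg j)|exact: (g0 j)|exact: DA].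
Qed.

Lemma boundary_sqint : (sqint (boundary f) < +oo)%E.
Proof.
apply: (@le_lt_trans _ _ (K * (2 * pi))%:E); last by rewrite ltry.
have := @boundary_tail 0 K; rewrite /sqint.
under eq_integral do rewrite /psum big_ord0 subr0.
by apply=> M _; rewrite big_mkord.
Qed.

Lemma tail_small (e : R) : 0 < e -> exists N, forall n M, (N <= n)%N -> (n <= M)%N ->
  \sum_(n <= k < M) rnorm (a k) ^+ 2 <= e.
Proof.
move=> e0; have [n_ [hn ht]] := lacunary_indices (fun k => sqr_ge0 (rnorm (a k))) aK.
have q0 : (0 : R) <= (1 / 4) ^+ 2 by rewrite sqr_ge0.
have q1 : ((1 / 4) ^+ 2 : R) < 1 by rewrite expr_lt1//; lra.
have [j hj] := geometric_lt 1 q0 q1 e0.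
exists (n_ j) => n M jn nM; apply: le_trans (ltW (hj j (leqnn _))).
rewrite mul1r exprAC; apply: le_trans (ht j M (leq_trans jn nM)).
by rewrite (big_cat_nat jn nM)/= lerDr sumr_ge0// => k _; exact: sqr_ge0.
Qed.

End square_summable.

Lemma sqint_integrable (E : hilbertType R) (u v : R -> E) :
  measurable_fun (@angles R) (fun t => rdot (u t) (v t)) ->
  bmeasurable (@angles R) u -> bmeasurable (@angles R) v ->
  (\int[mu]_(t in @angles R) ((rnorm (u t)) ^+ 2)%:E < +oo)%E ->
  (\int[mu]_(t in @angles R) ((rnorm (v t)) ^+ 2)%:E < +oo)%E ->
  mu.-integrable (@angles R) (EFin \o (fun t => rdot (u t) (v t))).
Proof.
move=> muv mu_ mv hu hv.
have sq (w : R -> E) : bmeasurable (@angles R) w ->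
    (\int[mu]_(t in @angles R) ((rnorm (w t)) ^+ 2)%:E < +oo)%E ->
    mu.-integrable (@angles R) (EFin \o (fun t => rnorm (w t) ^+ 2)).
  move=> mw hw; apply/integrableP; split.
    by apply/measurable_EFinP; apply: measurable_funX; exact: measurable_rnorm.
  apply: le_lt_trans hw; apply: ge0_le_integral => //.
  - apply/measurable_EFinP; apply: measurableT_comp => //.
    by apply: measurable_funX; exact: measurable_rnorm.
  - by apply/measurable_EFinP; apply: measurable_funX; exact: measurable_rnorm.
  - by move=> t _; rewrite /= ger0_norm// sqr_ge0.
have i1 := sq _ mu_ hu; have i2 := sq _ mv hv.
have huv : mu.-integrable (@angles R)
    ((EFin \o (fun t => (rnorm (u t) ^+ 2)%R)) \+ (EFin \o (fun t => (rnorm (v t) ^+ 2)%R)))%E.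
  exact: integrableD.
apply: (le_integrable _ _ _ huv) => //; first exact/measurable_EFinP.
move=> t _; rewrite /= lee_fin.
rewrite [leRHS]ger0_norm ?addr_ge0 ?sqr_ge0//.
apply: le_trans (rdot_norm_le _ _) _.
have := sqr_ge0 (rnorm (u t) - rnorm (v t)); rewrite sqrrB.
have := sqr_ge0 (rnorm (u t)); have := sqr_ge0 (rnorm (v t)); lra.
Qed.

End boundary_L2.

(** * Fourier coefficients of boundary values, tested on monomials *)

Section fourier_coefficients.
Context {R : realType} {E : hilbertType R}.
Local Notation mu := (@lebesgue_measure R).
Local Notation C := R[i].
Let measurable_anglesR : measurable (@angles R). Proof. exact: measurable_angles. Qed.
#[local] Hint Resolve measurable_anglesR : core.

Definition monomial n (x : E) : C -> E := fun z => z ^+ n *: x.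

Definition monomial_coef n (x : E) (k : nat) : E := if k == n then x else 0.

Lemma psum_monomial n x z N : (n < N)%N -> psum (monomial_coef n x) z N = monomial n x z.
Proof.
move=> nN; rewrite /psum (bigD1 (Ordinal nN))//= /monomial_coef eqxx big1 ?addr0// => k.
by rewrite -val_eqE /= => /negbTE ->; rewrite scaler0.
Qed.

Lemma monomial_series n x z : psums (monomial_coef n x) z (monomial n x z).
Proof.
apply/cvg_seq_rnormP => e e0; exists n.+1 => N nN.
by rewrite psum_monomial// subrr rnorm0.
Qed.

Lemma monomial_power_series n x : has_power_series (monomial n x).
Proof. by exists (monomial_coef n x) => z _; exact: monomial_series. Qed.

Lemma monomial_boundaryE n (x : E) (t : R) :
  regular (monomial n x) t /\ boundary (monomial n x) (cis t) = cis t ^+ n *: x.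
Proof.
apply: (boundaryE (f := monomial n x)); apply/cvg_rnormP => e e0.
have := psum_radial_near (monomial_coef n x) n.+1 t e0; apply: filterS => r.
by rewrite rnorm_subC !psum_monomial.
Qed.

Lemma boundary_monomial n x (t : R) : boundary (monomial n x) (cis t) = cis t ^+ n *: x.
Proof. exact: (monomial_boundaryE n x t).2. Qed.

Lemma rnorm_cisZ n (x : E) (t : R) : rnorm (cis t ^+ n *: x) = rnorm x.
Proof. by rewrite rnormZ cnormX cnorm_cis expr1n mul1r. Qed.

Lemma Hinfty_power_series (f : C -> E) : Hinfty f ->
  exists M : R, [/\ 0 <= M, has_power_series f & forall z, disc z -> rnorm (f z) <= M].
Proof.
move=> [fa [M hM]]; exists (complex.Re M).
have h z : disc z -> rnorm (f z) <= complex.Re M.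
  by move=> /hM; rewrite rnormE lecE/= => /andP[].
split=> //; last exact: analytic_power_series.
have d0 : disc (0 : C) by rewrite disc_cnorm cnorm0.
by apply: le_trans (h _ d0); exact: rnorm_ge0.
Qed.

Lemma bounded_H2 (f : C -> E) (M : R) : has_power_series f ->
  (forall z, disc z -> rnorm (f z) <= M) -> H2 f.
Proof.
move=> fa fM; split; first by have [a ha] := fa; exact: power_series_analytic ha.
apply: (@H2norm_lty _ _ _ (M ^+ 2 * (2 * pi))) => r r0 r1.
rewrite -angles_cst; apply: ge0_le_integral => //.
- by move=> t _; rewrite lee_fin sqr_ge0.
- apply: measurable_funTS; apply/measurable_EFinP; apply: continuous_measurable_fun.
  exact: rnorm_circle_continuous fa (ltW r0) r1.
- move=> t _; rewrite lee_fin.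
  have zd : disc (r%:C * cis t) by apply: disc_scale_cis; rewrite (ltW r0).
  have M0 : 0 <= M by apply: le_trans (fM _ zd); exact: rnorm_ge0.
  by rewrite lerXn2r ?nnegrE ?rnorm_ge0// fM.
Qed.

Lemma Hinfty_H2 (f : C -> E) : Hinfty f -> H2 f.
Proof. by move=> /Hinfty_power_series[M [_ fa fM]]; exact: bounded_H2 fa fM. Qed.

Lemma monomial_H2 n x : H2 (monomial n x).
Proof.
apply: (bounded_H2 (M := rnorm x) (monomial_power_series n x)) => z.
rewrite disc_cnorm => z1; rewrite /monomial rnormZ cnormX.
by rewrite ler_piMl ?rnorm_ge0// exprn_ile1 ?cnorm_ge0// ltW.
Qed.

Definition fourier (u : C -> E) n (x : E) : R :=
  \int[mu]_(t in @angles R) rdot (u (cis t)) (cis t ^+ n *: x).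

Lemma bmeasurable_cisZ n (x : E) : bmeasurable (@angles R) (fun t => cis t ^+ n *: x).
Proof.
rewrite (_ : (fun t => _) = fun t => boundary (monomial n x) (cis t)).
  exact: bmeasurable_boundary (monomial_power_series n x).
by apply/funext => t; rewrite boundary_monomial.
Qed.

Lemma fourier_integrable (u : C -> E) n x : bmeasurable (@angles R) (fun t => u (cis t)) ->
  (sqint u < +oo)%E ->
  mu.-integrable (@angles R) (EFin \o (fun t => rdot (u (cis t)) (cis t ^+ n *: x))).
Proof.
move=> mu_ hu; apply: (sqint_integrable (u := fun t => u (cis t)) (v := fun t => cis t ^+ n *: x)) => //.
- exact: measurable_rdot_cis.
- exact: bmeasurable_cisZ.
- under eq_integral do rewrite rnorm_cisZ.
  by rewrite angles_cst ltry.
Qed.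

Lemma fourierB (u v : C -> E) n x :
  bmeasurable (@angles R) (fun t => u (cis t)) -> (sqint u < +oo)%E ->
  bmeasurable (@angles R) (fun t => v (cis t)) -> (sqint v < +oo)%E ->
  fourier (fun w => u w - v w) n x = fourier u n x - fourier v n x.
Proof.
move=> mu_ hu mv hv; rewrite /fourier -RintegralB//.
- by apply: eq_Rintegral => t _; rewrite rdotBl.
- exact: fourier_integrable.
- exact: fourier_integrable.
Qed.

Lemma fourier_psum (a : nat -> E) n N x : (n < N)%N ->
  \int[mu]_(t in @angles R) rdot (psum a (cis t) N) (cis t ^+ n *: x) =
  2 * pi * rdot (a n) x.
Proof.
move=> nN; have rE t : rdot (psum a (cis t) N) (cis t ^+ n *: x) =
    \sum_(k < N) trig2 <| a k, x |> k n t.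
  rewrite /rdot dot_suml Re_sum; apply: eq_bigr => k _.
  by rewrite dotZl dotZr /trig2; congr complex.Re; ring.
under eq_Rintegral do rewrite rE.
rewrite /angles Rint_cont_sum => [|k]; last exact: trig2_continuous.
under eq_bigr do rewrite int_trig2 ?cis0 ?cis2pi ?twopi_gt0//.
rewrite (bigD1 (Ordinal nN))//= eqxx big1 ?addr0 => [|k]; first by rewrite subr0 mulrC.
by rewrite -val_eqE /= => /negbTE ->.
Qed.

(** The identity holds exactly for a partial sum of degree at least [n]; replacing it by the
    boundary function costs an error controlled by the mean square of the tail. *)
Lemma fourier_boundary (f : C -> E) (a : nat -> E) (K : R) n x :
  (forall z, disc z -> psums a z (f z)) ->
  (forall n, \sum_(k < n) rnorm (a k) ^+ 2 <= K) ->
  fourier (boundary f) n x = 2 * pi * rdot (a n) x.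
Proof.
move=> ha aK; have fa : has_power_series f by exists a.
have pi0 := @twopi_gt0 R.
have mf : bmeasurable (@angles R) (fun t => boundary f (cis t)) by exact: bmeasurable_boundary.
have sf := boundary_sqint ha aK.
pose h t := cis t ^+ n *: x.
apply/eqP; rewrite -subr_eq0 -normr_eq0; apply/eqP/ge0_eps_eq0 => // d d0.
(* With tail integral at most [2 pi e^2], the bound [|g|^2 / (2 e) + e |x|^2 / 2] on the integrand
   integrates to at most [pi e + pi e |x|^2 = e L]. *)
pose L := pi * (1 + rnorm x ^+ 2).
have L0 : 0 < L by rewrite mulr_gt0 ?pi_gt0// ltr_pwDl ?sqr_ge0.
pose e := d / L; have e0 : 0 < e by rewrite divr_gt0.
have e20 : 0 < 2 * e by exact: mulr_gt0.
have [N0 hN] := tail_small aK (exprn_gt0 2 e0).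
pose N := maxn N0 n.+1.
have nN : (n < N)%N by rewrite leq_max ltnSn orbT.
have tail := boundary_tail ha aK (fun M NM => hN N M (leq_maxl _ _) NM).
have ip : mu.-integrable (@angles R) (EFin \o (fun t => rdot (psum a (cis t) N) (h t))).
  apply: integrable_cont; rewrite (_ : (fun t => _) = fun t => \sum_(k < N) trig2 <| a k, x |> k n t).
    by apply: continuous_sumR => k; exact: trig2_continuous.
  apply/funext => t; rewrite /rdot dot_suml Re_sum; apply: eq_bigr => k _.
  by rewrite dotZl dotZr /trig2; congr complex.Re; ring.
have ib := fourier_integrable n x mf sf.
rewrite -(fourier_psum a x nN) /fourier -RintegralB//.
pose g t := boundary f (cis t) - psum a (cis t) N.
have gE t : rdot (boundary f (cis t)) (h t) - rdot (psum a (cis t) N) (h t) = rdot (g t) (h t).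
  by rewrite rdotBl.
have ig : mu.-integrable (@angles R) (EFin \o (fun t => rdot (g t) (h t))).
  suff : mu.-integrable (@angles R) ((EFin \o (fun t => rdot (boundary f (cis t)) (h t))) \-
      (EFin \o (fun t => rdot (psum a (cis t) N) (h t))))%E.
    by congr (integrable _ _ _); apply/funext => t /=; rewrite -gE.
  exact: integrableB.
have mg : measurable_fun (@angles R) (fun t => rnorm (g t) ^+ 2).
  exact: measurable_rnorm_psum.
under eq_Rintegral do rewrite gE.
apply: le_trans (le_normr_Rintegral _ ig) _ => //.
have mgh : measurable_fun (@angles R) (fun t => rdot (g t) (h t)).
  by move: ig => /integrableP[/measurable_EFinP].
have ign : mu.-integrable (@angles R) (EFin \o (fun t => `|rdot (g t) (h t)|)).
  exact: integrable_norm.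
rewrite -lee_fin /Rintegral fineK; last exact: integrable_fin_num.
apply: (@le_trans _ _ (\int[mu]_(t in @angles R)
    (((2 * e)^-1)%:E * (rnorm (g t) ^+ 2)%:E + (e / 2 * rnorm x ^+ 2)%:E))%E).
  apply: ge0_le_integral => //.
  - by apply/measurable_EFinP; apply: measurableT_comp.
  - apply: emeasurable_funD => //; apply: measurable_funeM; exact/measurable_EFinP.
  - move=> t _; rewrite -EFinM -EFinD lee_fin; apply: le_trans (rdot_norm_le _ _) _.
    rewrite rnorm_cisZ -(ler_pM2l e20).
    have -> : 2 * e * ((2 * e)^-1 * rnorm (g t) ^+ 2 + e / 2 * rnorm x ^+ 2) =
        rnorm (g t) ^+ 2 + (e * rnorm x) ^+ 2 by field; rewrite gt_eqF.
    have := sqr_ge0 (rnorm (g t) - e * rnorm x); rewrite sqrrB; lra.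
have i0 : 0 <= (2 * e)^-1 by rewrite invr_ge0 mulr_ge0// ltW.
have k0 : 0 <= e / 2 * rnorm x ^+ 2 by rewrite mulr_ge0 ?sqr_ge0// divr_ge0// ltW.
have mge : measurable_fun (@angles R) (fun t => (rnorm (g t) ^+ 2)%:E) by exact/measurable_EFinP.
have eI : (\int[mu]_(t in @angles R)
    (((2 * e)^-1)%:E * (rnorm (g t) ^+ 2)%:E + (e / 2 * rnorm x ^+ 2)%:E) =
    ((2 * e)^-1)%:E * \int[mu]_(t in @angles R) (rnorm (g t) ^+ 2)%:E +
    \int[mu]_(t in @angles R) (e / 2 * rnorm x ^+ 2)%:E)%E.
  have <- : (\int[mu]_(t in @angles R) (((2 * e)^-1)%:E * (rnorm (g t) ^+ 2)%:E) =
      ((2 * e)^-1)%:E * \int[mu]_(t in @angles R) (rnorm (g t) ^+ 2)%:E)%E.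
    by apply: ge0_integralZl => // t _; rewrite lee_fin sqr_ge0.
  apply: (ge0_integralD mu measurable_anglesR (f1 := fun t => ((2 * e)^-1)%:E * (rnorm (g t) ^+ 2)%:E)%E) => //.
  - by move=> t _; rewrite mule_ge0// lee_fin sqr_ge0.
  - exact: measurable_funeM.
rewrite [leLHS]eI angles_cst.
apply: le_trans (leeD (lee_wpmul2l _ tail) (lexx _)) _; first by rewrite lee_fin.
rewrite -EFinM -EFinD lee_fin le_eqVlt; apply/orP; left; apply/eqP.
have -> : d = e * L by rewrite /e divfK// gt_eqF.
by rewrite /L; field; rewrite gt_eqF.
Qed.

Lemma power_series_ext (f g : C -> E) (a b : nat -> E) :
  (forall z, disc z -> psums a z (f z)) -> (forall z, disc z -> psums b z (g z)) ->
  (forall n x, rdot (a n) x = rdot (b n) x) -> forall z, disc z -> f z = g z.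
Proof.
move=> ha hb hab z zd.
suff ab : a = b by rewrite (psums_unique (ha z zd) (y' := g z))// ab; exact: hb.
apply/funext => n; apply/eqP; rewrite -subr_eq0; apply/eqP/rnorm0_eq0/eqP.
by rewrite -sqrf_eq0 -rdotxx rdotBl hab subrr.
Qed.

End fourier_coefficients.

(** * Wedge products *)

Section dot_continuity.
Context {R : realType} {E : hilbertType R}.
Local Notation C := R[i].

Lemma dot_cvg {T} {F : set_system T} {FF : Filter F} (u v : T -> E) (x y : E) :
  u t @[t --> F] --> x -> v t @[t --> F] --> y -> <| u t, v t |> @[t --> F] --> <| x, y |>.
Proof.
move=> /cvg_rnormP hu /cvg_rnormP hv; apply/cvgrPdist_lt => -[e e'].
rewrite ltcE /= => /andP[/eqP -> e0].
pose L := rnorm x + rnorm y + 1.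
have L0 : 0 < L by rewrite ltr_wpDl// addr_ge0 ?rnorm_ge0.
pose d := Num.min 1 (e / L).
have d0 : 0 < d by rewrite lt_min ltr01 divr_gt0.
near=> t; rewrite cnormE ltcR.
have n1 : rnorm (x - u t) < d by near: t; exact: hu.
have n2 : rnorm (y - v t) < d by near: t; exact: hv.
have -> : <| x, y |> - <| u t, v t |> = <| x - u t, y |> + <| u t, y - v t |>.
  by rewrite dotBl dotBr addrA subrK.
have an : rnorm (u t) <= rnorm x + 1.
  rewrite -[u t](subrK x); apply: le_trans (rnormD _ _) _.
  by rewrite addrC lerD2l rnorm_subC (le_trans (ltW n1))// ge_min lexx.
apply: le_lt_trans (cnormD _ _) _.
apply: le_lt_trans (lerD (cnorm_dot_le _ _) (cnorm_dot_le _ _)) _.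
have h1 : rnorm (x - u t) * rnorm y <= d * rnorm y by rewrite ler_wpM2r ?rnorm_ge0// ltW.
have u0 : 0 < rnorm x + 1 by rewrite ltr_wpDl ?rnorm_ge0.
have h2 : rnorm (u t) * rnorm (y - v t) < (rnorm x + 1) * d.
  by apply: le_lt_trans (ler_wpM2r (rnorm_ge0 _) an) _; rewrite ltr_pM2l.
apply: lt_le_trans (ler_ltD h1 h2) _.
have -> : d * rnorm y + (rnorm x + 1) * d = d * L by rewrite /L; ring.
by rewrite -ler_pdivlMr// ge_min lexx orbT.
Unshelve. all: by end_near. Qed.

Lemma dotZ_cvg {T} {F : set_system T} {FF : Filter F} (u v w : T -> E) (x y z : E) :
  u t @[t --> F] --> x -> v t @[t --> F] --> y -> w t @[t --> F] --> z ->
  <| u t, v t |> *: w t @[t --> F] --> <| x, y |> *: z.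
Proof. by move=> hu hv hw; apply: cvgZ => //; exact: dot_cvg. Qed.

End dot_continuity.

Section wedge_product.
Context {R : realType} {E : hilbertType R} (E2 : hilbert_tensor_square E).
Local Notation C := R[i].
Local Notation tens := (tens E2).
Local Notation wedge := (wedge E2).

(* The flip is unitary, so it fixes [x (x) y + y (x) x] and negates the
   antisymmetric tensors; the two are therefore orthogonal. *)
Lemma wedgeE (x y : E) : wedge x y = 2^-1 *: (tens x y - tens y x).
Proof.
set q := 2^-1 *: _.
have flipB s t : tens_flip E2 (s - t) = tens_flip E2 s - tens_flip E2 t by rewrite linearB.
have Wq : @wedge_square R E E2 q.
  by rewrite /wedge_square /= /q linearZ flipB !tens_flipE -scalerN opprB.
have orth w : @wedge_square R E E2 w -> <| tens x y - q, w |> = 0.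
  move=> Ww.
  have -> : tens x y - q = 2^-1 *: (tens x y + tens y x).
    apply/eqP; rewrite subr_eq /q -scalerDr addrACA subrr addr0 -(mulr2n (tens x y)) -(scaler_nat 2 (tens x y)) scalerA.
    by rewrite mulVf ?pnatr_eq0// scale1r.
  set s := tens x y + tens y x.
  have fs : tens_flip E2 s = s by rewrite /s linearD !tens_flipE addrC.
  have : <| s, w |> = - <| s, w |>.
    rewrite -[LHS]tens_flip_unitary fs (_ : tens_flip E2 w = - w)//.
    by rewrite linearNr.
  move/eqP; rewrite -addr_eq0 -mulr2n mulrn_eq0/= => /eqP h.
  by rewrite dotZl h mulr0.
apply: xget_unique => [|p [Wp hp]]; first by [].
(* Uniqueness of the projection: [p - q] is antisymmetric and is the difference of two vectors
   orthogonal to all antisymmetric tensors, hence orthogonal to itself. *)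
apply/eqP; rewrite -subr_eq0; apply/eqP/rnorm0_eq0/eqP; rewrite -sqrf_eq0 -rdotxx /rdot.
have Wpq : @wedge_square R E E2 (p - q).
  by rewrite /wedge_square /= flipB Wp Wq opprD.
have pq : p - q = (tens x y - q) - (tens x y - p).
  by rewrite opprB [RHS]addrC addrA subrK.
by rewrite {1}pq dotBl orth// hp// subrr.
Qed.

Lemma wedge_antisym (x y : E) : @wedge_square R E E2 (wedge x y).
Proof.
by rewrite wedgeE /wedge_square /= linearZ linearB !tens_flipE -scalerN opprB.
Qed.

(** The four products of elementary tensors form two equal pairs; with the factor 2 of [tens_dot]
    this cancels the [1/4]. *)
Lemma wedge_dot (x1 x2 y1 y2 : E) :
  <| wedge x1 x2, wedge y1 y2 |> =
  <| x1, y1 |> * <| x2, y2 |> - <| x1, y2 |> * <| x2, y1 |>.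
Proof.
rewrite !wedgeE dotZl dotZr !dotBl !dotBr !tens_dot.
rewrite fmorphV rmorph_nat.
by field.
Qed.

Lemma rnorm_tens (x y : E) : rnorm (tens x y) <= 2 * (rnorm x * rnorm y).
Proof.
rewrite -(ler_pXn2r (n := 2)) ?nnegrE ?mulr_ge0 ?rnorm_ge0//.
rewrite -rdotxx /rdot tens_dot !dot_normE !rnormE -!rmorphXn -rmorphM.
have -> : 2 = 2%:C :> C by rewrite rmorph_nat.
rewrite -rmorphM/= !exprMn.
have := mulr_ge0 (sqr_ge0 (rnorm x)) (sqr_ge0 (rnorm y)); lra.
Qed.

Lemma rnorm_wedge (x y : E) : rnorm (wedge x y) <= 2 * (rnorm x * rnorm y).
Proof.
rewrite wedgeE rnormZ.
have -> : cnorm (2^-1 : C) = 2^-1.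
  have -> : (2^-1 : C) = (2^-1)%:C by rewrite rmorphV ?unitfE ?pnatr_eq0// rmorph_nat.
  by rewrite cnorm_real gtr0_norm ?invr_gt0.
have := rnormB (tens x y) (tens y x); have := rnorm_tens x y; have := rnorm_tens y x.
rewrite (mulrC (rnorm y)); lra.
Qed.

Lemma wedge_cvg {T} {F : set_system T} {FF : Filter F} (u v : T -> E) (x y : E) :
  u t @[t --> F] --> x -> v t @[t --> F] --> y -> wedge (u t) (v t) @[t --> F] --> wedge x y.
Proof.
move=> hu hv; rewrite wedgeE; under eq_fun do rewrite wedgeE.
by apply: cvgZr; apply: cvgB; exact: (bounded_bilinear_cvg rnorm_tens).
Qed.

Lemma pwedge_power_series (f g : C -> E) : has_power_series f -> has_power_series g ->
  has_power_series (pwedge E2 f g).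
Proof.
move=> [a ha] [b hb].
exists (fun k => 2^-1 *: (cauchy_prod tens a b k - cauchy_prod tens b a k)) => z zd.
have := zd; rewrite disc_cnorm => z1; have z0 := cnorm_ge0 z.
pose s := (cnorm z + 1) / 2; have s0 : 0 < s by rewrite /s; lra.
have s1 : s < 1 by rewrite /s; lra.
have zs : cnorm z < s by rewrite /s; lra.
have sd : disc s%:C by rewrite disc_cnorm cnorm_real gtr0_norm.
have [M _ aM] := psums_cbound (ltW s0) (ha _ sd).
have [M' _ bM] := psums_cbound (ltW s0) (hb _ sd).
have q0 : 0 <= cnorm z / s by rewrite divr_ge0// ltW.
(* The Cauchy product lemma asks for [|z| <= p^2 s]. *)
pose p := Num.sqrt (cnorm z / s).
have p0 : 0 <= p by exact: sqrtr_ge0.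
have p1 : p < 1 by rewrite -sqrtr1 ltr_sqrt// ltr_pdivrMr// mul1r.
have zp : cnorm z <= p ^+ 2 * s by rewrite sqr_sqrtr// divfK ?gt_eqF.
rewrite /pwedge wedgeE; apply: psumsZB.
- exact: (psums_cauchy_prod rnorm_tens aM bM p0 p1 zp (ha _ zd) (hb _ zd)).
- exact: (psums_cauchy_prod rnorm_tens bM aM p0 p1 zp (hb _ zd) (ha _ zd)).
Qed.

Lemma pwedge_regular (f g : C -> E) (t : R) : regular f t -> regular g t ->
  regular (pwedge E2 f g) t /\
  boundary (pwedge E2 f g) (cis t) = wedge (boundary f (cis t)) (boundary g (cis t)).
Proof. by move=> hf hg; apply: boundaryE; exact: wedge_cvg. Qed.

Lemma pwedge_H2 (f g : C -> E) : Hinfty f -> H2 g -> H2wedge (pwedge E2 f g).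
Proof.
move=> /Hinfty_power_series[M [M0 fa fM]] Hg; have [b [L [hb bL]]] := H2_power_series Hg.
have ga : has_power_series g by exists b.
have wa := pwedge_power_series fa ga.
split; last by move=> z _; exact: wedge_antisym.
split; first by have [c hc] := wa; exact: power_series_analytic hc.
have [_ /H2norm_bound[K hK]] := Hg.
apply: (@H2norm_lty _ _ _ ((2 * M) ^+ 2 * K)) => r r0 r1.
have M2 : 0 <= (2 * M) ^+ 2 by exact: sqr_ge0.
have mg : measurable_fun (@angles R) (fun t => ((rnorm (g (r%:C * cis t))) ^+ 2)%:E).
  apply: measurable_funTS; apply/measurable_EFinP; apply: continuous_measurable_fun.
  exact: rnorm_circle_continuous ga (ltW r0) r1.
rewrite EFinM; apply: le_trans (lee_wpmul2l _ (hK r r0 r1)); last by rewrite lee_fin.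
rewrite /sqint.
have <- : (\int[@lebesgue_measure R]_(t in @angles R)
    (((2 * M) ^+ 2)%:E * ((rnorm (g (r%:C * cis t))) ^+ 2)%:E) =
    ((2 * M) ^+ 2)%:E * \int[@lebesgue_measure R]_(t in @angles R) ((rnorm (g (r%:C * cis t))) ^+ 2)%:E)%E.
  apply: ge0_integralZl => //; first exact: measurable_angles.
  by move=> t _; rewrite lee_fin sqr_ge0.
apply: ge0_le_integral => //.
- exact: measurable_angles.
- by move=> t _; rewrite lee_fin sqr_ge0.
- apply: measurable_funTS; apply/measurable_EFinP; apply: continuous_measurable_fun.
  exact: rnorm_circle_continuous wa (ltW r0) r1.
- exact: measurable_funeM.
- move=> t _; rewrite -EFinM lee_fin -exprMn.
  have zd : disc (r%:C * cis t) by apply: disc_scale_cis; rewrite (ltW r0).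
  rewrite lerXn2r ?nnegrE ?mulr_ge0 ?rnorm_ge0//; apply: le_trans (rnorm_wedge _ _) _.
  by rewrite -mulrA ler_pM2l// ler_wpM2r ?rnorm_ge0// fM.
Qed.

End wedge_product.

(** * The adjoint of the creation operator *)

Section boundary_bounds.
Context {R : realType} {E : hilbertType R}.
Local Notation mu := (@lebesgue_measure R).
Local Notation C := R[i].
Let measurable_anglesR : measurable (@angles R). Proof. exact: measurable_angles. Qed.
#[local] Hint Resolve measurable_anglesR : core.

Lemma L2P (u : C -> E) :
  L2 u <-> bmeasurable (@angles R) (fun t => u (cis t)) /\ (sqint u < +oo)%E.
Proof. by split=> -[mu_ /L2norm_lty]. Qed.

Lemma sqint_dominated (F : hilbertType R) (u : C -> E) (v : C -> F) (k : R) :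
  bmeasurable (@angles R) (fun t => u (cis t)) -> bmeasurable (@angles R) (fun t => v (cis t)) ->
  (forall t, rnorm (u (cis t)) <= k * rnorm (v (cis t))) ->
  (sqint v < +oo)%E -> (sqint u < +oo)%E.
Proof.
move=> mu_ mv uv hv.
have mu2 : measurable_fun (@angles R) (fun t => (rnorm (u (cis t)) ^+ 2)%:E).
  by apply/measurable_EFinP; apply: measurable_funX; exact: measurable_rnorm.
have mv2 : measurable_fun (@angles R) (fun t => (rnorm (v (cis t)) ^+ 2)%:E).
  by apply/measurable_EFinP; apply: measurable_funX; exact: measurable_rnorm.
have k2 : 0 <= k ^+ 2 by exact: sqr_ge0.
apply: (@le_lt_trans _ _ ((k ^+ 2)%:E * sqint v)%E); last by rewrite lte_mul_pinfty ?lee_fin.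
have <- : (\int[mu]_(t in @angles R) ((k ^+ 2)%:E * (rnorm (v (cis t)) ^+ 2)%:E) =
    (k ^+ 2)%:E * sqint v)%E.
  by apply: ge0_integralZl => // t _; rewrite lee_fin sqr_ge0.
apply: ge0_le_integral => //.
- by move=> t _; rewrite lee_fin sqr_ge0.
- exact: measurable_funeM.
- move=> t _; rewrite -EFinM lee_fin -exprMn.
  have h0 := rnorm_ge0 (u (cis t)).
  by rewrite lerXn2r ?nnegrE// (le_trans h0).
Qed.

(** The extra [rnorm point] covers the default value, which makes the bound valid at every angle. *)
Lemma rnorm_boundary_le (f : C -> E) (M : R) : (forall z, disc z -> rnorm (f z) <= M) ->
  forall t, rnorm (boundary f (cis t)) <= M + rnorm (point : E).
Proof.
move=> fM t; have M0 : 0 <= M.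
  by apply: le_trans (rnorm_ge0 _) (fM 0 _); rewrite disc_cnorm cnorm0.
have [ft|/boundary_singular ->] := pselect (regular f t); last by rewrite lerDr.
apply: (@le_trans _ _ M); last by rewrite lerDl rnorm_ge0.
apply/ler_addgt0Pr => e e0.
have [N /(_ N (leqnn N)) hN] := (cvg_seq_rnormP _ _).1 (regular_seq ft) e e0.
rewrite -[boundary f _](subrK (f ((radius N)%:C * cis t))).
apply: le_trans (rnormD _ _) _; rewrite addrC; apply: lerD; last exact: ltW.
by apply: fM; apply: disc_scale_cis; rewrite radius_ge0 radius_lt1.
Qed.

Lemma H2_boundary (f : C -> E) : H2 f -> exists a,
  [/\ forall z, disc z -> psums a z (f z), L2 (boundary f),
      {ae mu, forall t, @angles R t -> regular f t} &
      forall n x, fourier (boundary f) n x = 2 * pi * rdot (a n) x].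
Proof.
move=> /H2_power_series[a [K [ha aK]]]; exists a; split=> //.
- apply/L2P; split; last exact: boundary_sqint ha aK.
  by apply: bmeasurable_boundary => //; exists a.
- exact: regular_ae ha aK.
- by move=> n x; exact: fourier_boundary ha aK.
Qed.

Lemma ReL2dot (u v : C -> E) : complex.Re (L2dot u v) =
  (2 * pi)^-1 * \int[mu]_(t in @angles R) rdot (u (cis t)) (v (cis t)).
Proof. by rewrite /L2dot ReZ. Qed.

(** Orthogonality of [u - P u] to monomials alone fixes the Taylor coefficients of [P u], hence
    [P u] on the disc. *)
Lemma orthoproj_power_series (P : (C -> E) -> C -> E) (u : C -> E) :
  is_orthoproj_L2_H2 P -> L2 u -> exists b, (forall z, disc z -> psums b z (P u z)) /\
    forall n x, fourier u n x = 2 * pi * rdot (b n) x.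
Proof.
move=> hP Lu; have [HPu orth] := hP u Lu.
have [b [hb LPu _ fb]] := H2_boundary HPu; exists b; split=> // n x; rewrite -fb.
have /L2P[mu_ su] := Lu; have /L2P[mP sP] := LPu.
apply/eqP; rewrite -subr_eq0 -fourierB//.
have := congr1 (@complex.Re R) (orth _ (monomial_H2 n x)); rewrite ReL2dot.
under eq_Rintegral do rewrite boundary_monomial.
by move/eqP; rewrite mulf_eq0 invr_eq0 gt_eqF ?twopi_gt0.
Qed.

End boundary_bounds.

Section creation_adjoint.
Context {R : realType} {E : hilbertType R} (E2 : hilbert_tensor_square E).
Local Notation mu := (@lebesgue_measure R).
Local Notation C := R[i].
Let measurable_anglesR : measurable (@angles R). Proof. exact: measurable_angles. Qed.
#[local] Hint Resolve measurable_anglesR : core.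

Lemma adjoint_power_series (A : (C -> E) -> C -> E2) (B : (C -> E2) -> C -> E) (u : C -> E2) :
  is_adjoint_H2 A B -> H2wedge u -> exists b, (forall z, disc z -> psums b z (B u z)) /\
    forall n x, \int[mu]_(t in @angles R)
      rdot (boundary (A (monomial n x)) (cis t)) (boundary u (cis t)) = 2 * pi * rdot (b n) x.
Proof.
move=> hAB Hu; have [HBu adj] := hAB u Hu.
have [b [hb _ _ fb]] := H2_boundary HBu; exists b; split=> // n x; rewrite -fb.
have := congr1 (@complex.Re R) (adj _ (monomial_H2 n x)); rewrite /H2dot !ReL2dot.
have /mulfI inj : (2 * pi : R)^-1 != 0 by rewrite invr_eq0 gt_eqF ?twopi_gt0.
move=> /inj ->; apply: eq_Rintegral => t _.
by rewrite boundary_monomial rdotC.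
Qed.

Let ae_filter : Filter (almost_everywhere mu).
Proof. exact: ae_filter_ringOfSetsType. Qed.

Lemma wedge_dot_alpha (f g x h : E) :
  <| wedge E2 x h, wedge E2 f g |> = <| h, <| f, x |> *: g - <| g, x |> *: f |>.
Proof. by rewrite wedge_dot dotBr !dotZr (dotC x f) (dotC x g). Qed.

(** The formula for [alpha] is assumed almost everywhere only, so that one statement serves both
    parts of the theorem. *)
Lemma creation_adjoint_eq (xi f g alpha : C -> E) (P : (C -> E) -> C -> E)
    (B : (C -> E2) -> C -> E) :
  Hinfty xi -> Hinfty f -> H2 g -> is_orthoproj_L2_H2 P ->
  is_adjoint_H2 (creation E2 xi) B -> L2 alpha ->
  {ae mu, forall t, @angles R t -> alpha (cis t) =
    <| boundary f (cis t), boundary xi (cis t) |> *: boundary g (cis t) -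
    <| boundary g (cis t), boundary xi (cis t) |> *: boundary f (cis t)} ->
  forall z, disc z -> B (pwedge E2 f g) z = P alpha z.
Proof.
move=> Hxi Hf Hg hP hB La aeq.
have [b [hb fb]] := orthoproj_power_series hP La.
have Hw := pwedge_H2 E2 Hf Hg.
have [c [hc fc]] := adjoint_power_series hB Hw.
apply: (power_series_ext hc hb) => n x.
have /mulfI inj : (2 * pi : R) != 0 by rewrite gt_eqF ?twopi_gt0.
apply: inj; rewrite -fb -fc.
have [_ [_ _ rxi _]] := H2_boundary (Hinfty_H2 Hxi).
have [_ [_ _ rf _]] := H2_boundary (Hinfty_H2 Hf).
have [_ [_ _ rg _]] := H2_boundary Hg.
have [_ [_ axi _]] := Hinfty_power_series Hxi.
have [_ [_ af _]] := Hinfty_power_series Hf.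
have ag : has_power_series g by have [d [hd _]] := H2_boundary Hg; exists d.
have aw := pwedge_power_series E2 af ag.
have ac := pwedge_power_series E2 axi (monomial_power_series n x).
have /L2P[ma _] := La.
have m1 : measurable_fun (@angles R) (fun t =>
    rdot (boundary (creation E2 xi (monomial n x)) (cis t)) (boundary (pwedge E2 f g) (cis t))).
  apply: measurable_rdot => //; first exact: bmeasurable_boundary.
    exact: bmeasurable_boundary.
  (* The sum demanded by polarization is a continuous function of the two boundary values. *)
  apply: bmeasurable_boundary2 => //; exact: jointly_continuousD.
have m2 : measurable_fun (@angles R) (fun t => rdot (alpha (cis t)) (cis t ^+ n *: x)).
  exact: measurable_rdot_cis.
have ae12 : {ae mu, forall t, @angles R t ->
    (rdot (boundary (creation E2 xi (monomial n x)) (cis t)) (boundary (pwedge E2 f g) (cis t)))%:E =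
    (rdot (alpha (cis t)) (cis t ^+ n *: x))%:E}.
  have FI := @filterI _ _ ae_filter.
  have := FI _ _ (FI _ _ rxi rf) (FI _ _ rg aeq).
  apply: (@filterS _ _ ae_filter) => t [[h1 h2] [h3 h4]] t01; congr EFin.
  have [hm hme] := monomial_boundaryE n x t.
  have [_ ->] := pwedge_regular E2 (h2 t01) (h3 t01).
  have [_ ->] := pwedge_regular E2 (h1 t01) hm.
  by rewrite hme h4// /rdot wedge_dot_alpha -/(rdot _ _) rdotC.
rewrite /fourier /Rintegral; congr fine; apply: ae_eq_integral => //.
- exact/measurable_EFinP.
- exact/measurable_EFinP.
Qed.

End creation_adjoint.

Section symbols.
Context {R : realType} {E : hilbertType R}.
Local Notation mu := (@lebesgue_measure R).
Local Notation C := R[i].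
Let measurable_anglesR : measurable (@angles R). Proof. exact: measurable_angles. Qed.
#[local] Hint Resolve measurable_anglesR : core.

Lemma rnorm_dotZ_le (x y z : E) : rnorm (<| x, y |> *: z) <= rnorm x * rnorm y * rnorm z.
Proof. by rewrite rnormZ ler_wpM2r ?rnorm_ge0// cnorm_dot_le. Qed.

Lemma rnorm_rank_one_le (u : C -> E) w (x : E) :
  rnorm (rank_one u u w x) <= rnorm (u w) ^+ 2 * rnorm x.
Proof.
by apply: le_trans (rnorm_dotZ_le _ _ _) _; rewrite -mulrA -expr2 mulrC.
Qed.

Lemma singular_regular (f : C -> E) (t : R) : ~ singular_set f (cis t) <-> regular f t.
Proof.
split=> [h|ft [_]//]; apply: contrapT => ft; apply: h.
by split; [exact: circle_cis | exact: ft].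
Qed.

Lemma alpha_exists (xi f g : C -> E) : Hinfty xi -> Hinfty f -> H2 g ->
  exists alpha, is_alpha xi f g alpha.
Proof.
move=> /Hinfty_power_series[M [M0 axi xiM]] /Hinfty_power_series[M' [M'0 af fM]] Hg.
have [a [ha /L2P[mbg sg] _ _]] := H2_boundary Hg.
have ag : has_power_series g by exists a.
pose S := singular_set f `|` singular_set xi `|` singular_set g.
pose F (x y z : E) : E := <| x, y |> *: z - <| z, y |> *: x.
(* The value on the singular sets is free; taking 0 there leaves two pieces to check for
   measurability, one of them a limit of continuous functions of three arguments. *)
pose alpha w := if `[< S w >] then 0 else F (boundary f w) (boundary xi w) (boundary g w).
pose Reg := regular f `&` regular xi `&` regular g.
have SP t : Reg t <-> ~ S (cis t).
  rewrite /Reg /S; split=> [[[/singular_regular h1 /singular_regular h2] /singular_regular h3]|h].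
    by move=> [[]|].
  by split; first split; apply/singular_regular => h'; apply: h;
    [left; left|left; right|right].
have alphaE t : Reg t -> alpha (cis t) =
    F (boundary f (cis t)) (boundary xi (cis t)) (boundary g (cis t)).
  by move=> /SP h; rewrite /alpha asboolF.
have alpha0 t : ~ Reg t -> alpha (cis t) = 0.
  by move=> h; rewrite /alpha asboolT//; apply: contrapT => /SP.
have Fcvg T (G : set_system T) (FG : Filter G) (u v w : T -> E) x y z :
    u t @[t --> G] --> x -> v t @[t --> G] --> y -> w t @[t --> G] --> z ->
    F (u t) (v t) (w t) @[t --> G] --> F x y z.
  by move=> hu hv hw; apply: cvgB; exact: dotZ_cvg.
have mReg : measurable Reg.
  by do 2?[apply: measurableI]; exact: measurable_regular.
have malpha : bmeasurable (@angles R) (fun t => alpha (cis t)).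
  rewrite (_ : @angles R = (@angles R `&` Reg) `|` (@angles R `&` ~` Reg)); last first.
    by rewrite -setIUr setUv setIT.
  apply/measurable_funU; [exact: measurableI|apply: measurableI => //; exact: measurableC|split].
  - apply: (bmeasurable_limit (u_ := fun n t => F (f ((radius n)%:C * cis t))
      (xi ((radius n)%:C * cis t)) (g ((radius n)%:C * cis t)))).
    + exact: measurableI.
    + have r0 := @radius_ge0 R; have r1 := @radius_lt1 R.
      by move=> n t; apply: Fcvg; exact: circle_continuous.
    + move=> t [_ tR]; rewrite alphaE//; have [[h1 h2] h3] := tR.
      by apply: Fcvg; exact: regular_seq.
  - apply: (bmeasurable_limit (u_ := fun=> cst 0)) => [|n|t [_ /alpha0->]].
    + by apply: measurableI => //; exact: measurableC.
    + exact: cst_continuous.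
    + exact: cvg_cst.
exists alpha; split; last first.
  by move=> w _ wS; rewrite /alpha asboolF.
apply/L2P; split=> //.
apply: (sqint_dominated (v := boundary g) (k := 2 * ((M' + rnorm (point : E)) * (M + rnorm (point : E))))) => // t.
have p0 := rnorm_ge0 (point : E).
have bf := rnorm_boundary_le fM t; have bxi := rnorm_boundary_le xiM t.
have nf := rnorm_ge0 (boundary f (cis t)); have nxi := rnorm_ge0 (boundary xi (cis t)).
have ng := rnorm_ge0 (boundary g (cis t)).
have [/alphaE ->|/alpha0 ->] := pselect (Reg t); last first.
  by rewrite rnorm0 !mulr_ge0// addr_ge0.
apply: le_trans (rnormB _ _) _; apply: le_trans (lerD (rnorm_dotZ_le _ _ _) (rnorm_dotZ_le _ _ _)) _.
have : rnorm (boundary f (cis t)) * rnorm (boundary xi (cis t)) * rnorm (boundary g (cis t)) <=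
    (M' + rnorm (point : E)) * (M + rnorm (point : E)) * rnorm (boundary g (cis t)).
  by rewrite ler_wpM2r// ler_pM.
have -> : rnorm (boundary g (cis t)) * rnorm (boundary xi (cis t)) * rnorm (boundary f (cis t)) =
    rnorm (boundary f (cis t)) * rnorm (boundary xi (cis t)) * rnorm (boundary g (cis t)) by ring.
rewrite -mulrA; lra.
Qed.

Lemma alpha_ae (xi f g alpha : C -> E) : Hinfty xi -> Hinfty f -> H2 g -> is_alpha xi f g alpha ->
  {ae mu, forall t, @angles R t -> alpha (cis t) =
    <| boundary f (cis t), boundary xi (cis t) |> *: boundary g (cis t) -
    <| boundary g (cis t), boundary xi (cis t) |> *: boundary f (cis t)}.
Proof.
move=> Hxi Hf Hg [_ halpha].
have [_ [_ _ rxi _]] := H2_boundary (Hinfty_H2 Hxi).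
have [_ [_ _ rf _]] := H2_boundary (Hinfty_H2 Hf).
have [_ [_ _ rg _]] := H2_boundary Hg.
have AF : Filter (almost_everywhere mu) by exact: ae_filter_ringOfSetsType.
have FI := @filterI _ _ AF.
have := FI _ _ (FI _ _ rxi rf) rg.
apply: (@filterS _ _ AF) => t [[h1 h2] h3] t01.
apply: halpha; first exact: circle_cis.
by move=> [[]|]; apply/singular_regular; auto.
Qed.

Lemma rank_one_L2 (xi g : C -> E) : Hinfty xi -> H2 g ->
  L2 (fun w => rank_one (boundary xi) (boundary xi) w (boundary g w)).
Proof.
move=> /Hinfty_power_series[M [M0 axi xiM]] Hg.
have [a [ha /L2P[mbg sg] _ _]] := H2_boundary Hg.
have ag : has_power_series g by exists a.
have mb : bmeasurable (@angles R) (fun t =>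
    rank_one (boundary xi) (boundary xi) (cis t) (boundary g (cis t))).
  apply: (bmeasurable_boundary2 (F := fun x y : E => <| y, x |> *: x)) => //.
  by move=> T G FG u v x y hu hv; exact: dotZ_cvg.
apply/L2P; split=> //.
apply: (sqint_dominated (v := boundary g) (k := (M + rnorm (point : E)) ^+ 2)) => // t.
have bxi := rnorm_boundary_le xiM t; have nxi := rnorm_ge0 (boundary xi (cis t)).
apply: le_trans (rnorm_rank_one_le _ _ _) _.
by rewrite ler_wpM2r ?rnorm_ge0// lerXn2r ?nnegrE// (le_trans nxi).
Qed.

Lemma alpha_inner_L2 (xi g : C -> E) : Hinfty xi -> H2 g -> L2 (alpha_inner xi g).
Proof.
move=> Hxi Hg; have /L2P[mb sb] := rank_one_L2 Hxi Hg.
have [M [M0 axi xiM]] := Hinfty_power_series Hxi.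
have [a [ha /L2P[mbg sg] _ _]] := H2_boundary Hg.
have ag : has_power_series g by exists a.
(* The difference is treated as one continuous function of the pair of boundary values of [xi] and
   [g]. *)
have ma : bmeasurable (@angles R) (fun t => alpha_inner xi g (cis t)).
  apply: (bmeasurable_boundary2 (F := fun x y : E => y - <| y, x |> *: x)) => //.
  by move=> T G FG u v x y hu hv; apply: cvgB => //; exact: dotZ_cvg.
apply/L2P; split=> //.
apply: (sqint_dominated (v := boundary g) (k := 1 + (M + rnorm (point : E)) ^+ 2)) => // t.
have bxi := rnorm_boundary_le xiM t; have nxi := rnorm_ge0 (boundary xi (cis t)).
apply: le_trans (rnormB _ _) _; rewrite mulrDl mul1r lerD2l.
apply: le_trans (rnorm_rank_one_le _ _ _) _.
by rewrite ler_wpM2r ?rnorm_ge0// lerXn2r ?nnegrE// (le_trans nxi).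
Qed.

Lemma alpha_inner_ae (xi g : C -> E) : inner xi ->
  {ae mu, forall t, @angles R t -> alpha_inner xi g (cis t) =
    <| boundary xi (cis t), boundary xi (cis t) |> *: boundary g (cis t) -
    <| boundary g (cis t), boundary xi (cis t) |> *: boundary xi (cis t)}.
Proof.
move=> [_]; have AF : Filter (almost_everywhere mu) by exact: ae_filter_ringOfSetsType.
apply: (@filterS _ _ AF) => t h /h h1.
by rewrite dot_normE h1 expr1n scale1r.
Qed.

(** [P] is known only through its defining property, so its additivity, and the fact that it fixes
    [g], are read off Fourier coefficients. *)
Lemma orthoproj_alpha_inner (P : (C -> E) -> C -> E) (xi g : C -> E) :
  is_orthoproj_L2_H2 P -> Hinfty xi -> H2 g -> forall z, disc z ->
  P (alpha_inner xi g) z = g z - toeplitz P (rank_one (boundary xi) (boundary xi)) g z.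
Proof.
move=> hP Hxi Hg; have Lb := rank_one_L2 Hxi Hg; have La := alpha_inner_L2 Hxi Hg.
have [a [ha /L2P[mg sg] _ fg]] := H2_boundary Hg.
have [b [hb fb]] := orthoproj_power_series hP Lb.
have [c [hc fc]] := orthoproj_power_series hP La.
apply: (power_series_ext hc (b := fun k => 1 *: (a k - b k))).
  by move=> z zd; rewrite -[X in psums _ _ X]scale1r; apply: psumsZB; [exact: ha | exact: hb].
move=> n x; have /mulfI inj : (2 * pi : R) != 0 by rewrite gt_eqF ?twopi_gt0.
have /L2P[mb sb] := Lb.
by apply: inj; rewrite scale1r rdotBl mulrBr -fg -fb -fc -fourierB.
Qed.

End symbols.

Theorem theorem4p18 (R : realType) (E : hilbertType R)
    (E2 : hilbert_tensor_square E) (xi : R[i] -> E)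
    (Pplus : (R[i] -> E) -> (R[i] -> E))
    (Cadj : (R[i] -> E2) -> (R[i] -> E)) :
  separable_space E ->
  Hinfty xi ->
  is_orthoproj_L2_H2 Pplus ->
  is_adjoint_H2 (creation E2 xi) Cadj ->
  (forall f g : R[i] -> E, H2 g -> Hinfty f ->
     (exists alpha, is_alpha xi f g alpha) /\
     (forall alpha, is_alpha xi f g alpha ->
        forall z, disc z -> Cadj (pwedge E2 f g) z = Pplus alpha z)) /\
  (inner xi -> forall g : R[i] -> E, H2 g ->
     L2 (alpha_inner xi g) /\
     (forall z, disc z ->
        Cadj (creation E2 xi g) z = Pplus (alpha_inner xi g) z) /\
     (forall z, disc z ->
        Cadj (creation E2 xi g) z =
        g z - toeplitz Pplus (rank_one (boundary xi) (boundary xi)) g z)).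
Proof.
move=> _ Hxi hP hB; split=> [f g Hg Hf|ixi g Hg].
  split=> [|alpha halpha]; first exact: alpha_exists.
  apply: (creation_adjoint_eq Hxi Hf Hg hP hB halpha.1); exact: alpha_ae.
have La := alpha_inner_L2 Hxi Hg.
have eq : forall z, disc z -> Cadj (creation E2 xi g) z = Pplus (alpha_inner xi g) z.
  (* The case [f = xi]: [creation E2 xi g] is by definition [pwedge E2 xi g]. *)
  by apply: (creation_adjoint_eq Hxi Hxi Hg hP hB La); exact: alpha_inner_ae.
split=> //; split=> // z zd; rewrite eq//.
exact: orthoproj_alpha_inner.
Qed.
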